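(* Let $0<q<1$, $\eta:=\frac{q^{1/4}+q^{-1/4}}{2}$, $\gamma:=\frac{2q^{1/4}}{1-q}$, and let $w_1$ be the smallest positive zero of $w\mapsto S_q(\eta;w)$. Assume that $f$ is an entire function of $q$-exponential growth of order less than $2\ln q^{-1}$, or of order $2\ln q^{-1}$ and of type less than $\frac{2\ln 2}{\ln q^{-1}}$. Then $f$ has the expansion $$f(x)=\sum_{k=0}^{\infty} f_k\,\rho_k(x),\qquad f_k:=\frac{q^{\frac{k^2-k}{4}}(1-q)^k}{2^k (q;q)_k}\,(\mathcal{D}_q^k f)(0).$$ If moreover $$\limsup_{n\to\infty}\sqrt[n]{|(\mathcal{D}_q^n f)(0)|\,q^{-n/4}}=\tau,\qquad 0<\tau<\min(1,w_1),$$ then for every $x\in\mathbb{C}$ $$f(x)=2\sum_{k=0}^{\infty}\gamma^{-2k}\,(\mathcal{D}_q^{2k}f)(\eta)\,\mathcal{B}_{2k+1}(x;q)-2\sum_{k=0}^{\infty}\gamma^{-2k}\,(\mathcal{D}_q^{2k}f)(0)\,\beta_{2k+1}(x;q).$$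
   Context: Throughout $0<q<1$; $(a;q)_n=\prod_{j=0}^{n-1}(1-aq^j)$ for $n\in\{0,1,2,\dots\}\cup\{\infty\}$, and $(a,b;q)_n=(a;q)_n(b;q)_n$. Askey--Wilson operator: for $f$ entire put $\breve f(z):=f((z+1/z)/2)$, $x=(z+1/z)/2$, $z=e^{i\theta}$, $x=\cos\theta$. Then $\mathcal{D}_q f(x)=\dfrac{\breve f(q^{1/2}z)-\breve f(q^{-1/2}z)}{i(q^{1/2}-q^{-1/2})\sin\theta}$ (extended by continuity where $\sin\theta=0$), and $\mathcal{D}_q^k$ is its $k$-th iterate. Growth: an entire function $f$ has $q$-exponential growth of order $k$ and (finite) type $\alpha$ if there are a real $K>0$ and real $\alpha$ with $|f(x)|<K|x|^{\alpha}\exp\left(\frac{k\ln^2|x|}{2\ln^2 q}\right)$ for $x\neq0$. The functions $\rho_n$: $\rho_0(x)=1$ and $\rho_n(x)=(1+e^{2i\theta})(-q^{2-n}e^{2i\theta};q^2)_{n-1}e^{-in\theta}$ for $n\ge1$, $x=\cos\theta$ (a polynomial in $x$). The $q$-exponential function: for $|\alpha|<1$, $x=\cos\theta$, $$\mathcal{E}_q(x;\alpha)=\frac{(\alpha^2;q^2)_\infty}{(q\alpha^2;q^2)_\infty}\sum_{n=0}^\infty\frac{(-i\alpha)^n}{(q;q)_n}q^{n^2/4}\left(-ie^{i\theta}q^{(1-n)/2},-ie^{-i\theta}q^{(1-n)/2};q\right)_n=\sum_{n=0}^\infty\frac{q^{n^2/4}}{(q;q)_n}\alpha^n\rho_n(x),$$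 and $(q\alpha^2;q^2)_\infty\mathcal{E}_q(x;\alpha)$ extends to an entire function of $\alpha$, by which $\mathcal{E}_q(x;\alpha)$ is defined for other $\alpha$. One has $\mathcal{E}_q(\eta;w)=\frac{(-w;q^{1/2})_\infty}{(qw^2;q^2)_\infty}$. The basic sine and cosine are defined by $\mathcal{E}_q(x;iw)=C_q(x;w)+iS_q(x;w)$ with $C_q$ even and $S_q$ odd in $w$; in particular $S_q(\eta;w)=\frac{(-iw;q^{1/2})_\infty-(iw;q^{1/2})_\infty}{2i(-qw^2;q^2)_\infty}$. The $q$-Bernoulli polynomials $\mathcal{B}_n(x;q)$ and $\beta_n(x;q)$ are defined by the generating functions (power series in $w$ near $0$) $$\sum_{n=0}^\infty\mathcal{B}_n(x;q)w^n=\frac{w\,\mathcal{E}_q(x;w)}{\mathcal{E}_q(\eta;w)-\mathcal{E}_q(\eta;-w)},\qquad \sum_{n=0}^\infty\beta_n(x;q)w^n=\frac{w\,\mathcal{E}_q(\eta;-w)\,\mathcal{E}_q(x;w)}{\mathcal{E}_q(\eta;w)-\mathcal{E}_q(\eta;-w)}.$$ *)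

(* Defs.v *)
From Stdlib Require Import Reals ClassicalEpsilon.
From Coquelicot Require Import Coquelicot.

Open Scope C_scope.

(** Stdlib reals and Coquelicot's complex numbers.  Throughout [0 < q < 1] is
    real; real powers of [q] are written with [Rpower]. *)

(** The complex number characterised by [P], for a [P] satisfied by exactly one
    number (a limit, the sum of a series); unspecified if there is none. *)
Definition the_C (P : C -> Prop) : C := epsilon (inhabits (RtoC 0)) P.

Definition Cseries (a : nat -> C) : C :=
  the_C (fun l => is_series (K := C_AbsRing) (V := C_NormedModule) a l).

Definition entire (f : C -> C) : Prop :=
  forall x : C, ex_derive (K := C_AbsRing) (V := C_NormedModule) f x.

(** [Rpower 0 y] is [1] in Stdlib, so the root of [0] is treated apart. *)
Definition nroot (n : nat) (x : R) : R :=
  if Rle_dec x 0 then 0%R else Rpower x (/ INR n).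

Fixpoint qpoch (a : C) (q : R) (n : nat) : C :=
  match n with
  | O => 1
  | S m => qpoch a q m * (1 - a * RtoC (q ^ m))
  end.

Definition qpoch_inf (a : C) (q : R) : C :=
  the_C (fun l => filterlim (qpoch a q) eventually
                    (@locally C_UniformSpace l)).

(** The change of variables [x = cos theta], [z = e^{i theta}], theta complex. *)

Definition cosz (z : C) : C := (z + / z) / 2.
Definition sinz (z : C) : C := (z - / z) / (2 * Ci).

(** One of the two solutions [z], [1/z] of [cos theta = x]; every use below is
    invariant under [z -> 1/z]. *)
Definition expi (x : C) : C :=
  epsilon (inhabits (RtoC 1)) (fun z => z <> 0 /\ cosz z = x).

Definition AW_quotient (q : R) (f : C -> C) (x : C) : C :=
  let z := expi x in
  (f (cosz (RtoC (Rpower q (1 / 2)) * z))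
   - f (cosz (RtoC (Rpower q (- (1 / 2))) * z)))
  / (Ci * RtoC (Rpower q (1 / 2) - Rpower q (- (1 / 2))) * sinz z).

Definition AW (q : R) (f : C -> C) (x : C) : C :=
  if Ceq_dec (sinz (expi x)) 0
  then the_C (fun l => filterlim (AW_quotient q f)
                         (@locally' C_UniformSpace x)
                         (@locally C_UniformSpace l))
  else AW_quotient q f x.

Definition AW_iter (q : R) (k : nat) (f : C -> C) : C -> C :=
  Nat.iter k (AW q) f.

Definition q_exp_growth (q : R) (f : C -> C) (k alpha : R) : Prop :=
  exists K : R, (0 < K)%R /\
    forall x : C, x <> 0 ->
      (Cmod (f x) < K * Rpower (Cmod x) alpha
                    * exp (k * ln (Cmod x) ^ 2 / (2 * ln q ^ 2)))%R.

Definition rho (q : R) (n : nat) (x : C) : C :=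
  match n with
  | O => 1
  | S m =>
      let z := expi x in
      (1 + z ^ 2)
      * qpoch (- RtoC (Rpower q (2 - INR n)) * z ^ 2) (q ^ 2) m
      / z ^ n
  end.

(** The q-exponential function on the disc [|alpha| < 1]. *)
Definition qE_disc (q : R) (x alpha : C) : C :=
  let z := expi x in
  qpoch_inf (alpha ^ 2) (q ^ 2) / qpoch_inf (RtoC q * alpha ^ 2) (q ^ 2)
  * Cseries (fun n =>
      let s := RtoC (Rpower q ((1 - INR n) / 2)) in
      (- Ci * alpha) ^ n / qpoch (RtoC q) q n
      * RtoC (Rpower q (INR n ^ 2 / 4))
      * (qpoch (- Ci * z * s) q n * qpoch (- Ci * / z * s) q n)).

(** The entire function of [alpha] that extends
    [(q alpha^2; q^2)_oo * qE_disc q x alpha]. *)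
Definition qE_numerator (q : R) (x : C) : C -> C :=
  epsilon (inhabits (fun _ : C => RtoC 0))
    (fun F => entire F /\
       forall alpha : C, (Cmod alpha < 1)%R ->
         F alpha = qpoch_inf (RtoC q * alpha ^ 2) (q ^ 2) * qE_disc q x alpha).

Definition qE (q : R) (x alpha : C) : C :=
  if Rlt_dec (Cmod alpha) 1 then qE_disc q x alpha
  else qE_numerator q x alpha / qpoch_inf (RtoC q * alpha ^ 2) (q ^ 2).

(** [S_q] is the odd part in [w] of [qE q x (i w)], divided by [i]. *)
Definition qS (q : R) (x w : C) : C :=
  (qE q x (Ci * w) - qE q x (Ci * - w)) / (2 * Ci).

Definition eta (q : R) : C :=
  RtoC ((Rpower q (1 / 4) + Rpower q (- (1 / 4))) / 2).

Definition gamma (q : R) : R := (2 * Rpower q (1 / 4) / (1 - q))%R.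

(** [G] need not be meaningful at [0], where the generating functions below
    read [0 / 0] with value [0] in Coquelicot. *)
Definition generated_by (G : C -> C) (b : nat -> C) : Prop :=
  exists r : R, (0 < r)%R /\
    forall w : C, w <> 0 -> (Cmod w < r)%R ->
      is_pseries (K := C_AbsRing) (V := C_NormedModule) b w (G w).

Definition gen_coef (G : C -> C) : nat -> C :=
  epsilon (inhabits (fun _ : nat => RtoC 0)) (generated_by G).

Definition qBernoulli (q : R) (n : nat) (x : C) : C :=
  gen_coef (fun w =>
    w * qE q x w / (qE q (eta q) w - qE q (eta q) (- w))) n.

Definition qbeta (q : R) (n : nat) (x : C) : C :=
  gen_coef (fun w =>
    w * qE q (eta q) (- w) * qE q x w
    / (qE q (eta q) w - qE q (eta q) (- w))) n.

Definition smallest_positive_zero (g : C -> C) (w1 : R) : Prop :=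
  (0 < w1)%R /\ g (RtoC w1) = 0 /\
  forall w : R, (0 < w < w1)%R -> g (RtoC w) <> 0.

Definition rho_coef (q : R) (f : C -> C) (k : nat) : C :=
  RtoC (Rpower q ((INR k ^ 2 - INR k) / 4) * (1 - q) ^ k)
  / (2 ^ k * qpoch (RtoC q) q k) * AW_iter q k f 0.

(* Main.v *)
Require Import Defs.
From Stdlib Require Import ZArith Arith Reals Lra Lia Psatz Classical ClassicalEpsilon.
From Coquelicot Require Import Coquelicot.

(** The polynomial [rho_n] has the parity of [n]; in [u = x^2] (and after removing a factor [x]
    when [n] is odd) it is a multiple of the Newton polynomial at the nodes
    [- (q^(-m/2) - q^(m/2))^2 / 4] with [m < n - 1] of the parity of [n].  An expansion in the [rho_n]
    is therefore a pair of Newton interpolation series, one for each parity.  Their remainders are obtained by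
    dividing the Taylor series by the factors [u - node]; Cauchy's estimates on the circle
    [|x| = q^(-(N + s/2)) / 2], [s] the parity, make them tend to [0] under the growth hypothesis.
    Taylor's theorem with Cauchy's estimates follows from Goursat's theorem in the coordinate [log x].

    Put [e_n = q^(n^2/4) rho_n / (q;q)_n], so that [D_q e_n = gamma e_(n-1)] and [e_n(0) = 0] for [n > 0].  The lattices
    [z in i q^(Z/2)] and [z in q^(1/4 + Z/2)] avoid the points [x = 1, -1], so the iterates of [D_q] at [0] and
    [eta] only involve finitely many values of [f], and they may be applied term by term.  This gives
    [f = sum d_n e_n] with [d_n = gamma^(-n) D_q^n f(0)].  The same expansion of the polynomials [psi_m] that occur in the
    definition of [E_q], with the q-binomial theorem, gives [E_q(x;w) = sum e_n(x) w^n].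

    Hence [f(x) = L E_q(x;w)] for the linear functional [L w^n = d_n], and
    [gamma^(-2k) D_q^(2k) f(eta) = L (w^(2k) E_q(eta;w))].  With [B] and [beta] the generating functions of the q-Bernoulli
    polynomials, the second expansion is [L] applied to
    [E_q(eta;w) (B(w) - B(-w)) - (beta(w) - beta(-w)) = w E_q(x;w)], divided by [w].  The interchange of sums is justified because
    [|d_n| <= K (theta (1-q)/2)^n] with [theta < 1], while [E_q(eta;w) - E_q(eta;-w)] has no zero
    with [0 < |w| <= (1-q)/2]: the coefficients of its Taylor series decrease fast enough. *)

Open Scope C_scope.

(** The growth threshold is an exact balance. With [L = ln (/ q)], the Newton product over the first
    [n] nodes contributes [exp (- n^2 L)], since the first [n] odd numbers add up to [n^2]. Cauchy's
    estimate at log-radius [n L + d] contributes [exp (n^2 L)], so the quadratic terms cancel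
    precisely at order [2 L]. The linear term that remains is [n (alpha L - 2 ln 2)], negative
    exactly when the type is below [2 ln 2 / L]. The radius [(1-q)/2] of the second part comes from
    [gamma^(-n) = ((1-q)/2)^n q^(-n/4)], which turns the limsup hypothesis into a geometric bound on
    [d_n]. On that disc the constant term of [(E_q(eta;w) - E_q(eta;-w)) / w] dominates the sum of
    all the others, so the quotient series can be bounded coefficient by coefficient. The
    definitions select points, limits and coefficient sequences by [epsilon]. Each selection is
    therefore paired with a uniqueness argument: invariance under [z -> 1/z], uniqueness of limits,
    or uniqueness of power series on a punctured disc. *)

Lemma Cmod_minus_sym (x y : C) : Cmod (x - y) = Cmod (y - x).
Proof. rewrite <- Cmod_opp. f_equal. ring. Qed.

Lemma Cmod_sub_le (x y : C) : (Cmod (x - y) <= Cmod x + Cmod y)%R.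
Proof.
  unfold Cminus. eapply Rle_trans; [apply Cmod_triangle|]. rewrite Cmod_opp. lra.
Qed.

Lemma Cmod_sub_ge (x y : C) : (Cmod x - Cmod y <= Cmod (x - y))%R.
Proof.
  assert (H := Cmod_triangle (x - y) y).
  replace (x - y + y) with x in H by ring. lra.
Qed.

Lemma Cmod_RtoC_pos (x : R) : (0 <= x)%R -> Cmod (RtoC x) = x.
Proof. intros. rewrite Cmod_R. now apply Rabs_pos_eq. Qed.

Lemma Cmod_le_sum (x y : R) : (Cmod (x, y) <= Rabs x + Rabs y)%R.
Proof.
  replace (x, y) with (RtoC x + Ci * RtoC y).
  - eapply Rle_trans; [apply Cmod_triangle|].
    rewrite Cmod_mult, Cmod_Ci, !Cmod_R. lra.
  - unfold Ci, RtoC, Cplus, Cmult; simpl. f_equal; ring.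
Qed.

Lemma Rabs_fst_le (x : C) : (Rabs (fst x) <= Cmod x)%R.
Proof. eapply Rle_trans; [apply Rmax_l|apply Rmax_Cmod]. Qed.

Lemma Rabs_snd_le (x : C) : (Rabs (snd x) <= Cmod x)%R.
Proof. eapply Rle_trans; [apply Rmax_r|apply Rmax_Cmod]. Qed.

Lemma Cmod_small_eq0 (x : C) : (forall eps : R, (0 < eps)%R -> (Cmod x <= eps)%R) -> x = 0.
Proof.
  intros H. apply Cmod_eq_0. apply Rle_antisym; [|apply Cmod_ge_0].
  apply le_epsilon. intros e He. rewrite Rplus_0_l. now apply H.
Qed.

(** * Limits of sequences and absolutely convergent series *)

Definition cv (u : nat -> C) (l : C) : Prop :=
  forall eps : R, (0 < eps)%R ->
    exists N : nat, forall n : nat, (N <= n)%nat -> (Cmod (u n - l) < eps)%R.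

Lemma cv_unique u l l' : cv u l -> cv u l' -> l = l'.
Proof.
  intros H H'. apply Ceq_minus. apply Cmod_small_eq0. intros e He.
  destruct (H (e / 2)%R ltac:(lra)) as [N HN].
  destruct (H' (e / 2)%R ltac:(lra)) as [N' HN'].
  specialize (HN (N + N')%nat ltac:(lia)). specialize (HN' (N + N')%nat ltac:(lia)).
  replace (l - l') with ((u (N + N')%nat - l') - (u (N + N')%nat - l)) by ring.
  eapply Rle_trans; [apply Cmod_sub_le|]. lra.
Qed.

Lemma cv_ext_from N u v l : (forall n, (N <= n)%nat -> u n = v n) -> cv u l -> cv v l.
Proof.
  intros E H e He. destruct (H e He) as [M HM]. exists (N + M)%nat. intros n Hn.
  rewrite <- E by lia. apply HM. lia.
Qed.

Lemma cv_const c : cv (fun _ => c) c.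
Proof. intros e He. exists 0%nat. intros. replace (c - c) with (RtoC 0) by ring. now rewrite Cmod_0. Qed.

Lemma cv_plus u v l m : cv u l -> cv v m -> cv (fun n => u n + v n) (l + m).
Proof.
  intros H K e He. destruct (H (e / 2)%R ltac:(lra)) as [N HN].
  destruct (K (e / 2)%R ltac:(lra)) as [M HM]. exists (N + M)%nat. intros n Hn.
  specialize (HN n ltac:(lia)). specialize (HM n ltac:(lia)).
  replace (u n + v n - (l + m)) with ((u n - l) + (v n - m)) by ring.
  eapply Rle_lt_trans; [apply Cmod_triangle|]. lra.
Qed.

Lemma cv_bounded u l : cv u l -> exists M, (0 < M)%R /\ forall n, (Cmod (u n) <= M)%R.
Proof.
  intros H. destruct (H 1%R ltac:(lra)) as [N HN].
  assert (forall K, exists M, (0 < M)%R /\ forall n, (n < K)%nat -> (Cmod (u n) <= M)%R) as HK.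
  { induction K as [|K [M [HM IH]]].
    - exists 1%R. split; [lra|]. intros. lia.
    - exists (M + Cmod (u K))%R. assert (HK := Cmod_ge_0 (u K)). split; [lra|].
      intros n Hn. destruct (Nat.eq_dec n K) as [->|]; [lra|].
      specialize (IH n ltac:(lia)). lra. }
  destruct (HK N) as [M [HM HM']]. exists (M + Cmod l + 1)%R.
  assert (H0 := Cmod_ge_0 l). split; [lra|]. intros n.
  destruct (le_lt_dec N n) as [Hn|Hn].
  - specialize (HN n Hn). assert (H1 := Cmod_sub_ge (u n) l). lra.
  - specialize (HM' n Hn). lra.
Qed.

Lemma cv_mult u v l m : cv u l -> cv v m -> cv (fun n => u n * v n) (l * m).
Proof.
  intros H K e He. destruct (cv_bounded _ _ H) as [M [HM0 HM]].
  assert (Hm := Cmod_ge_0 m).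
  destruct (H (e / 2 / (Cmod m + 1))%R) as [N1 H1].
  { apply Rdiv_lt_0_compat; lra. }
  destruct (K (e / 2 / M)%R) as [N2 H2].
  { apply Rdiv_lt_0_compat; lra. }
  exists (N1 + N2)%nat. intros n Hn. specialize (H1 n ltac:(lia)). specialize (H2 n ltac:(lia)).
  replace (u n * v n - l * m) with (u n * (v n - m) + (u n - l) * m) by ring.
  eapply Rle_lt_trans; [apply Cmod_triangle|]. rewrite !Cmod_mult.
  assert (Cmod (u n) * Cmod (v n - m) <= M * Cmod (v n - m))%R.
  { apply Rmult_le_compat_r; [apply Cmod_ge_0|apply HM]. }
  assert (M * Cmod (v n - m) < e / 2)%R.
  { apply Rlt_le_trans with (M * (e / 2 / M))%R.
    - now apply Rmult_lt_compat_l.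
    - right. field. lra. }
  assert (Cmod (u n - l) * Cmod m <= e / 2)%R.
  { apply Rle_trans with (e / 2 / (Cmod m + 1) * (Cmod m + 1))%R.
    - apply Rmult_le_compat; [apply Cmod_ge_0|lra|lra|lra].
    - right. field. lra. }
  lra.
Qed.

Lemma cv_scal c u l : cv u l -> cv (fun n => c * u n) (c * l).
Proof. apply cv_mult. apply cv_const. Qed.

Lemma cv_minus u v l m : cv u l -> cv v m -> cv (fun n => u n - v n) (l - m).
Proof.
  intros H K. apply cv_ext_from with 0%nat (fun n => u n + (- (1)) * v n). { intros; ring. }
  replace (l - m) with (l + (- (1)) * m) by ring. apply cv_plus; [easy|]. now apply cv_scal.
Qed.

Lemma cv_le_bound u l M : cv u l -> (forall n, (Cmod (u n) <= M)%R) -> (Cmod l <= M)%R.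
Proof.
  intros H K. apply le_epsilon. intros e He. destruct (H e He) as [N HN].
  specialize (HN N ltac:(lia)). specialize (K N). rewrite Cmod_minus_sym in HN.
  assert (H1 := Cmod_sub_ge l (u N)). lra.
Qed.

Lemma cv_subseq (s : nat -> nat) u l :
  (forall n, (n <= s n)%nat) -> cv u l -> cv (fun n => u (s n)) l.
Proof.
  intros Hs H e He. destruct (H e He) as [N HN]. exists N. intros n Hn.
  apply HN. specialize (Hs n). lia.
Qed.

Lemma cv_of_shift u l : cv (fun n => u (S n)) l -> cv u l.
Proof.
  intros H e He. destruct (H e He) as [N HN]. exists (S N). intros [|n] Hn; [lia|].
  apply HN. lia.
Qed.

(** Neighbourhoods in [C_UniformSpace] are boxes, those of [cv] are discs; passing from boxes to
    discs costs a factor 2. *)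
Lemma cv_filterlim u l : cv u l <-> filterlim u eventually (@locally C_UniformSpace l).
Proof.
  split; intros H.
  - apply filterlim_locally. intros eps. destruct (H eps (cond_pos eps)) as [N HN].
    exists N. intros n Hn. specialize (HN n Hn). split.
    + eapply Rle_lt_trans; [apply (Rabs_fst_le (u n - l))|]. exact HN.
    + eapply Rle_lt_trans; [apply (Rabs_snd_le (u n - l))|]. exact HN.
  - intros e He. assert (He2 : (0 < e / 2)%R) by lra.
    destruct (proj1 (filterlim_locally (U := C_UniformSpace) u l) H (mkposreal _ He2)) as [N HN].
    exists N. intros n Hn. destruct (HN n Hn) as [H1 H2].
    assert (B := Cmod_le_sum (fst (u n - l)) (snd (u n - l))).
    rewrite <- surjective_pairing in B.
    eapply Rle_lt_trans; [exact B|].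
    change (Rabs (fst (u n - l)%C) < e / 2)%R in H1.
    change (Rabs (snd (u n - l)%C) < e / 2)%R in H2. lra.
Qed.

Fixpoint csum (a : nat -> C) (n : nat) : C :=
  match n with O => 0 | S m => csum a m + a m end.

Fixpoint rsum (a : nat -> R) (n : nat) : R :=
  match n with O => 0%R | S m => (rsum a m + a m)%R end.

Lemma csum_ext (a b : nat -> C) n : (forall k, (k < n)%nat -> a k = b k) -> csum a n = csum b n.
Proof. induction n; intros H; simpl; [easy|]. rewrite IHn, H; auto. Qed.

Lemma csum_plus a b n : csum (fun k => a k + b k) n = csum a n + csum b n.
Proof. induction n; simpl; [ring|]. rewrite IHn. ring. Qed.

Lemma csum_minus a b n : csum (fun k => a k - b k) n = csum a n - csum b n.
Proof. induction n; simpl; [ring|]. rewrite IHn. ring. Qed.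

Lemma csum_scal c a n : csum (fun k => c * a k) n = c * csum a n.
Proof. induction n; simpl; [ring|]. rewrite IHn. ring. Qed.

Lemma csum_zero (a : nat -> C) n : (forall k, (k < n)%nat -> a k = 0) -> csum a n = 0.
Proof. induction n; intros H; simpl; [easy|]. rewrite IHn, H; auto. ring. Qed.

Lemma csum_add a n m : csum a (n + m) = csum a n + csum (fun k => a (n + k)%nat) m.
Proof.
  induction m; simpl. { rewrite Nat.add_0_r. ring. }
  rewrite Nat.add_succ_r. simpl. rewrite IHm. ring.
Qed.

Lemma csum_S_l a n : csum a (S n) = a 0%nat + csum (fun k => a (S k)) n.
Proof. change (S n) with (1 + n)%nat. rewrite csum_add. simpl. ring. Qed.

Lemma rsum_S_l a n : rsum a (S n) = (a 0%nat + rsum (fun k => a (S k)) n)%R.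
Proof. induction n; [simpl; ring|]. change (rsum a (S (S n))) with (rsum a (S n) + a (S n))%R. rewrite IHn. simpl. ring. Qed.

Lemma csum_swap (u : nat -> nat -> C) n m :
  csum (fun i => csum (fun j => u i j) m) n = csum (fun j => csum (fun i => u i j) n) m.
Proof.
  induction n; simpl. { now rewrite csum_zero. }
  rewrite IHn, <- csum_plus. reflexivity.
Qed.

Lemma rsum_ext a b n : (forall k, (k < n)%nat -> a k = b k) -> rsum a n = rsum b n.
Proof. induction n; intros H; simpl; [easy|]. rewrite IHn, H; auto. Qed.

Lemma rsum_le a b n : (forall k, (k < n)%nat -> (a k <= b k)%R) -> (rsum a n <= rsum b n)%R.
Proof. induction n; intros H; simpl; [lra|]. apply Rplus_le_compat; auto. Qed.

Lemma rsum_scal c a n : rsum (fun k => c * a k)%R n = (c * rsum a n)%R.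
Proof. induction n; simpl; [ring|]. rewrite IHn. ring. Qed.

Lemma rsum_pos a n : (forall k, (k < n)%nat -> (0 <= a k)%R) -> (0 <= rsum a n)%R.
Proof. induction n; intros H; simpl; [lra|]. apply Rplus_le_le_0_compat; auto. Qed.

Lemma rsum_mono a n m : (forall k, (0 <= a k)%R) -> (n <= m)%nat -> (rsum a n <= rsum a m)%R.
Proof. intros H Hm. induction Hm; simpl; [lra|]. specialize (H m). lra. Qed.

Lemma rsum_add a n m : rsum a (n + m) = (rsum a n + rsum (fun k => a (n + k)%nat) m)%R.
Proof.
  induction m; simpl. { rewrite Nat.add_0_r. ring. }
  rewrite Nat.add_succ_r. simpl. rewrite IHm. ring.
Qed.

Lemma rsum_term a n k : (forall k, (0 <= a k)%R) -> (k < n)%nat -> (a k <= rsum a n)%R.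
Proof.
  intros H Hk. apply Rle_trans with (rsum a (S k)).
  - simpl. assert (0 <= rsum a k)%R by (apply rsum_pos; auto). lra.
  - now apply rsum_mono.
Qed.

Lemma rsum_geom_le t n : (0 <= t < 1)%R -> (rsum (fun k => t ^ k) n <= / (1 - t))%R.
Proof.
  intros Ht. assert (H : (rsum (fun k => t ^ k) n * (1 - t) = 1 - t ^ n)%R).
  { induction n; simpl; [ring|]. rewrite Rmult_plus_distr_r, IHn. ring. }
  assert (0 <= t ^ n)%R by (apply pow_le; lra).
  apply Rmult_le_reg_r with (1 - t)%R; [lra|]. rewrite H, Rinv_l; lra.
Qed.

Lemma Cmod_csum a n : (Cmod (csum a n) <= rsum (fun k => Cmod (a k)) n)%R.
Proof.
  induction n; simpl. { rewrite Cmod_0. lra. }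
  eapply Rle_trans; [apply Cmod_triangle|]. lra.
Qed.

Lemma sum_n_csum a n : sum_n (G := C_AbelianMonoid) a n = csum a (S n).
Proof.
  induction n. { rewrite sum_O. simpl. symmetry. apply Cplus_0_l. }
  rewrite sum_Sn, IHn. reflexivity.
Qed.

Lemma is_series_cv a l :
  is_series (K := C_AbsRing) (V := C_NormedModule) a l <-> cv (csum a) l.
Proof.
  unfold is_series. split; intros H.
  - apply cv_of_shift.
    apply cv_ext_from with 0%nat (sum_n (G := C_AbelianMonoid) a).
    { intros. apply sum_n_csum. }
    apply cv_filterlim. exact H.
  - apply (cv_filterlim (sum_n (G := C_AbelianMonoid) a)).
    apply cv_ext_from with 0%nat (fun n => csum a (S n)).
    { intros. symmetry. apply sum_n_csum. }
    apply (cv_subseq S); [lia|easy].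
Qed.

Definition summable (a : nat -> C) : Prop :=
  exists M : R, forall n, (rsum (fun k => Cmod (a k)) n <= M)%R.

Lemma rsum_tail a M : (forall k, (0 <= a k)%R) -> (forall n, (rsum a n <= M)%R) ->
  forall eps, (0 < eps)%R -> exists N, forall n m, (N <= n)%nat -> (rsum (fun k => a (n + k)%nat) m < eps)%R.
Proof.
  intros H HM eps He.
  destruct (completeness (fun x => exists n, x = rsum a n)) as [l [Hl1 Hl2]].
  { exists M. intros x [n ->]. apply HM. }
  { exists 0%R, 0%nat. reflexivity. }
  assert (exists N, (l - eps < rsum a N)%R) as [N HN].
  { apply NNPP. intros C. assert (l <= l - eps)%R; [|lra]. apply Hl2.
    intros x [n ->]. apply Rnot_lt_le. intros C'. apply C. now exists n. }
  exists N. intros n m Hn.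
  assert (rsum a (n + m) <= l)%R by (apply Hl1; now exists (n + m)%nat).
  assert (rsum a N <= rsum a n)%R by now apply rsum_mono.
  rewrite rsum_add in H0. lra.
Qed.

(** Both components are 1-Lipschitz for [Cmod], so completeness of the reals supplies their
    limits. *)
Lemma cauchy_cv (u : nat -> C) :
  (forall eps, (0 < eps)%R -> exists N, forall n m, (N <= n)%nat -> (Cmod (u (n + m)%nat - u n) < eps)%R) ->
  exists l, cv u l.
Proof.
  intros H.
  assert (forall p : C -> R, (forall x y, (Rabs (p x - p y) <= Cmod (x - y))%R) ->
            exists l, forall eps, (0 < eps)%R -> exists N, forall n, (N <= n)%nat -> (Rabs (p (u n) - l) < eps)%R) as K.
  { intros p Hp. destruct (Rcomplete.R_complete (fun n => p (u n))) as [l Hl].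
    - intros eps He. destruct (H (eps / 2)%R ltac:(lra)) as [N HN]. exists N. intros n m Hn Hm.
      unfold Rdist. 
      assert (A1 := HN N (n - N)%nat ltac:(lia)). assert (A2 := HN N (m - N)%nat ltac:(lia)).
      replace (N + (n - N))%nat with n in A1 by lia.
      replace (N + (m - N))%nat with m in A2 by lia.
      assert (B1 := Hp (u n) (u N)). assert (B2 := Hp (u m) (u N)).
      replace (p (u n) - p (u m))%R with ((p (u n) - p (u N)) - (p (u m) - p (u N)))%R by ring.
      eapply Rle_lt_trans; [apply Rabs_triang|]. rewrite Rabs_Ropp. lra.
    - exists l. intros eps He. destruct (Hl eps He) as [N HN]. exists N. intros n Hn. now apply HN. }
  destruct (K fst) as [l1 H1]. { intros x y. apply (Rabs_fst_le (x - y)). }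
  destruct (K snd) as [l2 H2]. { intros x y. apply (Rabs_snd_le (x - y)). }
  exists (l1, l2). intros e He.
  destruct (H1 (e / 2)%R ltac:(lra)) as [N1 HN1]. destruct (H2 (e / 2)%R ltac:(lra)) as [N2 HN2].
  exists (N1 + N2)%nat. intros n Hn.
  specialize (HN1 n ltac:(lia)). specialize (HN2 n ltac:(lia)).
  eapply Rle_lt_trans; [apply (Cmod_le_sum (fst (u n) - l1) (snd (u n) - l2))|]. lra.
Qed.

Lemma csum_block a n m : csum a (n + m) - csum a n = csum (fun k => a (n + k)%nat) m.
Proof. rewrite csum_add. ring. Qed.

Lemma summable_cv a : summable a -> exists l, cv (csum a) l.
Proof.
  intros [M HM]. apply cauchy_cv. intros eps He.
  destruct (rsum_tail (fun k => Cmod (a k)) M ltac:(intros; apply Cmod_ge_0) HM eps He) as [N HN].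
  exists N. intros n m Hn. rewrite csum_block.
  eapply Rle_lt_trans; [apply Cmod_csum|]. now apply HN.
Qed.

Lemma summable_le a (b : nat -> R) M :
  (forall k, (Cmod (a k) <= b k)%R) -> (forall n, (rsum b n <= M)%R) -> summable a.
Proof.
  intros H HM. exists M. intros n. eapply Rle_trans; [|apply HM]. apply rsum_le. auto.
Qed.

Lemma summable_geom a K t : (0 <= t < 1)%R -> (forall k, (Cmod (a k) <= K * t ^ k)%R) -> summable a.
Proof.
  intros Ht H. apply summable_le with (fun k => K * t ^ k)%R (K * / (1 - t))%R; auto.
  intros n. rewrite rsum_scal. apply Rmult_le_compat_l; [|now apply rsum_geom_le].
  specialize (H 0%nat). assert (H0 := Cmod_ge_0 (a 0%nat)). simpl in H. lra.
Qed.

(** The first [n] rows, cut at a late column [j], and the first [n] full columns differ only by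
    entries in columns from [n] on. Their total is a tail of the absolutely convergent sum over
    columns. Row [k] starts on the diagonal, at column [k]. *)
Lemma fubini_triangular (u : nat -> nat -> C) (r : nat -> C) (s : C) :
  (exists M, forall n, (rsum (fun m => rsum (fun k => Cmod (u k m)) (S m)) n <= M)%R) ->
  (forall k, cv (csum (fun j => u k (k + j)%nat)) (r k)) ->
  cv (csum (fun m => csum (fun k => u k m) (S m))) s ->
  cv (csum r) s.
Proof.
  intros [M HM] HR Hs eps He.
  set (A := fun m => rsum (fun k => Cmod (u k m)) (S m)) in HM.
  assert (HA : forall m, (0 <= A m)%R). { intros. apply rsum_pos. intros; apply Cmod_ge_0. }
  destruct (rsum_tail A M HA HM (eps / 4)%R ltac:(lra)) as [N1 HN1].
  destruct (Hs (eps / 4)%R ltac:(lra)) as [N2 HN2].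
  exists (N1 + N2)%nat. intros n Hn.
  assert (E1 : exists J, forall j, (J <= j)%nat ->
     (Cmod (csum (fun k => csum (fun i => u k (k + i)%nat) (j - k)) n - csum r n) < eps / 4)%R).
  { assert (cv (fun j => csum (fun k => csum (fun i => u k (k + i)%nat) (j - k)) n) (csum r n)) as HC.
    { clear -HR. induction n; simpl. { apply cv_const. }
      apply cv_plus; [easy|]. specialize (HR n). intros e He.
      destruct (HR e He) as [N HN]. exists (N + n)%nat. intros j Hj. apply HN. lia. }
    apply HC. lra. }
  destruct E1 as [J HJ].
  set (j := (J + n)%nat). specialize (HJ j ltac:(unfold j; lia)).
  assert (E2 : (Cmod (csum (fun k => csum (fun i => u k (k + i)%nat) (j - k)) n
              - csum (fun m => csum (fun k => u k m) (S m)) n) <= eps / 4)%R).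
  (* Both sums are written over a rectangle, with zeros where [k > m], so that the order of
     summation can be exchanged. *)
  { assert (T : csum (fun k => csum (fun i => u k (k + i)%nat) (j - k)) n
       = csum (fun m => csum (fun k => if le_dec k m then u k m else 0) n) j).
    { rewrite (csum_swap (fun m k => if le_dec k m then u k m else 0)). apply csum_ext. intros k Hk.
      replace j with (k + (j - k))%nat at 2 by (unfold j; lia).
      assert (Z : csum (fun i => if le_dec k i then u k i else 0) k = 0).
      { apply csum_zero. intros i Hi. destruct (le_dec k i); [lia|easy]. }
      rewrite csum_add, Z, Cplus_0_l. apply csum_ext. intros i _.
      destruct (le_dec k (k + i)); [easy|lia]. }
    assert (T' : csum (fun m => csum (fun k => u k m) (S m)) n
        = csum (fun m => csum (fun k => if le_dec k m then u k m else 0) n) n).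
    { apply csum_ext. intros m Hm. replace n with (S m + (n - S m))%nat by lia.
      assert (Z : csum (fun i => if le_dec (S m + i) m then u (S m + i)%nat m else 0) (n - S m) = 0).
      { apply csum_zero. intros i Hi. destruct (le_dec (S m + i) m); [lia|easy]. }
      rewrite csum_add, Z, Cplus_0_r. apply csum_ext. intros k Hk.
      destruct (le_dec k m); [easy|lia]. }
    rewrite T, T'. replace j with (n + J)%nat by (unfold j; lia). rewrite csum_block.
    eapply Rle_trans; [apply Cmod_csum|].
    apply Rle_trans with (rsum (fun k => A (n + k)%nat) J).
    - apply rsum_le. intros k Hk. unfold A. eapply Rle_trans; [apply Cmod_csum|].
      replace (S (n + k)) with (n + S k)%nat by lia. rewrite rsum_add.
      assert (0 <= rsum (fun i => Cmod (u (n + i)%nat (n + k)%nat)) (S k))%R.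
      { apply rsum_pos. intros; apply Cmod_ge_0. }
      assert (rsum (fun k0 => Cmod (if le_dec k0 (n + k) then u k0 (n + k)%nat else 0)) n
         <= rsum (fun k0 => Cmod (u k0 (n + k)%nat)) n)%R; [|lra].
      apply rsum_le. intros i Hi. destruct (le_dec i (n + k)); [lra|].
      rewrite Cmod_0. apply Cmod_ge_0.
    - apply Rlt_le. apply HN1. lia. }
  specialize (HN2 n ltac:(lia)).
  set (P := csum (fun k => csum (fun i => u k (k + i)%nat) (j - k)) n) in *.
  set (Q := csum (fun m => csum (fun k => u k m) (S m)) n) in *.
  replace (csum r n - s) with ((P - Q) + (Q - s) - (P - csum r n)) by ring.
  eapply Rle_lt_trans; [apply Cmod_sub_le|].
  assert (B := Cmod_triangle (P - Q) (Q - s)). lra.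
Qed.

Lemma geom_small K t eps : (0 <= t < 1)%R -> (0 < eps)%R ->
  exists N, forall n, (N <= n)%nat -> (K * t ^ n < eps)%R.
Proof.
  intros Ht He.
  assert (P := Rabs_pos K). assert (Q := Rle_abs K).
  destruct (pow_lt_1_zero t ltac:(rewrite Rabs_pos_eq; lra) (eps / (Rabs K + 1))%R) as [N HN].
  { apply Rdiv_lt_0_compat; lra. }
  exists N. intros n Hn. specialize (HN n ltac:(lia)).
  assert (T : (0 <= t ^ n)%R) by (apply pow_le; lra). rewrite Rabs_pos_eq in HN by easy.
  apply Rle_lt_trans with ((Rabs K + 1) * t ^ n)%R; [apply Rmult_le_compat_r; lra|].
  apply Rlt_le_trans with ((Rabs K + 1) * (eps / (Rabs K + 1)))%R.
  - apply Rmult_lt_compat_l; lra.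
  - right. field. lra.
Qed.

Lemma cv_0_geom u K t : (0 <= t < 1)%R -> (forall n, (Cmod (u n) <= K * t ^ n)%R) -> cv u 0.
Proof.
  intros Ht H e He. destruct (geom_small K t e Ht He) as [N HN]. exists N. intros n Hn.
  replace (u n - 0) with (u n) by ring. eapply Rle_lt_trans; [apply H|auto].
Qed.

(** * Continuity and Caratheodory differentiability *)

Definition ccont (f : C -> C) (x : C) : Prop :=
  forall eps : R, (0 < eps)%R -> exists d : R, (0 < d)%R /\
    forall y, (Cmod (y - x) < d)%R -> (Cmod (f y - f x) < eps)%R.

(** Caratheodory's form of differentiability: the slope [phi] is defined on all of [C] and
    continuous at [x]. Product and chain rules become algebra, and the slope itself is what gets
    integrated in Cauchy's theorem. *)
Definition cdiff (f : C -> C) (x : C) : Prop :=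
  exists phi : C -> C, ccont phi x /\ forall y, f y = f x + phi y * (y - x).

Lemma ccont_const c x : ccont (fun _ => c) x.
Proof.
  intros e He. exists 1%R. split; [lra|]. intros. replace (c - c) with (RtoC 0) by ring.
  now rewrite Cmod_0.
Qed.

Lemma ccont_id x : ccont (fun y => y) x.
Proof. intros e He. now exists e. Qed.

Lemma ccont_ext f g x : (forall y, f y = g y) -> ccont f x -> ccont g x.
Proof.
  intros E H e He. destruct (H e He) as [d [Hd K]]. exists d. split; [easy|].
  intros y Hy. rewrite <- !E. now apply K.
Qed.

Lemma ccont_locally_ext f g x r : (0 < r)%R -> (forall y, (Cmod (y - x) < r)%R -> f y = g y) ->
  ccont f x -> ccont g x.
Proof.
  intros Hr E H e He. destruct (H e He) as [d [Hd K]]. exists (Rmin r d).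
  split; [now apply Rmin_pos|]. intros y Hy.
  assert (Rmin r d <= r)%R by apply Rmin_l. assert (Rmin r d <= d)%R by apply Rmin_r.
  rewrite <- !E; [apply K; lra| |lra].
  replace (x - x) with (RtoC 0) by ring. now rewrite Cmod_0.
Qed.

Lemma ccont_plus f g x : ccont f x -> ccont g x -> ccont (fun y => f y + g y) x.
Proof.
  intros H K e He. destruct (H (e / 2)%R ltac:(lra)) as [d1 [Hd1 H1]].
  destruct (K (e / 2)%R ltac:(lra)) as [d2 [Hd2 H2]].
  exists (Rmin d1 d2). split; [now apply Rmin_pos|]. intros y Hy.
  assert (Rmin d1 d2 <= d1)%R by apply Rmin_l. assert (Rmin d1 d2 <= d2)%R by apply Rmin_r.
  specialize (H1 y ltac:(lra)). specialize (H2 y ltac:(lra)).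
  replace (f y + g y - (f x + g x)) with ((f y - f x) + (g y - g x)) by ring.
  eapply Rle_lt_trans; [apply Cmod_triangle|]. lra.
Qed.

Lemma ccont_mult f g x : ccont f x -> ccont g x -> ccont (fun y => f y * g y) x.
Proof.
  intros H K e He. assert (Hf := Cmod_ge_0 (f x)). assert (Hg := Cmod_ge_0 (g x)).
  set (B := (Cmod (f x) + Cmod (g x) + 1)%R).
  assert (HB : (1 <= B)%R) by (unfold B; lra).
  set (e' := Rmin 1 (e / (2 * B))%R).
  assert (He' : (0 < e')%R). { apply Rmin_pos; [lra|]. apply Rdiv_lt_0_compat; lra. }
  assert (He1 : (e' <= 1)%R) by apply Rmin_l.
  assert (He2 : (e' <= e / (2 * B))%R) by apply Rmin_r.
  assert (He3 : (e' * (2 * B) <= e)%R).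
  { apply Rle_trans with (e / (2 * B) * (2 * B))%R.
    - apply Rmult_le_compat_r; lra.
    - right. field. lra. }
  destruct (H e' He') as [d1 [Hd1 H1]].
  destruct (K e' He') as [d2 [Hd2 H2]].
  exists (Rmin d1 d2). split; [now apply Rmin_pos|]. intros y Hy.
  assert (Rmin d1 d2 <= d1)%R by apply Rmin_l. assert (Rmin d1 d2 <= d2)%R by apply Rmin_r.
  specialize (H1 y ltac:(lra)). specialize (H2 y ltac:(lra)).
  replace (f y * g y - f x * g x)
    with ((f y - f x) * (g y - g x) + (f x * (g y - g x) + (f y - f x) * g x)) by ring.
  eapply Rle_lt_trans; [apply Cmod_triangle|].
  assert (T := Cmod_triangle (f x * (g y - g x)) ((f y - f x) * g x)).
  rewrite !Cmod_mult in *.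
  assert (A2 := Cmod_ge_0 (g y - g x)).
  unfold B in *. nra.
Qed.

Lemma ccont_comp f g x : ccont f x -> ccont g (f x) -> ccont (fun y => g (f y)) x.
Proof.
  intros H K e He. destruct (K e He) as [d [Hd K']]. destruct (H d Hd) as [d' [Hd' H']].
  exists d'. split; [easy|]. intros y Hy. apply K', H', Hy.
Qed.

Lemma ccont_inv (x : C) : x <> 0 -> ccont Cinv x.
Proof.
  intros Hx e He. assert (H := proj1 (Cmod_gt_0 x) Hx). set (m := Cmod x) in *.
  exists (Rmin (m / 2) (e * (m * m) / 2)). split.
  { apply Rmin_pos; [lra|]. apply Rdiv_lt_0_compat; [|lra]. apply Rmult_lt_0_compat; [lra|].
    now apply Rmult_lt_0_compat. }
  intros y Hy. assert (Rmin (m / 2) (e * (m * m) / 2) <= m / 2)%R by apply Rmin_l.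
  assert (Rmin (m / 2) (e * (m * m) / 2) <= e * (m * m) / 2)%R by apply Rmin_r.
  assert (Hm : (m / 2 < Cmod y)%R).
  { assert (T := Cmod_sub_ge x y). rewrite Cmod_minus_sym in T. fold m in T. lra. }
  assert (Hy0 : y <> 0). { intros ->. rewrite Cmod_0 in Hm. lra. }
  replace (/ y - / x) with ((x - y) * (/ x * / y)) by (field; auto).
  rewrite !Cmod_mult, Cmod_minus_sym, !Cmod_inv; auto. fold m.
  apply Rlt_le_trans with (e * (m * m) / 2 * (/ m * / Cmod y))%R.
  - apply Rmult_lt_compat_r; [|lra]. apply Rmult_lt_0_compat; apply Rinv_0_lt_compat; lra.
  - apply Rle_trans with (e * (m * m) / 2 * (/ m * / (m / 2)))%R.
    + apply Rmult_le_compat_l. { nra. }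
      apply Rmult_le_compat_l. { apply Rlt_le, Rinv_0_lt_compat; lra. }
      apply Rinv_le_contravar; lra.
    + right. field. lra.
Qed.

Lemma cdiff_ccont f x : cdiff f x -> ccont f x.
Proof.
  intros [phi [H E]]. apply ccont_ext with (fun y => f x + phi y * (y + (- x))).
  { intros y. rewrite (E y). ring. }
  apply ccont_plus; [apply ccont_const|]. apply ccont_mult; [easy|].
  apply ccont_plus; [apply ccont_id|apply ccont_const].
Qed.

Lemma cdiff_const c x : cdiff (fun _ => c) x.
Proof. exists (fun _ => 0). split; [apply ccont_const|]. intros. ring. Qed.

Lemma cdiff_id x : cdiff (fun y => y) x.
Proof. exists (fun _ => 1). split; [apply ccont_const|]. intros. ring. Qed.

Lemma cdiff_plus f g x : cdiff f x -> cdiff g x -> cdiff (fun y => f y + g y) x.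
Proof.
  intros [p [Hp Ep]] [r [Hr Er]]. exists (fun y => p y + r y). split.
  - now apply ccont_plus.
  - intros y. rewrite (Ep y), (Er y). ring.
Qed.

Lemma cdiff_mult f g x : cdiff f x -> cdiff g x -> cdiff (fun y => f y * g y) x.
Proof.
  intros [p [Hp Ep]] Hg. assert (Cg := cdiff_ccont g x Hg). destruct Hg as [r [Hr Er]].
  exists (fun y => p y * g y + f x * r y). split.
  - apply ccont_plus; apply ccont_mult; auto. apply ccont_const.
  - intros y. rewrite (Ep y), (Er y). ring.
Qed.

Lemma cdiff_comp f g x : cdiff f x -> cdiff g (f x) -> cdiff (fun y => g (f y)) x.
Proof.
  intros Hf [r [Hr Er]]. assert (Cf := cdiff_ccont f x Hf). destruct Hf as [p [Hp Ep]].
  exists (fun y => r (f y) * p y). split.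
  - apply ccont_mult; [|easy]. now apply (ccont_comp f r).
  - intros y. rewrite (Er (f y)), (Ep y). ring.
Qed.

Lemma cdiff_inv (x : C) : x <> 0 -> cdiff Cinv x.
Proof.
  (* At [y = 0] the convention [/ 0 = 0] forces the slope [/ x * / x]; continuity at [x] does not
     see this value. *)
  intros Hx. exists (fun y => if Ceq_dec y 0 then / x * / x else - (/ x * / y)). split.
  - apply (ccont_locally_ext (fun y => - (1) * (/ x * / y)) _ _ (Cmod x)).
    + now apply Cmod_gt_0.
    + intros y Hy. destruct (Ceq_dec y 0) as [->|_]; [|ring].
      exfalso. replace (0 - x) with (- x) in Hy by ring. rewrite Cmod_opp in Hy. lra.
    + apply ccont_mult; [apply ccont_const|]. apply ccont_mult; [apply ccont_const|].
      now apply ccont_inv.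
  - intros y. destruct (Ceq_dec y 0) as [->|Hy]; [|now field].
    replace (/ 0) with (RtoC 0); [now field|].
    unfold Cinv, RtoC; simpl. f_equal; unfold Rdiv; ring.
Qed.

Lemma cdiff_pow f n x : cdiff f x -> cdiff (fun y => f y ^ n) x.
Proof.
  intros H. induction n; simpl; [apply cdiff_const|]. now apply cdiff_mult.
Qed.

Lemma entire_cdiff f : entire f -> forall x, cdiff f x.
Proof.
  intros H x. destruct (H x) as [l [_ Hl]].
  exists (fun y => if Ceq_dec y x then l else (f y - f x) / (y - x)). split.
  - intros e He. 
    destruct (Hl x (fun P HP => HP) (mkposreal (e / 2) ltac:(lra))) as [d Hd].
    exists d. split; [apply cond_pos|]. intros y Hy.
    destruct (Ceq_dec x x) as [_|C]; [|easy].
    destruct (Ceq_dec y x) as [->|Hn].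
    { replace (l - l) with (RtoC 0) by ring. now rewrite Cmod_0. }
    assert (Hyx : y - x <> 0). { intros C. apply Hn. now apply Ceq_minus. }
    specialize (Hd y).
    assert (D : (Cmod (f y - f x - (y - x) * l) <= e / 2 * Cmod (y - x))%R).
    { apply Hd. exact Hy. }
    replace ((f y - f x) / (y - x) - l) with ((f y - f x - (y - x) * l) * / (y - x)) by (now field).
    rewrite Cmod_mult, Cmod_inv; auto.
    assert (P := proj1 (Cmod_gt_0 _) Hyx).
    apply Rle_lt_trans with (e / 2 * Cmod (y - x) * / Cmod (y - x))%R.
    + apply Rmult_le_compat_r; [|easy]. now apply Rlt_le, Rinv_0_lt_compat.
    + field_simplify; lra.
  - intros y. destruct (Ceq_dec y x) as [->|Hn]; [ring|]. field.
    intros C. apply Hn. now apply Ceq_minus.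
Qed.

(** * Integrals of complex-valued functions of a real variable *)

Definition rcont (h : R -> C) : Prop :=
  forall t eps : R, (0 < eps)%R -> exists d : R, (0 < d)%R /\
    forall s, (Rabs (s - t) < d)%R -> (Cmod (h s - h t) < eps)%R.

Definition cint (h : R -> C) (a b : R) : C :=
  (RInt (fun t => fst (h t)) a b, RInt (fun t => snd (h t)) a b).

Lemma continuous_eps (f : R -> R) (t : R) :
  (forall eps : R, (0 < eps)%R -> exists d : R, (0 < d)%R /\
    forall s, (Rabs (s - t) < d)%R -> (Rabs (f s - f t) < eps)%R) -> continuous f t.
Proof.
  intros H. apply filterlim_locally. intros eps.
  destruct (H eps (cond_pos eps)) as [d [Hd K]]. exists (mkposreal d Hd).
  intros y Hy. now apply K.
Qed.

Lemma rcont_fst h t : rcont h -> continuous (fun t => fst (h t)) t.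
Proof.
  intros H. apply continuous_eps. intros e He. destruct (H t e He) as [d [Hd K]].
  exists d. split; [easy|]. intros s Hs. eapply Rle_lt_trans; [|now apply (K s)].
  apply (Rabs_fst_le (h s - h t)).
Qed.

Lemma rcont_snd h t : rcont h -> continuous (fun t => snd (h t)) t.
Proof.
  intros H. apply continuous_eps. intros e He. destruct (H t e He) as [d [Hd K]].
  exists d. split; [easy|]. intros s Hs. eapply Rle_lt_trans; [|now apply (K s)].
  apply (Rabs_snd_le (h s - h t)).
Qed.

Lemma ex_RInt_fst h a b : rcont h -> ex_RInt (fun t => fst (h t)) a b.
Proof. intros H. apply (ex_RInt_continuous (V := R_CompleteNormedModule)). intros; now apply rcont_fst. Qed.

Lemma ex_RInt_snd h a b : rcont h -> ex_RInt (fun t => snd (h t)) a b.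
Proof. intros H. apply (ex_RInt_continuous (V := R_CompleteNormedModule)). intros; now apply rcont_snd. Qed.

Lemma cint_ext h g a b : (forall t, h t = g t) -> cint h a b = cint g a b.
Proof. intros E. unfold cint. f_equal; apply RInt_ext; intros; now rewrite E. Qed.

Lemma cint_plus h g a b : rcont h -> rcont g -> cint (fun t => h t + g t) a b = cint h a b + cint g a b.
Proof.
  intros H K. unfold cint, Cplus; simpl. f_equal.
  - apply (RInt_plus (V := R_CompleteNormedModule)); now apply ex_RInt_fst.
  - apply (RInt_plus (V := R_CompleteNormedModule)); now apply ex_RInt_snd.
Qed.

Lemma RInt_lin (f g : R -> R) x y a b : ex_RInt f a b -> ex_RInt g a b ->
  RInt (fun t => x * f t + y * g t)%R a b = (x * RInt f a b + y * RInt g a b)%R.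
Proof.
  intros H K. apply is_RInt_unique.
  apply (is_RInt_plus (V := R_NormedModule) (fun t => x * f t)%R (fun t => y * g t)%R).
  - apply (is_RInt_scal (V := R_NormedModule)). now apply (RInt_correct (V := R_CompleteNormedModule)).
  - apply (is_RInt_scal (V := R_NormedModule)). now apply (RInt_correct (V := R_CompleteNormedModule)).
Qed.

Lemma cint_scal c h a b : rcont h -> cint (fun t => c * h t) a b = c * cint h a b.
Proof.
  intros H. assert (E1 := ex_RInt_fst h a b H). assert (E2 := ex_RInt_snd h a b H).
  unfold cint, Cmult; simpl. f_equal.
  - rewrite (RInt_ext _ (fun t => fst c * fst (h t) + (- snd c) * snd (h t))%R) by (intros; match goal with |- ?l = ?r => change (@eq R l r) end; ring).
    rewrite RInt_lin by easy. match goal with |- ?l = ?r => change (@eq R l r) end. ring.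
  - now rewrite RInt_lin by easy.
Qed.

Lemma cint_Chasles h a b c : rcont h -> cint h a b + cint h b c = cint h a c.
Proof.
  intros H. unfold cint, Cplus; simpl. f_equal.
  - apply (RInt_Chasles (V := R_CompleteNormedModule)); now apply ex_RInt_fst.
  - apply (RInt_Chasles (V := R_CompleteNormedModule)); now apply ex_RInt_snd.
Qed.

(** The factor 2 is the price of estimating real and imaginary parts separately. *)
Lemma cint_bound h a b M : rcont h -> (a <= b)%R -> (forall t, (a <= t <= b)%R -> (Cmod (h t) <= M)%R) ->
  (Cmod (cint h a b) <= 2 * M * (b - a))%R.
Proof.
  intros H Hab HM. eapply Rle_trans; [apply Cmod_le_sum|].
  assert (Rabs (RInt (fun t => fst (h t)) a b) <= (b - a) * M)%R.
  { apply abs_RInt_le_const; [easy|now apply ex_RInt_fst|].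
    intros t Ht. eapply Rle_trans; [apply Rabs_fst_le|now apply HM]. }
  assert (Rabs (RInt (fun t => snd (h t)) a b) <= (b - a) * M)%R.
  { apply abs_RInt_le_const; [easy|now apply ex_RInt_snd|].
    intros t Ht. eapply Rle_trans; [apply Rabs_snd_le|now apply HM]. }
  lra.
Qed.

Lemma cint_const c a b : cint (fun _ => c) a b = RtoC (b - a) * c.
Proof.
  unfold cint. rewrite !RInt_const. unfold scal, RtoC, Cmult; simpl. unfold mult; simpl.
  f_equal; ring.
Qed.

Lemma cint_RtoC a b : cint (fun t => RtoC t) a b = RtoC ((b * b - a * a) / 2).
Proof.
  unfold cint; simpl. rewrite RInt_const. unfold scal; simpl. unfold mult; simpl.
  unfold RtoC. f_equal; [|ring].
  apply is_RInt_unique.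
  replace ((b * b - a * a) / 2)%R with (minus (b * b / 2)%R (a * a / 2)%R)
    by (unfold minus, plus, opp; simpl; field).
  apply (is_RInt_derive (V := R_CompleteNormedModule) (fun x => x * x / 2)%R).
  - intros x _. auto_derive; [easy|]. field.
  - intros x _. apply continuous_id.
Qed.

Lemma rcont_const c : rcont (fun _ => c).
Proof. intros t e He. exists 1%R. split; [lra|]. intros. replace (c - c) with (RtoC 0) by ring. now rewrite Cmod_0. Qed.

Lemma rcont_RtoC : rcont RtoC.
Proof. intros t e He. exists e. split; [easy|]. intros s Hs. now rewrite <- RtoC_minus, Cmod_R. Qed.

Lemma rcont_of_ccont (h : C -> C) (p : R -> C) :
  (forall x, ccont h x) -> rcont p -> rcont (fun t => h (p t)).
Proof.
  intros H K t e He. destruct (H (p t) e He) as [d [Hd H']]. destruct (K t d Hd) as [d' [Hd' K']].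
  exists d'. split; [easy|]. intros s Hs. apply H', K', Hs.
Qed.

Lemma rcont_plus h g : rcont h -> rcont g -> rcont (fun t => h t + g t).
Proof.
  intros H K t e He. destruct (H t (e / 2)%R ltac:(lra)) as [d1 [Hd1 H1]].
  destruct (K t (e / 2)%R ltac:(lra)) as [d2 [Hd2 H2]].
  exists (Rmin d1 d2). split; [now apply Rmin_pos|]. intros y Hy.
  assert (Rmin d1 d2 <= d1)%R by apply Rmin_l. assert (Rmin d1 d2 <= d2)%R by apply Rmin_r.
  specialize (H1 y ltac:(lra)). specialize (H2 y ltac:(lra)).
  replace (h y + g y - (h t + g t)) with ((h y - h t) + (g y - g t)) by ring.
  eapply Rle_lt_trans; [apply Cmod_triangle|]. lra.
Qed.

Lemma rcont_scal c h : rcont h -> rcont (fun t => c * h t).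
Proof.
  intros H. apply (rcont_of_ccont (fun z => c * z)); [|easy].
  intros x. apply ccont_mult; [apply ccont_const|apply ccont_id].
Qed.

Lemma rcont_horiz y : rcont (fun x => (x, y)).
Proof.
  intros t e He. exists e. split; [easy|]. intros s Hs.
  replace ((s, y) - (t, y)) with (RtoC (s - t)); [now rewrite Cmod_R|].
  unfold RtoC, Cminus, Cplus, Copp; simpl. f_equal; ring.
Qed.

Lemma rcont_vert x : rcont (fun y => (x, y)).
Proof.
  intros t e He. exists e. split; [easy|]. intros s Hs.
  replace ((x, s) - (x, t)) with (Ci * RtoC (s - t)); [now rewrite Cmod_mult, Cmod_Ci, Cmod_R, Rmult_1_l|].
  unfold Ci, RtoC, Cmult, Cminus, Cplus, Copp; simpl. f_equal; ring.
Qed.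

(** * Goursat's theorem for rectangles *)

(** The integral of [h dz] along the boundary, counterclockwise, with [dz = Ci dy] on the vertical
    sides. *)
Definition rectI (h : C -> C) (a b c d : R) : C :=
  cint (fun x => h (x, c)) a b + Ci * cint (fun y => h (b, y)) c d
  - cint (fun x => h (x, d)) a b - Ci * cint (fun y => h (a, y)) c d.

Lemma rectI_ext h g a b c d : (forall z, h z = g z) -> rectI h a b c d = rectI g a b c d.
Proof.
  intros E. unfold rectI.
  rewrite (cint_ext (fun x => h (x, c)) (fun x => g (x, c))), (cint_ext (fun x => h (x, d)) (fun x => g (x, d))),
    (cint_ext (fun y => h (a, y)) (fun y => g (a, y))), (cint_ext (fun y => h (b, y)) (fun y => g (b, y))) by easy.
  reflexivity.
Qed.

Lemma rectI_split_h h a m b c d : (forall x, ccont h x) ->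
  rectI h a b c d = rectI h a m c d + rectI h m b c d.
Proof.
  intros H. unfold rectI.
  rewrite <- (cint_Chasles (fun x => h (x, c)) a m b), <- (cint_Chasles (fun x => h (x, d)) a m b);
    [ring| |]; apply (rcont_of_ccont h); auto using rcont_horiz.
Qed.

Lemma rectI_split_v h a b c m d : (forall x, ccont h x) ->
  rectI h a b c d = rectI h a b c m + rectI h a b m d.
Proof.
  intros H. unfold rectI.
  rewrite <- (cint_Chasles (fun y => h (a, y)) c m d), <- (cint_Chasles (fun y => h (b, y)) c m d);
    [ring| |]; apply (rcont_of_ccont h); auto using rcont_vert.
Qed.

Lemma rectI_plus h g a b c d : (forall x, ccont h x) -> (forall x, ccont g x) ->
  rectI (fun z => h z + g z) a b c d = rectI h a b c d + rectI g a b c d.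
Proof.
  intros H K. unfold rectI. rewrite !cint_plus; [ring|..];
  first [apply (rcont_of_ccont h)|apply (rcont_of_ccont g)]; auto using rcont_vert, rcont_horiz.
Qed.

Lemma pair_horiz x y : (x, y) = RtoC x + Ci * RtoC y.
Proof. unfold Ci, RtoC, Cplus, Cmult; simpl. f_equal; ring. Qed.

Lemma rectI_affine al be a b c d : rectI (fun z => al + be * z) a b c d = 0.
Proof.
  unfold rectI.
  assert (Hh : forall y, cint (fun x => al + be * (x, y)) a b
     = RtoC (b - a) * (al + be * Ci * RtoC y) + be * RtoC ((b * b - a * a) / 2)).
  { intros y. rewrite (cint_ext _ (fun x => (al + be * Ci * RtoC y) + be * RtoC x)).
    2: { intros t. rewrite pair_horiz. ring. }
    rewrite cint_plus; [|apply rcont_const|apply rcont_scal, rcont_RtoC].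
    now rewrite cint_scal, cint_const, cint_RtoC by apply rcont_RtoC. }
  assert (Hv : forall x, cint (fun y => al + be * (x, y)) c d
     = RtoC (d - c) * (al + be * RtoC x) + be * Ci * RtoC ((d * d - c * c) / 2)).
  { intros x. rewrite (cint_ext _ (fun y => (al + be * RtoC x) + be * Ci * RtoC y)).
    2: { intros t. rewrite pair_horiz. ring. }
    rewrite cint_plus; [|apply rcont_const|apply rcont_scal, rcont_RtoC].
    now rewrite cint_scal, cint_const, cint_RtoC by apply rcont_RtoC. }
  rewrite !Hh, !Hv, !RtoC_minus.
  assert (Ci * Ci = - (1)) as Hi.
  { unfold Ci, RtoC, Cmult, Copp; simpl. f_equal; ring. }
  ring.
Qed.

Lemma rectI_bound h a b c d M : (forall x, ccont h x) -> (a <= b)%R -> (c <= d)%R ->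
  (forall x y, (a <= x <= b)%R -> (c <= y <= d)%R -> (Cmod (h (x, y)) <= M)%R) ->
  (Cmod (rectI h a b c d) <= 4 * M * ((b - a) + (d - c)))%R.
Proof.
  intros H Hab Hcd HM. unfold rectI.
  assert (B1 : (Cmod (cint (fun x => h (x, c)) a b) <= 2 * M * (b - a))%R).
  { apply cint_bound; [apply (rcont_of_ccont h); auto using rcont_horiz|easy|].
    intros; apply HM; lra. }
  assert (B2 : (Cmod (cint (fun x => h (x, d)) a b) <= 2 * M * (b - a))%R).
  { apply cint_bound; [apply (rcont_of_ccont h); auto using rcont_horiz|easy|].
    intros; apply HM; lra. }
  assert (B3 : (Cmod (cint (fun y => h (a, y)) c d) <= 2 * M * (d - c))%R).
  { apply cint_bound; [apply (rcont_of_ccont h); auto using rcont_vert|easy|].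
    intros; apply HM; lra. }
  assert (B4 : (Cmod (cint (fun y => h (b, y)) c d) <= 2 * M * (d - c))%R).
  { apply cint_bound; [apply (rcont_of_ccont h); auto using rcont_vert|easy|].
    intros; apply HM; lra. }
  eapply Rle_trans; [apply Cmod_sub_le|].
  eapply Rle_trans; [apply Rplus_le_compat_r, Cmod_sub_le|].
  eapply Rle_trans; [apply Rplus_le_compat_r, Rplus_le_compat_r, Cmod_triangle|].
  rewrite !Cmod_mult, Cmod_Ci. lra.
Qed.

(** The four quarter integrals add up to the whole one, so they cannot all be smaller than a quarter
    of it in modulus. *)
Lemma rectI_quarter h x y w v : (forall z, ccont h z) -> (0 <= w)%R -> (0 <= v)%R ->
  exists x' y', ((x' = x \/ x' = x + w / 2) /\ (y' = y \/ y' = y + v / 2))%R /\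
    (Cmod (rectI h x (x + w) y (y + v)) <= 4 * Cmod (rectI h x' (x' + w / 2) y' (y' + v / 2)))%R.
Proof.
  intros H Hw Hv.
  set (Q := fun x' y' => rectI h x' (x' + w / 2) y' (y' + v / 2)).
  assert (E : rectI h x (x + w) y (y + v)
     = (Q x y + Q x (y + v / 2)%R) + (Q (x + w / 2)%R y + Q (x + w / 2)%R (y + v / 2)%R)).
  { unfold Q. rewrite (rectI_split_h h x (x + w / 2) (x + w)) by easy.
    rewrite (rectI_split_v h x (x + w / 2) y (y + v / 2) (y + v)) by easy.
    rewrite (rectI_split_v h (x + w / 2) (x + w) y (y + v / 2) (y + v)) by easy.
    replace (x + w / 2 + w / 2)%R with (x + w)%R by field.
    replace (y + v / 2 + v / 2)%R with (y + v)%R by field. reflexivity. }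
  set (I := Cmod (rectI h x (x + w) y (y + v))).
  assert (B : (I <= Cmod (Q x y) + Cmod (Q x (y + v / 2)%R) + (Cmod (Q (x + w / 2)%R y)
              + Cmod (Q (x + w / 2)%R (y + v / 2)%R)))%R).
  { unfold I. rewrite E. eapply Rle_trans; [apply Cmod_triangle|].
    apply Rplus_le_compat; apply Cmod_triangle. }
  destruct (Rle_dec I (4 * Cmod (Q x y))) as [|N1]; [exists x, y; auto|].
  destruct (Rle_dec I (4 * Cmod (Q x (y + v / 2)%R))) as [|N2]; [exists x, (y + v / 2)%R; auto|].
  destruct (Rle_dec I (4 * Cmod (Q (x + w / 2)%R y))) as [|N3]; [exists (x + w / 2)%R, y; auto|].
  exists (x + w / 2)%R, (y + v / 2)%R. split; [auto|]. fold I. fold (Q (x + w / 2)%R (y + v / 2)%R). lra.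
Qed.

(** The left ends of the bisected intervals increase and stay below every right end; their supremum
    is the common point. *)
Lemma nested_point (x : nat -> R) (w : R) : (0 <= w)%R ->
  (forall n, x (S n) = x n \/ x (S n) = x n + w / 2 ^ n / 2)%R ->
  exists p, forall n, (x n <= p <= x n + w / 2 ^ n)%R.
Proof.
  intros Hw H.
  assert (P : forall n, (0 < 2 ^ n)%R) by (intros; apply pow_lt; lra).
  assert (Q : forall n, (0 <= w / 2 ^ n)%R).
  { intros n. apply Rmult_le_pos; [easy|]. now apply Rlt_le, Rinv_0_lt_compat. }
  assert (S1 : forall n, (x n <= x (S n) /\ x (S n) + w / 2 ^ (S n) <= x n + w / 2 ^ n)%R).
  { intros n. specialize (Q n).
    assert (E : (w / 2 ^ S n = w / 2 ^ n / 2)%R) by (simpl; field; apply pow_nonzero; lra).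
    rewrite E. destruct (H n) as [-> | ->]; lra. }
  assert (S2 : forall n k, (x n <= x (n + k)%nat /\ x (n + k)%nat + w / 2 ^ (n + k) <= x n + w / 2 ^ n)%R).
  { intros n k. induction k; [rewrite Nat.add_0_r; lra|].
    rewrite Nat.add_succ_r. specialize (S1 (n + k)%nat). lra. }
  assert (S3 : forall n m, (x n <= x m + w / 2 ^ m)%R).
  { intros n m. destruct (le_lt_dec n m) as [L|L].
    - specialize (S2 n (m - n)%nat). replace (n + (m - n))%nat with m in S2 by lia.
      specialize (Q m). lra.
    - specialize (S2 m (n - m)%nat). replace (m + (n - m))%nat with n in S2 by lia.
      specialize (Q n). lra. }
  destruct (completeness (fun z => exists n, z = x n)) as [p [Hp1 Hp2]].
  { exists (x 0%nat + w / 2 ^ 0)%R. intros z [n ->]. apply S3. }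
  { exists (x 0%nat), 0%nat. reflexivity. }
  exists p. intros n. split; [apply Hp1; now exists n|].
  apply Hp2. intros z [m ->]. apply S3.
Qed.

(** Classical bisection: near the limit point [h] is affine up to a remainder small compared with
    the size of the rectangle, and the affine part integrates to zero. Continuity on the whole plane
    guarantees that all the integrals exist. *)
Theorem goursat h a b c d : (forall z, ccont h z) -> (a <= b)%R -> (c <= d)%R ->
  (forall x y, (a <= x <= b)%R -> (c <= y <= d)%R -> cdiff h (x, y)) ->
  rectI h a b c d = 0.
Proof.
  intros H Hab Hcd HD. set (w := (b - a)%R). set (v := (d - c)%R).
  assert (Hw : (0 <= w)%R) by (unfold w; lra). assert (Hv : (0 <= v)%R) by (unfold v; lra).
  set (good := fun n (p p' : R * R) =>
    ((fst p' = fst p \/ fst p' = fst p + w / 2 ^ n / 2) /\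
     (snd p' = snd p \/ snd p' = snd p + v / 2 ^ n / 2))%R /\
    (Cmod (rectI h (fst p) (fst p + w / 2 ^ n) (snd p) (snd p + v / 2 ^ n))
     <= 4 * Cmod (rectI h (fst p') (fst p' + w / 2 ^ n / 2) (snd p') (snd p' + v / 2 ^ n / 2)))%R).
  assert (Hpow : forall n, (0 < 2 ^ n)%R) by (intros; apply pow_lt; lra).
  assert (Hex : forall n p, exists p', good n p p').
  { intros n [x y].
    assert (Hwn : forall u, (0 <= u)%R -> (0 <= u / 2 ^ n)%R).
    { intros u Hu. apply Rmult_le_pos; [easy|]. now apply Rlt_le, Rinv_0_lt_compat. }
    destruct (rectI_quarter h x y (w / 2 ^ n) (v / 2 ^ n) H) as [x' [y' K]]; auto.
    now exists (x', y'). }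
  set (s := nat_rect (fun _ => (R * R)%type) (a, c)
     (fun n p => proj1_sig (constructive_indefinite_description _ (Hex n p)))).
  assert (Hs : forall n, good n (s n) (s (S n))).
  { intros n. unfold s at 2; simpl. fold (s n). apply proj2_sig. }
  destruct (nested_point (fun n => fst (s n)) w Hw) as [p Hp]. { intros n. apply (Hs n). }
  destruct (nested_point (fun n => snd (s n)) v Hv) as [r Hr]. { intros n. apply (Hs n). }
  assert (Hhalf : forall u n, (u / 2 ^ n / 2 = u / 2 ^ S n)%R).
  { intros u n. simpl. field. apply pow_nonzero. lra. }
  assert (HI : forall n, (Cmod (rectI h a b c d) <= 4 ^ n *
     Cmod (rectI h (fst (s n)) (fst (s n) + w / 2 ^ n) (snd (s n)) (snd (s n) + v / 2 ^ n)))%R).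
  { induction n.
    - simpl. unfold w, v. replace (a + (b - a) / 1)%R with b by field.
      replace (c + (d - c) / 1)%R with d by field. lra.
    - destruct (Hs n) as [_ K]. rewrite !Hhalf in K.
      eapply Rle_trans; [exact IHn|]. simpl (4 ^ S n)%R.
      assert (0 < 4 ^ n)%R by (apply pow_lt; lra).
      rewrite (Rmult_comm 4), Rmult_assoc. apply Rmult_le_compat_l; [lra|exact K]. }
  assert (Hpr : cdiff h (p, r)).
  { apply HD.
    - specialize (Hp 0%nat). simpl in Hp. unfold w in Hp. lra.
    - specialize (Hr 0%nat). simpl in Hr. unfold v in Hr. lra. }
  destruct Hpr as [phi [Hphi Ephi]].
  set (al := h (p, r) - phi (p, r) * (p, r)). set (be := phi (p, r)).
  assert (Hrem : forall z, h z = (al + be * z) + (h z + (- al + (- be) * z))) by (intros; ring).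
  assert (Crem : forall z, ccont (fun z => h z + (- al + (- be) * z)) z).
  { intros z. apply ccont_plus; [easy|]. apply ccont_plus; [apply ccont_const|].
    apply ccont_mult; [apply ccont_const|apply ccont_id]. }
  assert (Caff : forall z, ccont (fun z => al + be * z) z).
  { intros z. apply ccont_plus; [apply ccont_const|].
    apply ccont_mult; [apply ccont_const|apply ccont_id]. }
  apply Cmod_small_eq0. intros e He.
  (* After [n] bisections the bound is [4 ^ n * 4 * e' * (wn + vn) ^ 2 = 4 * e' * (w + v) ^ 2],
     independent of [n]. The [+ 1] keeps the denominator positive for a degenerate rectangle. *)
  set (e' := (e / (4 * (w + v) * (w + v) + 1))%R).
  assert (Hsq : (0 <= 4 * (w + v) * (w + v))%R).
  { apply Rmult_le_pos; lra. }
  assert (He' : (0 < e')%R) by (apply Rdiv_lt_0_compat; lra).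
  destruct (Hphi e' He') as [dl [Hdl Hd]].
  assert (exists n, (w + v) / 2 ^ n < dl)%R as [n Hn].
  { destruct (pow_lt_1_zero (/ 2) ltac:(rewrite Rabs_pos_eq; lra) (dl / (w + v + 1))%R) as [N HN].
    { apply Rdiv_lt_0_compat; lra. }
    exists N. specialize (HN N ltac:(lia)). rewrite pow_inv in HN.
    assert (0 < / 2 ^ N)%R by now apply Rinv_0_lt_compat. rewrite Rabs_pos_eq in HN by lra.
    apply Rle_lt_trans with ((w + v + 1) * / 2 ^ N)%R.
    - apply Rmult_le_compat_r; lra.
    - apply Rlt_le_trans with ((w + v + 1) * (dl / (w + v + 1)))%R.
      + apply Rmult_lt_compat_l; lra.
      + right. field. lra. }
  specialize (HI n). specialize (Hp n). specialize (Hr n).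
  set (x0 := fst (s n)) in *. set (y0 := snd (s n)) in *.
  set (wn := (w / 2 ^ n)%R) in *. set (vn := (v / 2 ^ n)%R) in *.
  assert (Hsum : (wn + vn < dl)%R) by (unfold wn, vn; unfold Rdiv in *; lra).
  assert (B : (Cmod (rectI h x0 (x0 + wn) y0 (y0 + vn)) <= 4 * (e' * (wn + vn)) * (wn + vn))%R).
  { replace (rectI h x0 (x0 + wn) y0 (y0 + vn))%R
      with (rectI (fun z => h z + (- al + (- be) * z)) x0 (x0 + wn) y0 (y0 + vn)).
    2: { transitivity (rectI (fun z => (al + be * z) + (h z + (- al + (- be) * z))) x0 (x0 + wn) y0 (y0 + vn)).
         - rewrite (rectI_plus (fun z => al + be * z)); auto. rewrite rectI_affine. ring.
         - apply rectI_ext. intros; now rewrite <- Hrem. }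
    eapply Rle_trans.
    { apply rectI_bound with (M := (e' * (wn + vn))%R); auto; try lra.
      intros x y Hx Hy.
      replace (h (x, y) + (- al + - be * (x, y))) with ((phi (x, y) - phi (p, r)) * ((x, y) - (p, r))).
      2: { rewrite (Ephi (x, y)). unfold al, be. ring. }
      assert (D : (Cmod ((x, y) - (p, r)) <= wn + vn)%R).
      { eapply Rle_trans; [apply (Cmod_le_sum (x - p) (y - r))|].
        apply Rplus_le_compat; apply Rabs_le; lra. }
      rewrite Cmod_mult. apply Rmult_le_compat; try apply Cmod_ge_0; [|easy].
      apply Rlt_le, Hd. lra. }
    right. ring. }
  eapply Rle_trans; [exact HI|].
  eapply Rle_trans; [apply Rmult_le_compat_l; [apply pow_le; lra|exact B]|].
  replace (4 ^ n * (4 * (e' * (wn + vn)) * (wn + vn)))%R with (e' * (4 * (w + v) * (w + v)))%R.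
  - apply Rle_trans with (e' * (4 * (w + v) * (w + v) + 1))%R.
    + apply Rmult_le_compat_l; lra.
    + right. unfold e'. field. lra.
  - unfold wn, vn. replace (4 ^ n)%R with (2 ^ n * 2 ^ n)%R.
    + field. apply pow_nonzero. lra.
    + rewrite <- Rpow_mult_distr. now replace (2 * 2)%R with 4%R by ring.
Qed.

(** * The complex exponential *)

Definition cexp (z : C) : C := (exp (fst z) * cos (snd z), exp (fst z) * sin (snd z))%R.

Lemma cexp_plus z w : cexp (z + w) = cexp z * cexp w.
Proof.
  unfold cexp, Cplus, Cmult; simpl. rewrite exp_plus, cos_plus, sin_plus. f_equal; ring.
Qed.

Lemma Cmod_cexp z : Cmod (cexp z) = exp (fst z).
Proof.
  unfold Cmod, cexp; simpl.
  replace (exp (fst z) * cos (snd z) * (exp (fst z) * cos (snd z) * 1)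
     + exp (fst z) * sin (snd z) * (exp (fst z) * sin (snd z) * 1))%R
    with ((exp (fst z)) ^ 2 * ((sin (snd z))² + (cos (snd z))²))%R by (unfold Rsqr; ring).
  rewrite sin2_cos2, Rmult_1_r. apply sqrt_pow2. apply Rlt_le, exp_pos.
Qed.

Lemma cexp_neq0 z : cexp z <> 0.
Proof. apply Cmod_gt_0. rewrite Cmod_cexp. apply exp_pos. Qed.

Lemma cexp_0 : cexp 0 = 1.
Proof. unfold cexp; simpl. rewrite exp_0, cos_0, sin_0. unfold RtoC. f_equal; ring. Qed.

Lemma cexp_period u : cexp (u, 2 * PI)%R = cexp (u, 0%R).
Proof. unfold cexp; simpl. now rewrite cos_2PI, sin_2PI, cos_0, sin_0. Qed.

Lemma derive_at_0_eps (f : R -> R) l : derivable_pt_lim f 0 l ->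
  forall eps, (0 < eps)%R -> exists d, (0 < d)%R /\ forall x, (Rabs x < d)%R -> (Rabs (f x - f 0 - l * x) <= eps * Rabs x)%R.
Proof.
  intros H eps He. destruct (H eps He) as [d Hd]. exists d. split; [apply cond_pos|].
  intros x Hx. destruct (Req_dec x 0) as [->|Hn].
  { replace (f 0 - f 0 - l * 0)%R with 0%R by ring. rewrite Rabs_R0. lra. }
  specialize (Hd x Hn Hx). rewrite Rplus_0_l in Hd.
  replace (f x - f 0 - l * x)%R with (((f x - f 0) / x - l) * x)%R by (field; easy).
  rewrite Rabs_mult. apply Rmult_le_compat_r; [apply Rabs_pos|lra].
Qed.

Lemma cexp_near_0 eps : (0 < eps)%R -> exists d, (0 < d)%R /\
  forall z, (Cmod z < d)%R -> (Cmod (cexp z - 1 - z) <= eps * Cmod z)%R.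
Proof.
  (* The four error terms contribute [1 + 3 + 3 + 2 = 9] times [e * Cmod z]; the threes come from
     [exp x <= 3]. *)
  intros He. set (e := Rmin 1 (eps / 9)).
  assert (E1 : (0 < e)%R) by (apply Rmin_pos; lra).
  assert (E2 : (e <= 1)%R) by apply Rmin_l. assert (E3 : (e <= eps / 9)%R) by apply Rmin_r.
  clearbody e.
  destruct (derive_at_0_eps exp 1) with e as [d1 [Hd1 H1]]; auto.
  { assert (A := derivable_pt_lim_exp 0). now rewrite exp_0 in A. }
  destruct (derive_at_0_eps cos 0) with e as [d2 [Hd2 H2]]; auto.
  { assert (A := derivable_pt_lim_cos 0). now rewrite sin_0, Ropp_0 in A. }
  destruct (derive_at_0_eps sin 1) with e as [d3 [Hd3 H3]]; auto.
  { assert (A := derivable_pt_lim_sin 0). now rewrite cos_0 in A. }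
  exists (Rmin (Rmin d1 d2) (Rmin d3 e)).
  split; [repeat apply Rmin_pos; auto|]. intros [x y] Hz.
  assert (M1 := Rmin_l (Rmin d1 d2) (Rmin d3 e)). assert (M2 := Rmin_r (Rmin d1 d2) (Rmin d3 e)).
  assert (M3 := Rmin_l d1 d2). assert (M4 := Rmin_r d1 d2).
  assert (M5 := Rmin_l d3 e). assert (M6 := Rmin_r d3 e).
  assert (Bx := Rabs_fst_le (x, y)). assert (By := Rabs_snd_le (x, y)). simpl in Bx, By.
  set (m := Cmod (x, y)) in *.
  specialize (H1 x ltac:(lra)). specialize (H2 y ltac:(lra)). specialize (H3 y ltac:(lra)).
  rewrite exp_0, Rmult_1_l in H1. rewrite cos_0, Rmult_0_l, Rminus_0_r in H2.
  rewrite sin_0, Rmult_1_l, Rminus_0_r in H3.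
  assert (Px := Rabs_pos x). assert (Py := Rabs_pos y).
  assert (Hexp : (0 < exp x <= 3)%R).
  { split; [apply exp_pos|]. apply Rle_trans with (exp 1); [|apply exp_le_3].
    destruct (Req_dec x 1) as [->|]; [lra|]. apply Rlt_le, exp_increasing.
    assert (x <= Rabs x)%R by apply Rle_abs. lra. }
  assert (Hx1 : (Rabs (exp x - 1) <= 2 * Rabs x)%R).
  { replace (exp x - 1)%R with ((exp x - 1 - x) + x)%R by ring.
    eapply Rle_trans; [apply Rabs_triang|]. nra. }
  replace (cexp (x, y) - 1 - (x, y))
    with (((exp x - 1 - x) + exp x * (cos y - 1))%R, (exp x * (sin y - y) + (exp x - 1) * y)%R).
  2: { unfold cexp, RtoC, Cminus, Cplus, Copp; simpl. f_equal; ring. }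
  eapply Rle_trans; [apply Cmod_le_sum|].
  eapply Rle_trans; [apply Rplus_le_compat; apply Rabs_triang|].
  rewrite !Rabs_mult, (Rabs_pos_eq (exp x)) by lra.
  assert (exp x * Rabs (cos y - 1) <= 3 * (e * Rabs y))%R.
  { apply Rmult_le_compat; try lra. apply Rabs_pos. }
  assert (exp x * Rabs (sin y - y) <= 3 * (e * Rabs y))%R.
  { apply Rmult_le_compat; try lra. apply Rabs_pos. }
  assert (Rabs (exp x - 1) * Rabs y <= 2 * e * Rabs y)%R.
  { apply Rmult_le_compat_r; lra. }
  assert (e * Rabs x <= e * m)%R by (apply Rmult_le_compat_l; lra).
  assert (e * Rabs y <= e * m)%R by (apply Rmult_le_compat_l; lra).
  assert (e * m <= eps / 9 * m)%R by (apply Rmult_le_compat_r; lra).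
  lra.
Qed.

Lemma cdiff_cexp_0 : cdiff cexp 0.
Proof.
  exists (fun y => if Ceq_dec y 0 then RtoC 1 else (cexp y - 1) / y). split.
  - intros e He. destruct (cexp_near_0 (e / 2)%R ltac:(lra)) as [d [Hd H]].
    exists d. split; [easy|]. intros y Hy. destruct (Ceq_dec 0 0) as [_|C]; [|easy].
    destruct (Ceq_dec y 0) as [->|Hn].
    { replace (1 - 1) with (RtoC 0) by ring. now rewrite Cmod_0. }
    replace (y - 0) with y in Hy by ring. specialize (H y Hy).
    replace ((cexp y - 1) / y - 1) with ((cexp y - 1 - y) * / y) by (now field).
    rewrite Cmod_mult, Cmod_inv; auto. assert (P := proj1 (Cmod_gt_0 _) Hn).
    apply Rle_lt_trans with (e / 2 * Cmod y * / Cmod y)%R.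
    + apply Rmult_le_compat_r; [|easy]. now apply Rlt_le, Rinv_0_lt_compat.
    + field_simplify; lra.
  - intros y. rewrite cexp_0. destruct (Ceq_dec y 0) as [->|Hn]; [rewrite cexp_0; ring|now field].
Qed.

Lemma cdiff_cexp z : cdiff cexp z.
Proof.
  assert (H : cdiff (fun y => cexp z * cexp (y + (- z))) z).
  { apply cdiff_mult; [apply cdiff_const|]. apply (cdiff_comp (fun y => y + (- z)) cexp).
    - apply cdiff_plus; [apply cdiff_id|apply cdiff_const].
    - replace (z + - z) with (RtoC 0) by ring. apply cdiff_cexp_0. }
  destruct H as [p [Hp E]]. exists p. split; [easy|]. intros y. specialize (E y).
  rewrite <- !cexp_plus in E.
  replace (z + (y + - z)) with y in E by ring. now replace (z + (z + - z)) with z in E by ring.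
Qed.

(** * Means over circles, in the coordinate [z = log zeta] *)

(** With [zeta = cexp (u, v)] on the circle of radius [exp u], this integrates against
    [d zeta / (i zeta)]; the division by [2 * PI] is left to [taylor_coef]. In the logarithmic
    coordinate an annulus becomes a rectangle, to which [goursat] applies. *)
Definition cmean (h : C -> C) (u : R) : C := cint (fun v => h (u, v)) 0 (2 * PI).

Lemma two_PI_pos : (0 < 2 * PI)%R.
Proof. assert (H := PI_RGT_0). lra. Qed.

Lemma cmean_rcont h u : (forall z, ccont h z) -> rcont (fun v => h (u, v)).
Proof. intros H. apply (rcont_of_ccont h); auto using rcont_vert. Qed.

(** On the rectangle [[u1, u2] x [0, 2 PI]] periodicity makes the horizontal sides cancel, and the
    vertical sides are the two means. *)
Lemma cmean_strip h u1 u2 : (u1 <= u2)%R -> (forall z, ccont h z) ->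
  (forall u, h (u, 2 * PI)%R = h (u, 0%R)) ->
  (forall z, (u1 <= fst z <= u2)%R -> cdiff h z) -> cmean h u1 = cmean h u2.
Proof.
  intros Hu Hc Hp Hd.
  assert (G := goursat h u1 u2 0 (2 * PI) Hc Hu (Rlt_le _ _ two_PI_pos)).
  unfold rectI in G. rewrite (cint_ext (fun x => h (x, 2 * PI)%R) (fun x => h (x, 0%R))) in G by auto.
  fold (cmean h u1) (cmean h u2) in G.
  assert (E : Ci * (cmean h u1 - cmean h u2) = 0).
  { rewrite <- (Copp_0), <- G; [ring|]. intros x y Hx Hy. now apply Hd. }
  apply Ceq_minus. destruct (Ceq_dec (cmean h u1 - cmean h u2) 0); [easy|].
  exfalso. revert E. now apply Cmult_neq_0; [apply Ci_nz|].
Qed.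

Lemma cmean_continuous h u0 eps : (forall z, ccont h z) -> (0 < eps)%R ->
  exists d, (0 < d)%R /\ forall u, (Rabs (u - u0) < d)%R -> (Cmod (cmean h u - cmean h u0) <= eps)%R.
Proof.
  intros Hc He. assert (Hpi := two_PI_pos).
  set (e := (eps / (2 * (2 * PI)) / 2)%R).
  assert (He' : (0 < e)%R) by (unfold e; repeat apply Rdiv_lt_0_compat; lra).
  assert (Hex : forall t : R, exists d : posreal, forall w, (Cmod (w - (u0, t)) < 2 * d)%R -> (Cmod (h w - h (u0, t)) < e)%R).
  { intros t. destruct (Hc (u0, t) e He') as [d [Hd K]].
    assert (Hd2 : (0 < d / 2)%R) by lra. exists (mkposreal _ Hd2). simpl. intros w Hw. apply K. lra. }
  set (delta := fun t => proj1_sig (constructive_indefinite_description _ (Hex t))).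
  assert (Hdelta : forall t w, (Cmod (w - (u0, t)) < 2 * delta t)%R -> (Cmod (h w - h (u0, t)) < e)%R).
  { intros t. unfold delta. apply proj2_sig. }
  (* Compactness gives one [d] for all angles. The nearby point [t] comes under a double negation,
     hence the argument by contradiction; the margin [2 * delta t] covers both the change of [u] and
     the move from [x] to [t]. *)
  destruct (compactness_value_1d 0 (2 * PI) delta) as [d Hd].
  exists d. split; [apply cond_pos|]. intros u Hu.
  unfold cmean.
  replace (cint (fun v => h (u, v)) 0 (2 * PI) - cint (fun v => h (u0, v)) 0 (2 * PI))
    with (cint (fun v => h (u, v) + (- (1)) * h (u0, v)) 0 (2 * PI)).
  2: { rewrite cint_plus, cint_scal; [ring|..]; try apply rcont_scal; now apply cmean_rcont. }
  eapply Rle_trans.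
  { apply cint_bound with (M := (2 * e)%R); [|lra|].
    - apply rcont_plus; [|apply rcont_scal]; now apply cmean_rcont.
    - intros x Hx. replace (h (u, x) + - (1) * h (u0, x)) with (h (u, x) - h (u0, x)) by ring.
      apply Rnot_lt_le. intros C. apply (Hd x Hx). intros [t [Ht [Hxt Hdt]]].
      assert (A1 : (Cmod (h (u, x) - h (u0, t)) < e)%R).
      { apply Hdelta. eapply Rle_lt_trans; [apply (Cmod_le_sum (u - u0) (x - t))|]. lra. }
      assert (A2 : (Cmod (h (u0, x) - h (u0, t)) < e)%R).
      { apply Hdelta. eapply Rle_lt_trans; [apply (Cmod_le_sum (u0 - u0) (x - t))|].
        rewrite Rminus_diag, Rabs_R0. assert (P := Rabs_pos (x - t)). lra. }
      replace (h (u, x) - h (u0, x)) with ((h (u, x) - h (u0, t)) - (h (u0, x) - h (u0, t))) in C by ring.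
      assert (T := Cmod_sub_le (h (u, x) - h (u0, t)) (h (u0, x) - h (u0, t))). lra. }
  right. unfold e. field. lra.
Qed.

(** The exceptional circle [Re z = u0] is crossed by continuity. *)
Lemma cmean_const h u0 : (forall z, ccont h z) ->
  (forall u, h (u, 2 * PI)%R = h (u, 0%R)) ->
  (forall z, fst z <> u0 -> cdiff h z) -> forall u, cmean h u = cmean h u0.
Proof.
  intros Hc Hp Hd u. apply Ceq_minus. apply Cmod_small_eq0. intros e He.
  destruct (cmean_continuous h u0 e Hc He) as [d [Hd0 K]].
  destruct (Rtotal_order u u0) as [L|[->|L]].
  - assert (M1 := Rmax_l u (u0 - d / 2)). assert (M2 := Rmax_r u (u0 - d / 2)).
    assert (M3 : (Rmax u (u0 - d / 2) < u0)%R) by (apply Rmax_lub_lt; lra).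
    rewrite (cmean_strip h u (Rmax u (u0 - d / 2))); auto.
    + apply K. apply Rabs_def1; lra.
    + intros z Hz. apply Hd. lra.
  - replace (cmean h u0 - cmean h u0) with (RtoC 0) by ring. rewrite Cmod_0. lra.
  - assert (M1 := Rmin_l u (u0 + d / 2)). assert (M2 := Rmin_r u (u0 + d / 2)).
    assert (M3 : (u0 < Rmin u (u0 + d / 2))%R) by (apply Rmin_glb_lt; lra).
    rewrite <- (cmean_strip h (Rmin u (u0 + d / 2)) u); auto.
    + apply K. apply Rabs_def1; lra.
    + intros z Hz. apply Hd. lra.
Qed.

Lemma cmean_const_entire h : (forall z, cdiff h z) ->
  (forall u, h (u, 2 * PI)%R = h (u, 0%R)) -> forall u u', cmean h u = cmean h u'.
Proof.
  intros Hd Hp u u'. assert (Hc : forall z, ccont h z) by (intros; now apply cdiff_ccont).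
  now rewrite (cmean_const h 0 Hc Hp (fun z _ => Hd z) u), (cmean_const h 0 Hc Hp (fun z _ => Hd z) u').
Qed.

Lemma rcont_bounded h a b : (a <= b)%R -> rcont h -> exists B, forall t, (a <= t <= b)%R -> (Cmod (h t) <= B)%R.
Proof.
  intros Hab H. destruct (continuity_ab_maj (fun t => Cmod (h t)) a b Hab) as [m [Hm _]].
  - intros t _. apply continuity_pt_filterlim. apply continuous_eps. intros e He.
    destruct (H t e He) as [d [Hd K]]. exists d. split; [easy|]. intros s Hs.
    specialize (K s Hs). assert (T1 := Cmod_sub_ge (h s) (h t)).
    assert (T2 := Cmod_sub_ge (h t) (h s)). rewrite Cmod_minus_sym in T2.
    apply Rabs_def1; lra.
  - now exists (Cmod (h m)).
Qed.

(** * Taylor expansion of entire functions *)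

Lemma cdiff_locally_ext f g x r : (0 < r)%R -> (forall y, (Cmod (y - x) < r)%R -> f y = g y) ->
  cdiff f x -> cdiff g x.
Proof.
  intros Hr E [p [Hp Ep]].
  assert (E0 : f x = g x). { apply E. replace (x - x) with (RtoC 0) by ring. now rewrite Cmod_0. }
  exists (fun y => if Rlt_dec (Cmod (y - x)) r then p y else (g y - g x) / (y - x)). split.
  - apply (ccont_locally_ext p _ _ r Hr); [|easy]. intros y Hy.
    now destruct (Rlt_dec (Cmod (y - x)) r).
  - intros y. destruct (Rlt_dec (Cmod (y - x)) r) as [L|L].
    + rewrite <- (E y L), <- E0. apply Ep.
    + field. intros C. apply L. rewrite C, Cmod_0. easy.
Qed.

(** Away from [a] the slope agrees locally with the difference quotient of [f] at [a]. *)
Lemma slope_cdiff f phi a x : (forall z, cdiff f z) ->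
  (forall y, f y = f a + phi y * (y - a)) -> x <> a -> cdiff phi x.
Proof.
  intros Hf E Hx.
  assert (Hxa : x - a <> 0). { intros C. apply Hx. now apply Ceq_minus. }
  apply (cdiff_locally_ext (fun y => (f y + (- f a)) * / (y + (- a))) _ _ (Cmod (x - a))).
  - now apply Cmod_gt_0.
  - intros y Hy. assert (y - a <> 0).
    { intros C. apply Ceq_minus in C. subst y. rewrite Cmod_minus_sym in Hy. lra. }
    rewrite (E y). now field.
  - apply cdiff_mult.
    + apply cdiff_plus; [easy|apply cdiff_const].
    + apply (cdiff_comp (fun y => y + (- a)) Cinv).
      * apply cdiff_plus; [apply cdiff_id|apply cdiff_const].
      * now apply cdiff_inv.
Qed.

(** The slope is differentiable off [a] and continuous at [a], so the mean keeps its value even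
    across the circle through [a]. As the radius tends to 0 the slope stays bounded and the factor
    [cexp z] forces the value 0. *)
Lemma cauchy_slope f phi a u : (forall z, cdiff f z) -> ccont phi a ->
  (forall y, f y = f a + phi y * (y - a)) ->
  cmean (fun z => phi (cexp z) * cexp z) u = 0.
Proof.
  intros Hf Hphi E. set (H := fun z => phi (cexp z) * cexp z).
  assert (Cphi : forall x, ccont phi x).
  { intros x. destruct (Ceq_dec x a) as [->|Hx]; [easy|].
    apply cdiff_ccont. now apply (slope_cdiff f phi a). }
  assert (CH : forall z, ccont H z).
  { intros z. apply ccont_mult; [apply (ccont_comp cexp phi); auto|];
    apply cdiff_ccont, cdiff_cexp. }
  assert (PH : forall u, H (u, 2 * PI)%R = H (u, 0%R)).
  { intros v. unfold H. now rewrite cexp_period. }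
  (* If [a = 0], no circle passes through [a] and any value of [ln 0] serves. *)
  set (u0 := ln (Cmod a)).
  assert (DH : forall z, fst z <> u0 -> cdiff H z).
  { intros z Hz. apply cdiff_mult; [|apply cdiff_cexp].
    apply (cdiff_comp cexp phi); [apply cdiff_cexp|].
    apply (slope_cdiff f phi a); auto. intros C. apply Hz. unfold u0.
    now rewrite <- C, Cmod_cexp, ln_exp. }
  rewrite (cmean_const H u0 CH PH DH).
  destruct (Cphi 0 1%R ltac:(lra)) as [d [Hd K]].
  set (B := (Cmod (phi 0) + 1)%R). assert (HB : (0 < B)%R).
  { assert (P := Cmod_ge_0 (phi 0)). unfold B. lra. }
  assert (Hpi := two_PI_pos).
  apply Cmod_small_eq0. intros e He.
  set (m := Rmin (d / 2) (e / (2 * B * (2 * PI)))).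
  assert (Hm : (0 < m)%R).
  { apply Rmin_pos; [lra|]. apply Rdiv_lt_0_compat; [easy|]. apply Rmult_lt_0_compat; lra. }
  assert (M1 : (m <= d / 2)%R) by apply Rmin_l.
  assert (M2 : (m <= e / (2 * B * (2 * PI)))%R) by apply Rmin_r.
  rewrite <- (cmean_const H u0 CH PH DH (ln m)).
  eapply Rle_trans.
  { apply cint_bound with (M := (B * m)%R); [now apply cmean_rcont|lra|].
    intros t _. unfold H. rewrite Cmod_mult, Cmod_cexp. simpl fst. rewrite exp_ln by easy.
    apply Rmult_le_compat_r; [lra|].
    assert (Hk : (Cmod (phi (cexp (ln m, t)) - phi 0) < 1)%R).
    { apply K. replace (cexp (ln m, t) - 0) with (cexp (ln m, t)) by ring.
      rewrite Cmod_cexp. simpl fst. rewrite exp_ln by easy. lra. }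
    assert (T := Cmod_sub_ge (phi (cexp (ln m, t))) (phi 0)). unfold B. lra. }
  apply Rle_trans with (2 * B * (2 * PI) * (e / (2 * B * (2 * PI))))%R.
  - replace (2 * (B * m) * (2 * PI - 0))%R with (2 * B * (2 * PI) * m)%R by ring.
    apply Rmult_le_compat_l; [|easy]. apply Rlt_le, Rmult_lt_0_compat; lra.
  - right. field. lra.
Qed.

Lemma cdiff_inv_cexp_pow n z : cdiff (fun z => (/ cexp z) ^ n) z.
Proof.
  apply cdiff_pow, (cdiff_comp cexp Cinv); [apply cdiff_cexp|apply cdiff_inv, cexp_neq0].
Qed.

(** The mean does not depend on [u], yet raising [u] from 0 to 1 multiplies it by [exp (- n)]; hence
    it vanishes. *)
Lemma cmean_cexp_pow n u : (1 <= n)%nat -> cmean (fun z => (/ cexp z) ^ n) u = 0.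
Proof.
  intros Hn. set (h := fun z => (/ cexp z) ^ n).
  assert (Hd : forall z, cdiff h z) by apply cdiff_inv_cexp_pow.
  assert (Hp : forall u, h (u, 2 * PI)%R = h (u, 0%R)) by (intros; unfold h; now rewrite cexp_period).
  assert (Hc : forall z, ccont h z) by (intros; now apply cdiff_ccont).
  rewrite (cmean_const_entire h Hd Hp u 0).
  assert (E : cmean h 1 = (/ cexp 1) ^ n * cmean h 0).
  { unfold cmean. rewrite <- cint_scal by now apply cmean_rcont. apply cint_ext. intros t.
    unfold h. rewrite <- Cpow_mult_l. f_equal.
    replace (1%R, t) with (RtoC 1 + (0%R, t)) by (unfold RtoC, Cplus; simpl; f_equal; ring).
    rewrite cexp_plus. field. split; apply cexp_neq0. }
  rewrite (cmean_const_entire h Hd Hp 1 0) in E.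
  destruct (Ceq_dec (cmean h 0) 0) as [|Hz]; [easy|exfalso].
  assert (F : Cmod (cmean h 0) = (Cmod (/ cexp 1) ^ n * Cmod (cmean h 0))%R).
  { rewrite E at 1. now rewrite Cmod_mult, Cmod_pow. }
  assert (P := proj1 (Cmod_gt_0 _) Hz).
  assert (G : (Cmod (/ cexp 1) ^ n = 1)%R).
  { apply Rmult_eq_reg_r with (Cmod (cmean h 0)); lra. }
  rewrite Cmod_inv, Cmod_cexp in G by apply cexp_neq0. simpl fst in G.
  assert (L : (0 < / exp 1 < 1)%R).
  { split; [apply Rinv_0_lt_compat, exp_pos|]. assert (A := exp_increasing 0 1 ltac:(lra)).
    rewrite exp_0 in A. apply Rmult_lt_reg_l with (exp 1); [lra|]. rewrite Rinv_r; lra. }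
  assert (Q := pow_lt_1_compat (/ exp 1) n ltac:(lra) ltac:(lia)). lra.
Qed.

Definition taylor_coef (f : C -> C) (n : nat) : C :=
  cmean (fun z => f (cexp z) * (/ cexp z) ^ n) 0 / RtoC (2 * PI).

Lemma taylor_mean_rcont f n u : (forall z, cdiff f z) ->
  rcont (fun v => f (cexp (u, v)) * (/ cexp (u, v)) ^ n).
Proof.
  intros Hf. apply (cmean_rcont (fun z => f (cexp z) * (/ cexp z) ^ n)). intros z. apply ccont_mult.
  - apply (ccont_comp cexp f); apply cdiff_ccont; [apply cdiff_cexp|easy].
  - apply cdiff_ccont, cdiff_inv_cexp_pow.
Qed.

Lemma taylor_coef_mean f n u : (forall z, cdiff f z) ->
  cmean (fun z => f (cexp z) * (/ cexp z) ^ n) u = RtoC (2 * PI) * taylor_coef f n.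
Proof.
  intros Hf. unfold taylor_coef.
  rewrite (cmean_const_entire (fun z => f (cexp z) * (/ cexp z) ^ n)) with (u := u) (u' := 0%R).
  - field. intros C. apply RtoC_inj in C. assert (H := two_PI_pos). lra.
  - intros z. apply cdiff_mult; [|apply cdiff_inv_cexp_pow].
    apply (cdiff_comp cexp f); [apply cdiff_cexp|easy].
  - intros v. now rewrite cexp_period.
Qed.

(** Cauchy's estimate; the 2 is inherited from [cint_bound]. *)
Lemma taylor_coef_bound f r M n : (forall z, cdiff f z) -> (0 < r)%R ->
  (forall x, Cmod x = r -> (Cmod (f x) <= M)%R) -> (Cmod (taylor_coef f n) <= 2 * M / r ^ n)%R.
Proof.
  intros Hf Hr HM. assert (E := taylor_coef_mean f n (ln r) Hf). assert (Hpi := two_PI_pos).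
  assert (B : (Cmod (cmean (fun z => (f (cexp z) * (/ cexp z) ^ n)%C) (ln r))
             <= 2 * (M * / r ^ n) * (2 * PI - 0))%R).
  { apply cint_bound; [now apply taylor_mean_rcont|lra|]. intros t _.
    assert (Hx : Cmod (cexp (ln r, t)) = r) by (rewrite Cmod_cexp; simpl; now apply exp_ln).
    rewrite Cmod_mult, Cmod_pow, Cmod_inv, Hx, pow_inv by apply cexp_neq0.
    apply Rmult_le_compat_r; [|now apply HM].
    apply Rlt_le, Rinv_0_lt_compat, pow_lt, Hr. }
  rewrite E, Cmod_mult, Cmod_RtoC_pos in B by lra.
  apply Rmult_le_reg_l with (2 * PI)%R; [easy|]. unfold Rdiv. lra.
Qed.

(** For [H] equal to the slope at [a] times [zeta], one has [H = f - f a + (a / zeta) H]. This is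
    iterated [N] times and integrated over a circle: [cauchy_slope] kills the left side, and [f a]
    survives only at index 0, because the means of negative powers vanish. *)
Theorem taylor f : (forall z, cdiff f z) ->
  forall x, cv (csum (fun n => taylor_coef f n * x ^ n)) (f x).
Proof.
  intros Hf a. destruct (Hf a) as [phi [Hphi E]].
  (* This gives [Cmod a / r <= 1 / 2], so that each iteration halves the bound on the remainder. *)
  set (r := (2 * (Cmod a + 1))%R). assert (Pa := Cmod_ge_0 a).
  assert (Hr : (0 < r)%R) by (unfold r; lra). set (u := ln r).
  assert (Hz : forall v, Cmod (cexp (u, v)) = r) by (intros; rewrite Cmod_cexp; unfold u; simpl; now apply exp_ln).
  assert (Hpi := two_PI_pos).
  assert (Cphi : forall x, ccont phi x).
  { intros x. destruct (Ceq_dec x a) as [->|Hx]; [easy|].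
    apply cdiff_ccont. now apply (slope_cdiff f phi a). }
  set (H := fun z => phi (cexp z) * cexp z).
  assert (CH : forall z, ccont H z).
  { intros z. apply ccont_mult; [apply (ccont_comp cexp phi); auto|];
    apply cdiff_ccont, cdiff_cexp. }
  assert (Cinvp : forall N z, ccont (fun z => (/ cexp z) ^ N) z).
  { intros. apply cdiff_ccont, cdiff_inv_cexp_pow. }
  destruct (rcont_bounded (fun v => H (u, v)) 0 (2 * PI) ltac:(lra) (cmean_rcont H u CH)) as [B HB].
  assert (K : forall N, RtoC (2 * PI) * (csum (fun n => taylor_coef f n * a ^ n) N
                - (match N with O => 0 | _ => f a end))
     = - (a ^ N * cmean (fun z => (/ cexp z) ^ N * H z) u)).
  { intros N.
    assert (S : forall N, cmean H u = csum (fun n => a ^ n * (cmean (fun z => f (cexp z) * (/ cexp z) ^ n) u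
        - f a * cmean (fun z => (/ cexp z) ^ n) u)) N + a ^ N * cmean (fun z => (/ cexp z) ^ N * H z) u).
    { clear N. induction N as [|N IH].
      - simpl. unfold cmean. rewrite (cint_ext (fun v => 1 * H (u, v)) (fun v => H (u, v))); [ring|intros; ring].
      - rewrite IH. simpl. unfold cmean.
        rewrite (cint_ext (fun v => (/ cexp (u, v)) ^ N * H (u, v))
          (fun v => (f (cexp (u, v)) * (/ cexp (u, v)) ^ N + (- f a) * (/ cexp (u, v)) ^ N)
             + a * (/ cexp (u, v) * (/ cexp (u, v)) ^ N * H (u, v)))).
        + assert (R1 : rcont (fun v => f (cexp (u, v)) * (/ cexp (u, v)) ^ N)) by now apply taylor_mean_rcont.
          assert (R2 : rcont (fun v => (/ cexp (u, v)) ^ N)) by (apply (cmean_rcont (fun z => (/ cexp z) ^ N)); auto).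
          assert (R3 : rcont (fun v => / cexp (u, v) * (/ cexp (u, v)) ^ N * H (u, v))).
          { apply (cmean_rcont (fun z => (/ cexp z) ^ (S N) * H z)). intros z. now apply ccont_mult. }
          rewrite cint_plus, cint_plus, !cint_scal; auto using rcont_plus, rcont_scal. ring.
        + intros v. unfold H.
          set (z := cexp (u, v)). assert (z <> 0) by apply cexp_neq0.
          rewrite (E z). field. easy. }
    specialize (S N). unfold H at 1 in S. rewrite (cauchy_slope f phi a) in S by easy.
    fold H in S.
    replace (RtoC (2 * PI) * (csum (fun n => taylor_coef f n * a ^ n) N - match N with O => 0 | _ => f a end))
      with (csum (fun n => a ^ n * (cmean (fun z => f (cexp z) * (/ cexp z) ^ n) u
        - f a * cmean (fun z => (/ cexp z) ^ n) u)) N).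
    { rewrite <- (Cplus_0_r (csum _ N)).
      replace (RtoC 0) with (a ^ N * cmean (fun z => (/ cexp z) ^ N * H z) u - a ^ N * cmean (fun z => (/ cexp z) ^ N * H z) u) by ring.
      unfold Cminus at 2. rewrite Cplus_assoc, <- S. ring. }
    clear S. destruct N as [|N]; [simpl; ring|].
    transitivity (csum (fun n => RtoC (2 * PI) * (taylor_coef f n * a ^ n)) (S N) - RtoC (2 * PI) * f a).
    2: { rewrite csum_scal. ring. }
    rewrite !csum_S_l. rewrite (csum_ext _ (fun k => RtoC (2 * PI) * (taylor_coef f (S k) * a ^ S k))).
    - rewrite taylor_coef_mean by easy.
      replace (cmean (fun z => (/ cexp z) ^ 0) u) with (RtoC (2 * PI)).
      2: { unfold cmean. simpl. rewrite cint_const, Rminus_0_r. ring. }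
      change (a ^ 0) with (RtoC 1). ring.
    - intros k _. rewrite taylor_coef_mean by easy. rewrite cmean_cexp_pow by lia. ring. }
  intros e He.
  destruct (pow_lt_1_zero (/ 2) ltac:(rewrite Rabs_pos_eq; lra) (e / (2 * (Rabs B + 1)))%R) as [N HN].
  { assert (P := Rabs_pos B). apply Rdiv_lt_0_compat; lra. }
  exists (S N). intros n Hn. specialize (K n). destruct n as [|n]; [lia|].
  specialize (HN (S n) ltac:(lia)). rewrite Rabs_pos_eq in HN by (apply pow_le; lra).
  assert (PB := Rabs_pos B). assert (LB := Rle_abs B).
  assert (Bd : (Cmod (a ^ S n * cmean (fun z => ((/ cexp z) ^ S n * H z)%C) u)
      <= (/ 2) ^ S n * (2 * (Rabs B + 1)) * (2 * PI))%R).
  { rewrite Cmod_mult, Cmod_pow.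
    eapply Rle_trans.
    { apply Rmult_le_compat_l; [apply pow_le, Cmod_ge_0|].
      apply cint_bound with (M := ((/ r) ^ S n * (Rabs B + 1))%R); [|lra|].
      - apply (cmean_rcont (fun z => (/ cexp z) ^ S n * H z)). intros z. now apply ccont_mult.
      - intros t Ht. rewrite Cmod_mult, Cmod_pow, Cmod_inv, Hz by apply cexp_neq0.
        apply Rmult_le_compat_l.
        + apply pow_le, Rlt_le, Rinv_0_lt_compat, Hr.
        + specialize (HB t Ht). lra. }
    rewrite Rminus_0_r.
    replace (Cmod a ^ S n * (2 * ((/ r) ^ S n * (Rabs B + 1)) * (2 * PI)))%R
      with ((Cmod a * / r) ^ S n * (2 * (Rabs B + 1)) * (2 * PI))%R by (rewrite Rpow_mult_distr; ring).
    apply Rmult_le_compat_r; [lra|]. apply Rmult_le_compat_r; [lra|].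
    apply pow_incr. split.
    - apply Rmult_le_pos; [easy|]. now apply Rlt_le, Rinv_0_lt_compat.
    - apply Rmult_le_reg_r with r; [easy|]. rewrite Rmult_assoc, Rinv_l by lra. unfold r. lra. }
  apply Rmult_lt_reg_l with (2 * PI)%R; [easy|].
  rewrite <- (Cmod_RtoC_pos (2 * PI)) at 1 by lra. rewrite <- Cmod_mult, K, Cmod_opp.
  eapply Rle_lt_trans; [exact Bd|]. rewrite Rmult_comm. apply Rmult_lt_compat_l; [easy|].
  apply Rlt_le_trans with (e / (2 * (Rabs B + 1)) * (2 * (Rabs B + 1)))%R.
  - apply Rmult_lt_compat_r; lra.
  - right. field. lra.
Qed.

(** * Newton interpolation of power series *)

(** A weighted [l^1] norm of the coefficients. It bounds the sum on the disc of radius [r], and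
    division by [u - v] has a simple cost in it. *)
Definition wbound (b : nat -> C) (r G : R) : Prop :=
  forall n, (rsum (fun k => Cmod (b k) * r ^ k) n <= G)%R.

(** If [b] has sum [g], then [tail v b 0 = g v], and the [tail v b (m + 1)] are the coefficients of
    [(g u - g v) / (u - v)]. *)
Definition tail (v : C) (b : nat -> C) (m : nat) : C :=
  the_C (fun l => cv (csum (fun j => b (m + j)%nat * v ^ j)) l).

Lemma wbound_summable b r G v : (Cmod v <= r)%R -> wbound b r G -> summable (fun j => b j * v ^ j).
Proof.
  intros Hv H. apply summable_le with (fun k => Cmod (b k) * r ^ k)%R G; [|easy].
  intros k. rewrite Cmod_mult, Cmod_pow. apply Rmult_le_compat_l; [apply Cmod_ge_0|].
  apply pow_incr. split; [apply Cmod_ge_0|easy].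
Qed.

Lemma tail_cv v b r G m : (0 < r)%R -> (Cmod v <= r)%R -> wbound b r G ->
  cv (csum (fun j => b (m + j)%nat * v ^ j)) (tail v b m).
Proof.
  intros Hr Hv H. unfold tail, the_C. apply epsilon_spec. apply summable_cv.
  apply summable_le with (fun k => / r ^ m * (Cmod (b (m + k)%nat) * r ^ (m + k)))%R (/ r ^ m * G)%R.
  - intros k. rewrite Cmod_mult, Cmod_pow, pow_add.
    assert (0 < r ^ m)%R by now apply pow_lt.
    replace (/ r ^ m * (Cmod (b (m + k)%nat) * (r ^ m * r ^ k)))%R
      with (Cmod (b (m + k)%nat) * r ^ k)%R by (field; lra).
    apply Rmult_le_compat_l; [apply Cmod_ge_0|].
    apply pow_incr. split; [apply Cmod_ge_0|easy].
  - intros n. rewrite (rsum_scal (/ r ^ m) (fun k => Cmod (b (m + k)%nat) * r ^ (m + k))%R).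
    apply Rmult_le_compat_l; [apply Rlt_le, Rinv_0_lt_compat; now apply pow_lt|].
    specialize (H (m + n)%nat). rewrite rsum_add in H.
    assert (0 <= rsum (fun k => Cmod (b k) * r ^ k)%R m)%R; [|lra].
    apply rsum_pos. intros. apply Rmult_le_pos; [apply Cmod_ge_0|apply pow_le; lra].
Qed.

Lemma tail_rec v b r G m : (0 < r)%R -> (Cmod v <= r)%R -> wbound b r G ->
  tail v b m = b m + v * tail v b (S m).
Proof.
  intros Hr Hv H. apply cv_unique with (csum (fun j => b (m + j)%nat * v ^ j)).
  - now apply tail_cv with r G.
  - apply cv_of_shift.
    apply cv_ext_from with 0%nat (fun n => b m + v * csum (fun j => b (S m + j)%nat * v ^ j) n).
    + intros n _. rewrite csum_S_l, Nat.add_0_r, <- csum_scal. simpl.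
      rewrite Cmult_1_r. f_equal. apply csum_ext. intros k _. rewrite Nat.add_succ_r. ring.
    + apply cv_plus; [apply cv_const|]. apply cv_scal. now apply tail_cv with r G.
Qed.

(** Only the part of [G] left over by the first [m] coefficients is spent; this surplus closes the
    estimate of [tail_step_bound]. *)
Lemma tail_bound v b r G m : (0 < r)%R -> (Cmod v <= r)%R -> wbound b r G ->
  (Cmod (tail v b m) * r ^ m <= G - rsum (fun k => Cmod (b k) * r ^ k)%R m)%R.
Proof.
  intros Hr Hv H.
  replace (Cmod (tail v b m) * r ^ m)%R with (Cmod (RtoC (r ^ m) * tail v b m)).
  2: { rewrite Cmod_mult, Cmod_RtoC_pos; [ring|]. apply pow_le; lra. }
  apply cv_le_bound with (fun n => RtoC (r ^ m) * csum (fun j => b (m + j)%nat * v ^ j) n).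
  { apply cv_scal. now apply tail_cv with r G. }
  intros n. rewrite Cmod_mult, Cmod_RtoC_pos by (apply pow_le; lra).
  specialize (H (m + n)%nat). rewrite rsum_add in H.
  assert (r ^ m * Cmod (csum (fun j => (b (m + j)%nat * v ^ j)%C) n)
     <= rsum (fun k => Cmod (b (m + k)%nat) * r ^ (m + k))%R n)%R; [|lra].
  eapply Rle_trans; [apply Rmult_le_compat_l; [apply pow_le; lra|apply Cmod_csum]|].
  rewrite <- rsum_scal. apply rsum_le. intros k _. rewrite Cmod_mult, Cmod_pow, pow_add.
  assert (Cmod (b (m + k)%nat) * Cmod v ^ k <= Cmod (b (m + k)%nat) * r ^ k)%R.
  { apply Rmult_le_compat_l; [apply Cmod_ge_0|]. apply pow_incr. split; [apply Cmod_ge_0|easy]. }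
  assert (0 < r ^ m)%R by now apply pow_lt. nra.
Qed.

(** From [tail m = b m + v * tail (m + 1)] the norm [s] of the quotient satisfies
    [r s <= G + |v| s]. For partial sums one boundary term is missing, and [tail_bound] pays for
    it. *)
Lemma tail_step_bound v b r G : (Cmod v < r)%R -> wbound b r G ->
  wbound (fun m => tail v b (S m)) r (G / (r - Cmod v)).
Proof.
  intros Hv H n. assert (Pv := Cmod_ge_0 v). 
  set (B := tail v b). set (s := rsum (fun m => Cmod (B (S m)) * r ^ m)%R n).
  set (w := rsum (fun k => Cmod (b k) * r ^ k)%R (S n)).
  assert (E1 : (rsum (fun m => Cmod (B m) * r ^ m)%R (S n) = Cmod (B 0%nat) + r * s)%R).
  { rewrite rsum_S_l. unfold s. rewrite <- rsum_scal. simpl. f_equal; [ring|].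
    apply rsum_ext. intros. ring. }
  assert (E2 : (rsum (fun m => Cmod (B m) * r ^ m)%R (S n)
      <= w + Cmod v * rsum (fun m => Cmod (B (S m)) * r ^ m)%R (S n))%R).
  { unfold w. rewrite <- rsum_scal.
    assert (forall (a c : nat -> R) k, (rsum a k + rsum c k = rsum (fun i => a i + c i)%R k)%R) as Hp.
    { intros a c k. induction k; simpl; [ring|]. rewrite <- IHk. ring. }
    rewrite Hp. apply rsum_le. intros k _. unfold B. rewrite (tail_rec v b r G k) by (easy || lra).
    rewrite <- Rmult_assoc, <- Cmod_mult, <- Rmult_plus_distr_r.
    apply Rmult_le_compat_r; [apply pow_le; lra|apply Cmod_triangle]. }
  assert (E3 : (Cmod (B (S n)) * r ^ S n <= G - w)%R) by (apply tail_bound; easy || lra).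
  simpl rsum in E2 at 2. fold s in E2. rewrite E1 in E2.
  assert (Pb := Cmod_ge_0 (B 0%nat)). assert (Pbn := Cmod_ge_0 (B (S n))).
  assert (E4 : (Cmod v * (Cmod (B (S n)) * r ^ n) <= G - w)%R).
  { eapply Rle_trans; [|exact E3]. simpl. rewrite <- Rmult_assoc, (Rmult_comm (Cmod v)), Rmult_assoc.
    apply Rmult_le_compat_l; [easy|]. apply Rmult_le_compat_r; [apply pow_le|]; lra. }
  apply Rmult_le_reg_r with (r - Cmod v)%R; [lra|]. unfold Rdiv.
  rewrite Rmult_assoc, Rinv_l, Rmult_1_r by lra. fold s. lra.
Qed.

Lemma tail_step_sum v b r G u n : (0 < r)%R -> (Cmod v <= r)%R -> wbound b r G ->
  (u - v) * csum (fun m => tail v b (S m) * u ^ m) n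
  = csum (fun m => b m * u ^ m) n - tail v b 0 + tail v b n * u ^ n.
Proof.
  intros Hr Hv H. induction n; simpl; [ring|].
  rewrite Cmult_plus_distr_l, IHn, (tail_rec v b r G n) by easy. ring.
Qed.

(** Coefficients, in powers of [u], of the divided difference at the nodes [v 0, ..., v (N - 1), u].
    Its value at [u = v N] is the Newton coefficient [ncoef]. *)
Fixpoint ndiv (v : nat -> C) (b : nat -> C) (N : nat) : nat -> C :=
  match N with
  | O => b
  | S N' => fun m => tail (v N') (ndiv v b N') (S m)
  end.

Definition ncoef (v : nat -> C) (b : nat -> C) (N : nat) : C := tail (v N) (ndiv v b N) 0.

Fixpoint npoly (v : nat -> C) (k : nat) (u : C) : C :=
  match k with O => 1 | S m => npoly v m u * (u - v m) end.

Fixpoint rprod (a : nat -> R) (n : nat) : R :=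
  match n with O => 1%R | S m => (rprod a m * a m)%R end.

Lemma rprod_pos a n : (forall k, (k < n)%nat -> (0 < a k)%R) -> (0 < rprod a n)%R.
Proof. induction n; intros H; simpl; [lra|]. apply Rmult_lt_0_compat; auto. Qed.

Lemma rprod_nonneg a n : (forall k, (k < n)%nat -> (0 <= a k)%R) -> (0 <= rprod a n)%R.
Proof. induction n; intros H; simpl; [lra|]. apply Rmult_le_pos; auto. Qed.

Lemma rprod_le a b n : (forall k, (k < n)%nat -> (0 <= a k <= b k)%R) -> (rprod a n <= rprod b n)%R.
Proof.
  induction n; intros H; simpl; [lra|]. apply Rmult_le_compat; auto.
  - apply rprod_nonneg. intros; apply H; lia.
  - apply H; lia.
  - apply H; lia.
Qed.

Lemma rprod_mult a b n : rprod (fun k => a k * b k)%R n = (rprod a n * rprod b n)%R.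
Proof. induction n; simpl; [ring|]. rewrite IHn. ring. Qed.

Lemma rprod_exp a n : rprod (fun k => exp (a k)) n = exp (rsum a n).
Proof. induction n; simpl; [now rewrite exp_0|]. now rewrite IHn, exp_plus. Qed.

Lemma ndiv_bound v b r G N : (forall j, (j < N)%nat -> (Cmod (v j) < r)%R) -> wbound b r G ->
  wbound (ndiv v b N) r (G / rprod (fun j => r - Cmod (v j))%R N).
Proof.
  induction N; intros Hv H; simpl.
  - unfold Rdiv. now rewrite Rinv_1, Rmult_1_r.
  - assert (P : (0 < rprod (fun j => r - Cmod (v j))%R N)%R).
    { apply rprod_pos. intros k Hk. specialize (Hv k ltac:(lia)). lra. }
    assert (Q := Hv N ltac:(lia)).
    replace (G / (rprod (fun j => r - Cmod (v j)) N * (r - Cmod (v N))))%R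
      with (G / rprod (fun j => r - Cmod (v j)) N / (r - Cmod (v N)))%R by (field; lra).
    apply tail_step_bound; [easy|]. apply IHN; auto.
Qed.

Definition everywhere_summable (b : nat -> C) : Prop := forall r, (0 < r)%R -> exists G, wbound b r G.

Lemma ndiv_everywhere v b N : everywhere_summable b -> everywhere_summable (ndiv v b N).
Proof.
  intros H. induction N; simpl; [easy|]. intros r Hr.
  destruct (IHN (r + Cmod (v N) + 1)%R) as [G HG]. { assert (P := Cmod_ge_0 (v N)). lra. }
  assert (P := Cmod_ge_0 (v N)).
  exists (G / (r + Cmod (v N) + 1 - Cmod (v N)))%R.
  intros n. eapply Rle_trans; [|apply (tail_step_bound (v N) (ndiv v b N)); [|exact HG]; lra].
  apply rsum_le. intros k _. apply Rmult_le_compat_l; [apply Cmod_ge_0|].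
  apply pow_incr. lra.
Qed.

Lemma newton_identity v b g u N : everywhere_summable b ->
  cv (csum (fun m => b m * u ^ m)) g ->
  exists gN, cv (csum (fun m => ndiv v b N m * u ^ m)) gN /\
    g = csum (fun k => ncoef v b k * npoly v k u) N + npoly v N u * gN.
Proof.
  intros Hb Hg. induction N.
  - exists g. split; [easy|]. simpl. ring.
  - destruct IHN as [gN [H E]].
    assert (P := Cmod_ge_0 (v N)). assert (Pu := Cmod_ge_0 u).
    (* With [r >= 2 |u|] the boundary term of [tail_step_sum] decays like [(/ 2) ^ n]. *)
    set (r := (2 * (Cmod (v N) + Cmod u + 1))%R).
    assert (Hr : (0 < r)%R) by (unfold r; lra).
    destruct (ndiv_everywhere v b N Hb r Hr) as [G HG].
    destruct (ndiv_everywhere v b (S N) Hb r Hr) as [G' HG'].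
    destruct (summable_cv _ (wbound_summable _ r G' u ltac:(unfold r; lra) HG')) as [l Hl].
    exists l. split; [easy|].
    assert (F : (u - v N) * l = gN - tail (v N) (ndiv v b N) 0 + 0).
    { apply cv_unique with (fun n => (u - v N) * csum (fun m => ndiv v b (S N) m * u ^ m) n).
      - now apply cv_scal.
      - apply cv_ext_from with 0%nat (fun n => csum (fun m => ndiv v b N m * u ^ m) n - tail (v N) (ndiv v b N) 0
           + tail (v N) (ndiv v b N) n * u ^ n).
        + intros n _. symmetry. apply tail_step_sum with r G; [easy|unfold r; lra|easy].
        + apply cv_plus; [apply cv_minus; [easy|apply cv_const]|].
          apply cv_0_geom with G (/ 2)%R; [lra|]. intros n.
          assert (T := tail_bound (v N) (ndiv v b N) r G n Hr ltac:(unfold r; lra) HG).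
          assert (0 <= rsum (fun k => Cmod (ndiv v b N k) * r ^ k)%R n)%R.
          { apply rsum_pos. intros. apply Rmult_le_pos; [apply Cmod_ge_0|apply pow_le; lra]. }
          rewrite Cmod_mult, Cmod_pow.
          apply Rle_trans with (Cmod (tail (v N) (ndiv v b N) n) * r ^ n * (/ 2) ^ n)%R.
          * rewrite Rmult_assoc, <- Rpow_mult_distr. apply Rmult_le_compat_l; [apply Cmod_ge_0|].
            apply pow_incr. unfold r. lra.
          * apply Rmult_le_compat_r; [apply pow_le; lra|lra]. }
    rewrite E. simpl. unfold ncoef.
    rewrite <- Cmult_assoc, F. ring.
Qed.

Lemma Cmod_npoly v k u : (Cmod (npoly v k u) <= rprod (fun j => Cmod u + Cmod (v j))%R k)%R.
Proof.
  induction k; simpl; [rewrite Cmod_1; lra|]. rewrite Cmod_mult.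
  apply Rmult_le_compat; try apply Cmod_ge_0; [easy|apply Cmod_sub_le].
Qed.

Lemma Cmod_powerseries_le b r G u g : (Cmod u <= r)%R -> wbound b r G ->
  cv (csum (fun m => b m * u ^ m)) g -> (Cmod g <= G)%R.
Proof.
  intros Hu HG Hg. apply cv_le_bound with (csum (fun m => b m * u ^ m)); [easy|].
  intros n. eapply Rle_trans; [apply Cmod_csum|]. eapply Rle_trans; [|apply (HG n)].
  apply rsum_le. intros k _. rewrite Cmod_mult, Cmod_pow. apply Rmult_le_compat_l; [apply Cmod_ge_0|].
  apply pow_incr. split; [apply Cmod_ge_0|easy].
Qed.

(** The remainder is [npoly v N u] times a series whose norm has grown by [1 / (r - |v j|)] at each
    division. The radius may depend on [N], as it must for the unbounded nodes of [rho]. *)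
Theorem newton_series v b g u : everywhere_summable b ->
  cv (csum (fun m => b m * u ^ m)) g ->
  (forall eps, (0 < eps)%R -> exists N0, forall N, (N0 <= N)%nat -> exists r G,
     (Cmod u <= r)%R /\ (forall j, (j < N)%nat -> (Cmod (v j) < r)%R) /\ wbound b r G /\
     (G * rprod (fun j => (Cmod u + Cmod (v j)) / (r - Cmod (v j)))%R N < eps)%R) ->
  cv (csum (fun k => ncoef v b k * npoly v k u)) g.
Proof.
  intros Hb Hg H eps He. destruct (H eps He) as [N0 HN0]. exists N0. intros N HN.
  destruct (HN0 N HN) as [r [G [Hu [Hv [HG Hlt]]]]].
  destruct (newton_identity v b g u N Hb Hg) as [gN [HgN E]].
  rewrite E, Cmod_minus_sym.
  match goal with |- (Cmod ?t < _)%R => replace t with (npoly v N u * gN) by ring end.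
  rewrite Cmod_mult. eapply Rle_lt_trans; [|exact Hlt].
  assert (B := Cmod_powerseries_le _ r _ u gN Hu (ndiv_bound v b r G N Hv HG) HgN).
  eapply Rle_trans; [apply Rmult_le_compat; [apply Cmod_ge_0|apply Cmod_ge_0|apply Cmod_npoly|exact B]|].
  assert (P : (0 < rprod (fun j => r - Cmod (v j))%R N)%R).
  { apply rprod_pos. intros k Hk. specialize (Hv k Hk). lra. }
  right. unfold Rdiv at 2. rewrite rprod_mult.
  replace (rprod (fun k => / (r - Cmod (v k)))%R N) with (/ rprod (fun j => r - Cmod (v j))%R N)%R.
  { unfold Rdiv. ring. }
  clear -Hv. induction N; simpl; [apply Rinv_1|].
  rewrite Rinv_mult, IHN; [easy|]. intros; apply Hv; lia.
Qed.

(** * The functions [rho] as Newton polynomials in [x ^ 2] *)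

(** Half-angle formulas; the imaginary part takes the sign of [b]. *)
Lemma Csqrt_exists (w : C) : exists s : C, s * s = w.
Proof.
  destruct w as [a b]. set (r := sqrt (a * a + b * b)).
  assert (Hab : (0 <= a * a + b * b)%R) by nra.
  assert (Hr : (r * r = a * a + b * b)%R) by now apply sqrt_sqrt.
  assert (Hr0 : (0 <= r)%R) by apply sqrt_pos.
  assert (Ha : (Rabs a <= r)%R).
  { apply Rsqr_incr_0_var; [|easy]. rewrite <- Rsqr_abs. unfold Rsqr. nra. }
  assert (A1 := Rle_abs a). assert (A2 := Rle_abs (- a)). rewrite Rabs_Ropp in A2.
  set (c := sqrt ((r + a) / 2)). set (d := sqrt ((r - a) / 2)).
  assert (Hc : (c * c = (r + a) / 2)%R) by (apply sqrt_sqrt; lra).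
  assert (Hd : (d * d = (r - a) / 2)%R) by (apply sqrt_sqrt; lra).
  assert (Hc0 : (0 <= c)%R) by apply sqrt_pos. assert (Hd0 : (0 <= d)%R) by apply sqrt_pos.
  assert (Hcd : (2 * (c * d) = Rabs b)%R).
  { apply Rsqr_inj; [nra|apply Rabs_pos|]. rewrite <- Rsqr_abs. unfold Rsqr.
    replace (2 * (c * d) * (2 * (c * d)))%R with (4 * (c * c) * (d * d))%R by ring.
    rewrite Hc, Hd. replace (4 * ((r + a) / 2) * ((r - a) / 2))%R with (r * r - a * a)%R by field. lra. }
  destruct (Rle_dec 0 b) as [Hb|Hb].
  - rewrite Rabs_pos_eq in Hcd by easy. exists (c, d). unfold Cmult; simpl. f_equal; lra.
  - rewrite Rabs_left in Hcd by lra. exists (c, (- d)%R). unfold Cmult; simpl. f_equal; lra.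
Qed.

Lemma C2_neq0 : RtoC 2 <> 0.
Proof. intros C. apply RtoC_inj in C. lra. Qed.

(** If [s * s = x * x - 1], then [x + s] and [x - s] are inverse to each other and have mean [x]. *)
Lemma expi_spec x : expi x <> 0 /\ cosz (expi x) = x.
Proof.
  unfold expi. apply epsilon_spec. destruct (Csqrt_exists (x * x - 1)) as [s Hs].
  assert (E : (x + s) * (x - s) = 1).
  { replace ((x + s) * (x - s)) with (x * x - s * s) by ring. rewrite Hs. ring. }
  assert (Hz : x + s <> 0).
  { intros C. rewrite C in E. apply C1_nz. rewrite <- E. ring. }
  exists (x + s). split; [easy|]. unfold cosz.
  replace (/ (x + s)) with (x - s).
  - field.
  - rewrite <- (Cmult_1_l (/ (x + s))), <- E. now field.
Qed.

Lemma qpoch_split a q n : qpoch a q (S n) = (1 - a) * qpoch (a * RtoC q) q n.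
Proof.
  induction n.
  - simpl. ring.
  - change (qpoch a q (S (S n))) with (qpoch a q (S n) * (1 - a * RtoC (q ^ S n))).
    rewrite IHn. simpl. rewrite RtoC_mult. ring.
Qed.

(** The value of [x ^ 2] at [z = i q^(n/2)]. *)
Definition node (q : R) (n : nat) : R := ((2 - q ^ n - / q ^ n) / 4)%R.

Lemma Rpower_opp_nat q n : (0 < q)%R -> Rpower q (- INR n) = (/ q ^ n)%R.
Proof. intros H. now rewrite Rpower_Ropp, Rpower_pow. Qed.

Lemma sq_of_cosz (z : C) : z <> 0 -> 4 * (cosz z * cosz z) = z * z + 2 + / (z * z).
Proof. intros Hz. unfold cosz. field. easy. Qed.

(** [rho] as a function of [z] itself, free of the choice made by [expi], with [q^(2-n)] written as
    [q / q ^ m] for [n = m + 1]. *)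
Definition rhoz (q : R) (n : nat) (z : C) : C :=
  match n with
  | O => 1
  | S m => (1 + z ^ 2) * qpoch (- RtoC (q / q ^ m) * z ^ 2) (q ^ 2) m / z ^ n
  end.

Lemma rho_rhoz q n x : (0 < q)%R -> rho q n x = rhoz q n (expi x).
Proof.
  intros Hq. destruct n as [|m]; [easy|]. unfold rho, rhoz.
  replace (Rpower q (2 - INR (S m))) with (q / q ^ m)%R; [easy|].
  unfold Rdiv. rewrite <- Rpower_opp_nat by easy. rewrite <- (Rpower_1 q) at 1 by easy.
  rewrite <- Rpower_plus. f_equal. rewrite S_INR. ring.
Qed.

Lemma rhoz_1 q (z : C) : z <> 0 -> rhoz q 1 z = 2 * cosz z.
Proof. intros Hz. unfold rhoz, cosz. simpl. field. easy. Qed.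

(** From [n] to [n + 2] the [q^2]-product gains one factor at each end, [1 + q^(-n) z^2] and
    [1 + q^n z^2]; divided by [z^2], their product is [4 (x^2 - node)]. The case [n = 0] stands
    apart because [rho_0 = 1] does not follow the general formula. *)
Lemma rhoz_SS q n (z : C) : (0 < q)%R -> z <> 0 ->
  rhoz q (S (S n)) z = rhoz q n z * (4 * (cosz z ^ 2 - RtoC (node q n))).
Proof.
  intros Hq Hz.
  assert (E4 : 4 * (cosz z ^ 2 - RtoC (node q n))
     = z * z + / (z * z) + RtoC (q ^ n) + RtoC (/ q ^ n)).
  { replace (4 * (cosz z ^ 2 - RtoC (node q n))) with (4 * (cosz z * cosz z) - 4 * RtoC (node q n)) by ring.
    rewrite sq_of_cosz by easy.
    replace (4 * RtoC (node q n)) with (RtoC (2 - q ^ n - / q ^ n)).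
    2: { rewrite <- RtoC_mult. f_equal. unfold node. field. apply pow_nonzero. lra. }
    rewrite !RtoC_minus. ring. }
  rewrite E4. destruct n as [|m].
  - unfold rhoz. simpl. replace (q / (q * 1))%R with 1%R by (field; lra). rewrite Rinv_1. field. easy.
  - unfold rhoz. set (Q := (q ^ 2)%R).
    assert (Hpow : (q ^ m <> 0)%R) by (apply pow_nonzero; lra).
    rewrite qpoch_split.
    replace (- RtoC (q / q ^ S (S m)) * z ^ 2 * RtoC Q) with (- RtoC (q / q ^ m) * z ^ 2).
    2: { replace (q / q ^ m)%R with (q / q ^ S (S m) * Q)%R by (unfold Q; simpl; field; auto with real).
         rewrite (RtoC_mult _ Q). ring. }
    change (qpoch (- RtoC (q / q ^ m) * z ^ 2) Q (S m))
      with (qpoch (- RtoC (q / q ^ m) * z ^ 2) Q m * (1 - (- RtoC (q / q ^ m) * z ^ 2) * RtoC (Q ^ m))).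
    replace ((- RtoC (q / q ^ m) * z ^ 2) * RtoC (Q ^ m)) with (- RtoC (q ^ S m) * z ^ 2).
    2: { replace (q ^ S m)%R with (q / q ^ m * Q ^ m)%R.
         2: { unfold Q. rewrite <- pow_mult. replace (2 * m)%nat with (m + m)%nat by lia.
              rewrite pow_add. simpl. field. easy. }
         rewrite (RtoC_mult _ (Q ^ m)). ring. }
    replace (q / q ^ S (S m))%R with (/ q ^ S m)%R by (simpl; field; split; [easy|lra]).
    set (P := qpoch _ Q m).
    replace (z ^ S (S (S m))) with (z ^ S m * (z * z)) by (simpl; ring).
    assert (Hzm : z ^ S m <> 0) by now apply Cpow_nz.
    assert (HR : RtoC (/ q ^ S m) * RtoC (q ^ S m) = 1).
    { rewrite <- RtoC_mult. f_equal. apply Rinv_l. apply pow_nonzero. lra. }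
    set (a := RtoC (/ q ^ S m)) in *. set (b := RtoC (q ^ S m)) in *.
    replace (z * z + / (z * z) + b + a) with ((a * b) * (z * z) + / (z * z) + b + a) by (rewrite HR; ring).
    clearbody P a b. set (w := z ^ S m) in *. clearbody w. field. auto.
Qed.

Lemma rho_1 q x : (0 < q)%R -> rho q 1 x = 2 * x.
Proof. intros Hq. destruct (expi_spec x) as [Hz Hx]. now rewrite rho_rhoz, rhoz_1, Hx. Qed.

Lemma rho_SS q n x : (0 < q)%R ->
  rho q (S (S n)) x = rho q n x * (4 * (x ^ 2 - RtoC (node q n))).
Proof.
  intros Hq. destruct (expi_spec x) as [Hz Hx].
  rewrite !rho_rhoz, rhoz_SS, Hx by easy. reflexivity.
Qed.

Definition nodes (q : R) (s j : nat) : C := RtoC (node q (2 * j + s)).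

Lemma rho_even q k x : (0 < q)%R -> rho q (2 * k) x = 4 ^ k * npoly (nodes q 0) k (x ^ 2).
Proof.
  intros Hq. induction k; [simpl; ring|].
  replace (2 * S k)%nat with (S (S (2 * k))) by lia.
  rewrite rho_SS, IHk by easy. simpl npoly. unfold nodes. rewrite Nat.add_0_r.
  change (4 ^ S k) with (4 * 4 ^ k). ring.
Qed.

Lemma rho_odd q k x : (0 < q)%R -> rho q (2 * k + 1) x = 2 * x * (4 ^ k * npoly (nodes q 1) k (x ^ 2)).
Proof.
  intros Hq. induction k; [simpl (2 * 0 + 1)%nat; rewrite rho_1 by easy; simpl; ring|].
  replace (2 * S k + 1)%nat with (S (S (2 * k + 1))) by lia.
  rewrite rho_SS, IHk by easy. simpl npoly. unfold nodes.
  change (4 ^ S k) with (4 * 4 ^ k). ring.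
Qed.

Lemma exp_pow x n : (exp x ^ n = exp (INR n * x))%R.
Proof.
  induction n; [simpl; now rewrite Rmult_0_l, exp_0|].
  rewrite S_INR. simpl. rewrite IHn, <- exp_plus. f_equal. ring.
Qed.

Lemma rsum_rev a n : rsum (fun j => a (n - 1 - j)%nat) n = rsum a n.
Proof.
  induction n; [easy|]. rewrite rsum_S_l.
  rewrite (rsum_ext (fun k => a (S n - 1 - S k)%nat) (fun k => a (n - 1 - k)%nat)).
  - rewrite IHn. simpl. rewrite !Nat.sub_0_r. ring.
  - intros k Hk. f_equal. lia.
Qed.

(** The sum of the first [n] odd numbers: the source of the decay [exp (- n^2 L)]. *)
Lemma rsum_odd n L : rsum (fun j => - (INR (2 * j + 1) * L))%R n = (- (INR n * INR n * L))%R.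
Proof.
  induction n; [simpl; ring|].
  match goal with |- rsum ?f (S n) = _ => change (rsum f (S n)) with (rsum f n + f n)%R end.
  rewrite IHn. cbv beta. rewrite S_INR, plus_INR, mult_INR. simpl. ring.
Qed.

Lemma node_abs q n : (0 < q < 1)%R -> (Rabs (node q n) <= / q ^ n / 4)%R.
Proof.
  intros Hq. unfold node.
  assert (H : (0 < q ^ n <= 1)%R).
  { split; [apply pow_lt; lra|]. rewrite <- (pow1 n). apply pow_incr. lra. }
  assert (H1 : (/ q ^ n * q ^ n = 1)%R) by (apply Rinv_l; lra).
  set (x := (q ^ n)%R) in *. set (y := (/ x)%R) in *.
  apply Rabs_le. split; nra.
Qed.

(** With [lL = ln (/ q)], node number [2 j + s] has modulus at most [exp ((2 j + s) lL) / 4];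
    the radius [exp ((2 n + s - 1) lL) / 4] separates the first [n] nodes from the rest. *)
Lemma node_ratio_prod q s n u : (0 < q < 1)%R -> (0 <= u)%R ->
  let lL := ln (/ q) in
  let r := (exp ((2 * INR n + INR s - 1) * lL) / 4)%R in
  (forall j, (j < n)%nat -> (Cmod (nodes q s j) < r)%R) /\
  (rprod (fun j => (u + Cmod (nodes q s j)) / (r - Cmod (nodes q s j)))%R n
   <= exp (4 * u / (1 - q) + / (1 - q) / (1 - q)) * exp (- (INR n * INR n * lL)))%R.
Proof.
  intros Hq Hu lL r.
  assert (HlL : (0 < lL)%R).
  { unfold lL. rewrite ln_Rinv by lra. assert (ln q < 0)%R; [|lra]. rewrite <- ln_1. apply ln_increasing; lra. }
  assert (Hexp : forall k, (/ q ^ k = exp (INR k * lL))%R).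
  { intros k. rewrite <- pow_inv, <- exp_pow. unfold lL. rewrite exp_ln; [easy|]. apply Rinv_0_lt_compat; lra. }
  assert (Hq' : forall k, (q ^ k = exp (- (INR k * lL)))%R).
  { intros k. rewrite exp_Ropp, <- Hexp, Rinv_inv. easy. }
  set (V := fun j => (exp (INR (2 * j + s) * lL) / 4)%R).
  assert (HV : forall j, (0 < V j)%R) by (intros; unfold V; assert (P := exp_pos (INR (2 * j + s) * lL)); lra).
  assert (HvV : forall j, (Cmod (nodes q s j) <= V j)%R).
  { intros j. unfold nodes, V. rewrite Cmod_R, <- Hexp. apply node_abs, Hq. }
  assert (HVr : forall j, (j < n)%nat -> (V j = r * exp (- (INR (2 * (n - 1 - j) + 1) * lL)))%R).
  { intros j Hj. unfold V, r. unfold Rdiv. rewrite (Rmult_comm _ (/ 4)), (Rmult_comm _ (/ 4)), Rmult_assoc.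
    f_equal. rewrite <- exp_plus. f_equal.
    rewrite !plus_INR, !mult_INR, minus_INR, minus_INR by lia. simpl. ring. }
  (* [x i = q^(2 i + 1)] is the ratio to [r] of the majorant [V] of a node, with [i] counted
     downwards from the last node, [j = n - 1]. *)
  set (x := fun i => exp (- (INR (2 * i + 1) * lL))).
  assert (Hx : forall i, (0 < x i <= q)%R /\ (x i <= q ^ i)%R).
  { intros i. assert (E : x i = (q ^ (2 * i + 1))%R) by (unfold x; now rewrite Hq').
    rewrite E. assert (0 < q ^ i)%R by (apply pow_lt; lra).
    assert (q ^ i <= 1)%R by (rewrite <- (pow1 i); apply pow_incr; lra).
    replace (q ^ (2 * i + 1))%R with (q * q ^ i * q ^ i)%R.
    2: { rewrite pow_add. replace (2 * i)%nat with (i + i)%nat by lia. rewrite pow_add. ring. }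
    split; [split|]; [| |].
    - repeat apply Rmult_lt_0_compat; lra.
    - assert (q ^ i * q ^ i <= 1)%R by nra. rewrite Rmult_assoc. nra.
    - nra. }
  assert (Hr : (0 < r)%R) by (unfold r; assert (P := exp_pos ((2 * INR n + INR s - 1) * lL)); lra).
  split.
  - intros j Hj. eapply Rle_lt_trans; [apply HvV|]. rewrite (HVr j Hj).
    destruct (Hx (n - 1 - j)%nat) as [[H1 H2] _]. unfold x in *. rewrite <- (Rmult_1_r r) at 2.
    apply Rmult_lt_compat_l; lra.
  - eapply Rle_trans.
    { apply rprod_le with (b := fun j => (exp (4 * u * q ^ j) *
         (exp (- (INR (2 * (n - 1 - j) + 1) * lL)) * exp (q ^ (n - 1 - j) / (1 - q))))%R).
      intros j Hj.
      assert (B := HvV j). assert (P0 := Cmod_ge_0 (nodes q s j)). set (v := Cmod (nodes q s j)) in *.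
      destruct (Hx (n - 1 - j)%nat) as [[H1 H2] H3].
      assert (EV := HVr j Hj). fold (x (n - 1 - j)%nat) in EV |- *. set (y := x (n - 1 - j)%nat) in *.
      set (w := (q ^ (n - 1 - j))%R) in *.
      assert (HVlt : (V j <= r * q)%R). { rewrite EV. apply Rmult_le_compat_l; lra. }
      assert (Hrv : (r - V j = r * (1 - y))%R) by (rewrite EV; ring).
      assert (Hpos : (0 < r * (1 - y))%R) by (apply Rmult_lt_0_compat; lra).
      split.
      { apply Rmult_le_pos; [lra|]. apply Rlt_le, Rinv_0_lt_compat. lra. }
      apply Rle_trans with ((u + V j) / (r - V j))%R.
      { apply Rmult_le_compat; [lra| |lra|].
        - apply Rlt_le, Rinv_0_lt_compat. lra.
        - apply Rinv_le_contravar; lra. }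
      (* The factor [y] carries all the decay. The products of [1 + u / V j] and of [1 / (1 - y)]
         stay bounded in [n], through geometric sums in the exponent. *)
      replace ((u + V j) / (r - V j))%R with ((1 + u / V j) * (y * / (1 - y)))%R.
      2: { rewrite Hrv. rewrite EV. field. repeat split; try lra. }
      assert (Hy1 : (0 < / (1 - y))%R) by (apply Rinv_0_lt_compat; lra).
      apply Rmult_le_compat.
      + assert (0 <= u / V j)%R; [|lra]. apply Rmult_le_pos; [easy|]. now apply Rlt_le, Rinv_0_lt_compat.
      + apply Rmult_le_pos; lra.
      + eapply Rle_trans; [|apply exp_ineq1_le]. apply Rplus_le_compat_l.
        unfold Rdiv. rewrite (Rmult_comm 4), Rmult_assoc. apply Rmult_le_compat_l; [easy|].
        unfold V. rewrite <- Hexp. unfold Rdiv. rewrite Rinv_mult, !Rinv_inv, Rmult_comm.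
        apply Rmult_le_compat_l; [lra|].
        replace (2 * j + s)%nat with (j + (j + s))%nat by lia. rewrite pow_add.
        rewrite <- (Rmult_1_r (q ^ j)) at 2. apply Rmult_le_compat_l; [apply pow_le; lra|].
        rewrite <- (pow1 (j + s)). apply pow_incr. lra.
      + apply Rmult_le_compat_l; [lra|].
        eapply Rle_trans; [|apply exp_ineq1_le].
        apply Rle_trans with (1 + w * / (1 - y))%R.
        * replace (/ (1 - y))%R with (1 + y * / (1 - y))%R at 1 by (field; lra).
          apply Rplus_le_compat_l. apply Rmult_le_compat_r; lra.
        * apply Rplus_le_compat_l. unfold Rdiv. apply Rmult_le_compat_l; [lra|].
          apply Rinv_le_contravar; lra. }
    rewrite rprod_mult, rprod_mult, !rprod_exp.
    rewrite (rsum_rev (fun i => - (INR (2 * i + 1) * lL))%R n).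
    rewrite (rsum_rev (fun i => q ^ i / (1 - q))%R n). rewrite rsum_odd.
    rewrite (rsum_scal (4 * u) (fun j => q ^ j)%R).
    rewrite (rsum_ext (fun i => q ^ i / (1 - q))%R (fun i => / (1 - q) * q ^ i)%R) by (intros; unfold Rdiv; ring).
    rewrite (rsum_scal (/ (1 - q)) (fun j => q ^ j)%R).
    assert (G := rsum_geom_le q n ltac:(lra)). set (S := rsum (fun k => (q ^ k)%R) n) in *.
    rewrite exp_plus.
    rewrite (Rmult_comm (exp (- (INR n * INR n * lL))) (exp (/ (1 - q) * S))), <- Rmult_assoc.
    apply Rmult_le_compat_r; [apply Rlt_le, exp_pos|].
    assert (Hinv : (0 < / (1 - q))%R) by (apply Rinv_0_lt_compat; lra).
    assert (Hm : forall a b, (a <= b)%R -> (exp a <= exp b)%R).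
    { intros a b [H| ->]; [apply Rlt_le; now apply exp_increasing|lra]. }
    apply Rmult_le_compat; try (apply Rlt_le, exp_pos); apply Hm.
    + unfold Rdiv. apply Rmult_le_compat_l; [lra|easy].
    + unfold Rdiv. apply Rmult_le_compat_l; lra.
Qed.

(** * Convergence of the Newton series of both parities under the growth hypothesis *)

Lemma exp_le_mono a b : (a <= b)%R -> (exp a <= exp b)%R.
Proof. intros [H| ->]; [apply Rlt_le; now apply exp_increasing|lra]. Qed.

Lemma lnq_pos q : (0 < q < 1)%R -> (0 < ln (/ q))%R.
Proof.
  intros Hq. rewrite ln_Rinv by lra. assert (ln q < 0)%R; [|lra].
  rewrite <- ln_1. apply ln_increasing; lra.
Qed.

(** Common form of both growth hypotheses: at order [2 ln (/ q)] the coefficient [k / (2 ln^2 q)] is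
    [1 / ln (/ q)], and the condition on [alpha] is the type condition cleared of its
    denominator. *)
Definition growth_bound (q : R) (f : C -> C) (K alpha : R) : Prop :=
  (0 < K)%R /\ (alpha * ln (/ q) < 2 * ln 2)%R /\
  forall x : C, x <> 0 -> (Cmod (f x) <= K * exp (alpha * ln (Cmod x) + ln (Cmod x) ^ 2 / ln (/ q)))%R.

(** Cauchy's estimates on [|x| = exp l] control the coefficients at radius [exp (2 l)] in
    [u = x ^ 2]. Shrinking that radius by the factor [q] makes them summable, whence
    [1 / (1 - q)]. *)
Lemma parity_wbound q f K alpha s l : (0 < q < 1)%R -> (forall z, cdiff f z) -> growth_bound q f K alpha ->
  wbound (fun n => taylor_coef f (2 * n + s)) (q * exp (2 * l))
    (2 * (K * exp (alpha * l + l ^ 2 / ln (/ q))) * exp (- (INR s * l)) * / (1 - q)).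
Proof.
  intros Hq Hf [HK [_ HG]] n.
  set (M := (K * exp (alpha * l + l ^ 2 / ln (/ q)))%R).
  eapply Rle_trans.
  { apply rsum_le with (b := fun k => (2 * M * exp (- (INR s * l)) * q ^ k)%R). intros k _.
    assert (B : (Cmod (taylor_coef f (2 * k + s)) <= 2 * M / exp l ^ (2 * k + s))%R).
    { apply taylor_coef_bound; [easy|apply exp_pos|]. intros x Hx.
      assert (Hx0 : x <> 0). { intros ->. rewrite Cmod_0 in Hx. assert (P := exp_pos l). lra. }
      specialize (HG x Hx0). rewrite Hx, ln_exp in HG. exact HG. }
    eapply Rle_trans; [apply Rmult_le_compat_r; [apply pow_le|exact B]|].
    { apply Rmult_le_pos; [lra|apply Rlt_le, exp_pos]. }
    right. rewrite Rpow_mult_distr, exp_Ropp, <- (exp_pow l s).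
    replace (exp (2 * l) ^ k)%R with (exp l ^ (2 * k))%R.
    2: { rewrite !exp_pow, mult_INR. f_equal. simpl. ring. }
    rewrite pow_add. assert (exp l ^ (2 * k) <> 0)%R by (apply pow_nonzero; assert (P := exp_pos l); lra).
    assert (exp l ^ s <> 0)%R by (apply pow_nonzero; assert (P := exp_pos l); lra).
    field. auto. }
  rewrite rsum_scal. apply Rmult_le_compat_l.
  - repeat apply Rmult_le_pos; try lra; apply Rlt_le, exp_pos.
  - apply rsum_geom_le. lra.
Qed.

Lemma parity_everywhere q f K alpha s : (0 < q < 1)%R -> (forall z, cdiff f z) -> growth_bound q f K alpha ->
  everywhere_summable (fun n => taylor_coef f (2 * n + s)).
Proof.
  intros Hq Hf HG r Hr.
  assert (Hrq : (0 < r / q)%R) by (apply Rdiv_lt_0_compat; lra).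
  assert (B := parity_wbound q f K alpha s (ln (r / q) / 2)%R Hq Hf HG).
  replace (2 * (ln (r / q) / 2))%R with (ln (r / q)) in B by field.
  rewrite exp_ln in B by easy. replace (q * (r / q))%R with r in B by (field; lra). eauto.
Qed.

Lemma newton_parity q f K alpha s x g : (0 < q < 1)%R -> (forall z, cdiff f z) -> growth_bound q f K alpha ->
  cv (csum (fun n => taylor_coef f (2 * n + s) * (x ^ 2) ^ n)) g ->
  cv (csum (fun k => ncoef (nodes q s) (fun n => taylor_coef f (2 * n + s)) k
                     * npoly (nodes q s) k (x ^ 2))) g.
Proof.
  intros Hq Hf HG Hg. apply newton_series; [now apply (parity_everywhere q f K alpha)|easy|].
  intros eps He. assert (HL := lnq_pos q Hq). destruct HG as [HK [Ha HG0]].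
  assert (HG : growth_bound q f K alpha) by (split; auto). clear HG0.
  (* [d] solves [q * exp (2 * (n * L + d)) = r] for the radius [r] of [node_ratio_prod]; [ln 2]
     comes from the division by 4 in that radius. *)
  set (L := ln (/ q)) in *. set (d := (INR s * L / 2 - ln 2)%R).
  set (u := Cmod (x ^ 2)). assert (Hu : (0 <= u)%R) by apply Cmod_ge_0.
  set (D := exp (4 * u / (1 - q) + / (1 - q) / (1 - q))).
  (* For [l = n L + d] the exponent [alpha l + l^2 / L - s l - n^2 L] equals [n (alpha L - 2 ln 2)]
     plus the constant placed in [A]. *)
  set (A := (2 * K * / (1 - q) * D * exp ((alpha - INR s) * d + d ^ 2 / L))%R).
  assert (Hth : (0 <= exp (alpha * L - 2 * ln 2) < 1)%R).
  { split; [apply Rlt_le, exp_pos|]. rewrite <- exp_0. apply exp_increasing. lra. }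
  destruct (geom_small A (exp (alpha * L - 2 * ln 2)) eps Hth He) as [N1 HN1].
  (* From this index on, [|x ^ 2|] lies within the radius [r]. *)
  destruct (geom_small (4 * u) q 1 ltac:(lra) ltac:(lra)) as [N2 HN2].
  exists (S (N1 + N2)). intros n Hn.
  destruct (node_ratio_prod q s n u Hq Hu) as [R1 R2]. fold L in R1, R2.
  set (r := (exp ((2 * INR n + INR s - 1) * L) / 4)%R) in *.
  set (l := (INR n * L + d)%R).
  exists r, (2 * (K * exp (alpha * l + l ^ 2 / L)) * exp (- (INR s * l)) * / (1 - q))%R.
  assert (Eq : q = exp (- L)).
  { unfold L. rewrite exp_Ropp, exp_ln, Rinv_inv; [easy|]. apply Rinv_0_lt_compat; lra. }
  split; [|split; [exact R1|split]].
  - specialize (HN2 n ltac:(lia)). fold u.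
    assert (Hn1 : (1 <= INR n)%R) by (apply (le_INR 1); lia).
    assert (Hs : (0 <= INR s)%R) by apply pos_INR.
    assert (E : (exp (INR n * L) <= exp ((2 * INR n + INR s - 1) * L))%R).
    { apply exp_le_mono. apply Rmult_le_compat_r; lra. }
    assert (E2 : (q ^ n * exp (INR n * L) = 1)%R).
    { rewrite Eq, exp_pow, <- exp_plus. rewrite <- exp_0. f_equal. ring. }
    assert (P := exp_pos (INR n * L)).
    assert (4 * u <= exp (INR n * L))%R.
    { replace (4 * u)%R with (4 * u * q ^ n * exp (INR n * L))%R by (rewrite Rmult_assoc, E2; ring).
      rewrite <- (Rmult_1_l (exp (INR n * L))) at 2. apply Rmult_le_compat_r; lra. }
    unfold r. lra.
  - assert (B := parity_wbound q f K alpha s l Hq Hf HG). fold L in B.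
    replace (q * exp (2 * l))%R with r in B; [exact B|].
    unfold r, l, d. rewrite Eq at 1. rewrite <- exp_plus.
    replace (- L + 2 * (INR n * L + (INR s * L / 2 - ln 2)))%R
      with ((2 * INR n + INR s - 1) * L + - (ln 2 + ln 2))%R by field.
    rewrite exp_plus, exp_Ropp, exp_plus, exp_ln by lra. field.
  - eapply Rle_lt_trans; [|apply (HN1 n); lia].
    assert (Hinv : (0 < / (1 - q))%R) by (apply Rinv_0_lt_compat; lra).
    eapply Rle_trans; [apply Rmult_le_compat_l; [|exact R2]|].
    { repeat apply Rmult_le_pos; try lra; apply Rlt_le, exp_pos. }
    right. fold D. unfold A. rewrite exp_pow.
    transitivity (2 * K * / (1 - q) * D * (exp (alpha * l + l ^ 2 / L) * exp (- (INR s * l)) * exp (- (INR n * INR n * L))))%R;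
      [ring|].
    rewrite (Rmult_assoc _ (exp ((alpha - INR s) * d + d ^ 2 / L))). f_equal.
    rewrite <- !exp_plus. f_equal. unfold l, d. field. lra.
Qed.

Lemma csum_parity a n : csum a (2 * n) = csum (fun k => a (2 * k)%nat) n + csum (fun k => a (2 * k + 1)%nat) n.
Proof.
  induction n; [simpl; ring|]. replace (2 * S n)%nat with (S (S (2 * n))) by lia.
  simpl csum at 1. replace (S (n + (n + 0)))%nat with (2 * n + 1)%nat by lia.
  change (n + (n + 0))%nat with (2 * n)%nat. rewrite IHn. simpl csum.
  change (n + (n + 0))%nat with (2 * n)%nat. ring.
Qed.

Lemma cv_interleave a g h :
  cv (csum (fun k => a (2 * k)%nat)) g -> cv (csum (fun k => a (2 * k + 1)%nat)) h -> cv (csum a) (g + h).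
Proof.
  intros H K e He. destruct (H (e / 2)%R ltac:(lra)) as [N1 HN1]. destruct (K (e / 2)%R ltac:(lra)) as [N2 HN2].
  exists (2 * (N1 + N2) + 1)%nat. intros n Hn.
  assert (exists i j, (N1 <= i)%nat /\ (N2 <= j)%nat /\
     csum a n = csum (fun k => a (2 * k)%nat) i + csum (fun k => a (2 * k + 1)%nat) j) as [i [j [Hi [Hj E]]]].
  { destruct (Nat.Even_or_Odd n) as [[m Hm]|[m Hm]].
    - exists m, m. split; [lia|split; [lia|]]. rewrite Hm. apply csum_parity.
    - exists (S m), m. split; [lia|split; [lia|]]. rewrite Hm, Nat.add_1_r.
      change (csum a (S (2 * m))) with (csum a (2 * m) + a (2 * m)%nat). rewrite csum_parity.
      change (csum (fun k => a (2 * k)%nat) (S m)) with (csum (fun k => a (2 * k)%nat) m + a (2 * m)%nat). ring. }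
  rewrite E. specialize (HN1 i Hi). specialize (HN2 j Hj).
  match goal with |- (Cmod (?p + ?r - _) < _)%R => replace (p + r - (g + h)) with ((p - g) + (r - h)) by ring end.
  eapply Rle_lt_trans; [apply Cmod_triangle|]. lra.
Qed.

Definition ecoef (q : R) (f : C -> C) (k : nat) : C :=
  if Nat.even k
  then ncoef (nodes q 0) (fun n => taylor_coef f (2 * n + 0)) (Nat.div2 k) / 4 ^ Nat.div2 k
  else ncoef (nodes q 1) (fun n => taylor_coef f (2 * n + 1)) (Nat.div2 k) / (2 * 4 ^ Nat.div2 k).

Lemma C4pow_neq0 k : RtoC 4 ^ k <> 0.
Proof. apply Cpow_nz. intros C. apply RtoC_inj in C. lra. Qed.

(** The even and odd parts of the Taylor series are power series in [x ^ 2], each with its own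
    Newton series. The coefficients are related to [D_q] only in [en_expansion]. *)
Theorem rho_expansion_exists q f K alpha : (0 < q < 1)%R -> (forall z, cdiff f z) -> growth_bound q f K alpha ->
  forall x, cv (csum (fun k => ecoef q f k * rho q k x)) (f x).
Proof.
  intros Hq Hf HG x.
  assert (Hs : forall s, exists g, cv (csum (fun n => taylor_coef f (2 * n + s) * (x ^ 2) ^ n)) g).
  { intros s. apply summable_cv.
    destruct (parity_everywhere q f K alpha s Hq Hf HG (Cmod (x ^ 2) + 1)%R) as [G HGb].
    { assert (P := Cmod_ge_0 (x ^ 2)). lra. }
    apply (wbound_summable _ (Cmod (x ^ 2) + 1)%R G); [lra|easy]. }
  destruct (Hs 0%nat) as [g0 Hg0]. destruct (Hs 1%nat) as [g1 Hg1].
  assert (E : f x = g0 + x * g1).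
  { apply cv_unique with (csum (fun n => taylor_coef f n * x ^ n)); [now apply taylor|].
    apply cv_interleave.
    - apply cv_ext_from with 0%nat (csum (fun n => taylor_coef f (2 * n + 0) * (x ^ 2) ^ n)); [|easy].
      intros n _. apply csum_ext. intros k _. now rewrite <- Cpow_mult_r, Nat.add_0_r.
    - apply cv_ext_from with 0%nat (fun n => x * csum (fun n => taylor_coef f (2 * n + 1) * (x ^ 2) ^ n) n).
      + intros n _. rewrite <- csum_scal. apply csum_ext. intros k _.
        rewrite <- Cpow_mult_r, Cpow_add_r, Cpow_1_r. ring.
      + now apply cv_scal. }
  rewrite E. apply cv_interleave.
  - apply cv_ext_from with 0%nat (csum (fun k => ncoef (nodes q 0) (fun n => taylor_coef f (2 * n + 0)) k
                     * npoly (nodes q 0) k (x ^ 2))).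
    + intros n _. apply csum_ext. intros k _. rewrite rho_even by lra. unfold ecoef.
      rewrite Nat.even_mul. simpl Nat.even. cbv iota. simpl orb. rewrite Nat.div2_double. field. apply C4pow_neq0.
    + now apply newton_parity with K alpha.
  - apply cv_ext_from with 0%nat (fun n => x * csum (fun k => ncoef (nodes q 1) (fun n => taylor_coef f (2 * n + 1)) k
                     * npoly (nodes q 1) k (x ^ 2)) n).
    + intros n _. rewrite <- csum_scal. apply csum_ext. intros k _. rewrite rho_odd by lra. unfold ecoef.
      rewrite Nat.even_add, Nat.even_mul. simpl. rewrite Nat.add_0_r.
      replace (Nat.div2 (k + k + 1)) with k.
      2: { replace (k + k + 1)%nat with (S (2 * k)) by lia. now rewrite Nat.div2_succ_double. }
      field. apply C4pow_neq0.
    + apply cv_scal. now apply newton_parity with K alpha.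
Qed.

(** * The Askey-Wilson operator on lattices [z0 q^(Z/2)] avoiding the points [x = 1, -1] *)

Definition sq (q : R) : C := RtoC (Rpower q (1 / 2)).

Lemma sq_neq0 q : sq q <> 0.
Proof.
  unfold sq. intros C. apply RtoC_inj in C. assert (H := exp_pos (1 / 2 * ln q)).
  unfold Rpower in C. lra.
Qed.

Lemma sq_sq q : (0 < q)%R -> sq q * sq q = RtoC q.
Proof.
  intros Hq. unfold sq. rewrite <- RtoC_mult, <- Rpower_plus.
  replace (1 / 2 + 1 / 2)%R with 1%R by field. now rewrite Rpower_1.
Qed.

Lemma sq_inv q : RtoC (Rpower q (- (1 / 2))) = / sq q.
Proof.
  unfold sq. rewrite Rpower_Ropp, RtoC_inv; [easy|].
  assert (H := exp_pos (1 / 2 * ln q)). unfold Rpower. lra.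
Qed.

Lemma sq_lt1 q : (0 < q < 1)%R -> sq q - / sq q <> 0.
Proof.
  intros Hq C. apply (C1_nz). assert (N := sq_neq0 q).
  assert (E : sq q * sq q = 1).
  { replace (sq q * sq q) with ((sq q - / sq q) * sq q + 1) by (field; easy). rewrite C. ring. }
  rewrite sq_sq in E by lra. apply RtoC_inj in E. lra.
Qed.

Lemma cosz_inv (z : C) : z <> 0 -> cosz (/ z) = cosz z.
Proof. intros H. unfold cosz. field. easy. Qed.

Lemma sinz_inv (z : C) : z <> 0 -> sinz (/ z) = - sinz z.
Proof. intros H. unfold sinz. field. split; [easy|apply Ci_nz]. Qed.

Lemma expi_cosz (z : C) : z <> 0 -> expi (cosz z) = z \/ expi (cosz z) = / z.
Proof.
  intros Hz. destruct (expi_spec (cosz z)) as [Hw Hx]. set (w := expi (cosz z)) in *.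
  assert (E : (w - z) * (w - / z) = 0).
  { replace ((w - z) * (w - / z)) with (2 * w * (cosz w - cosz z)).
    - rewrite Hx. ring.
    - unfold cosz. field. auto. }
  destruct (Ceq_dec w z) as [|N]; [now left|right].
  apply Ceq_minus. destruct (Ceq_dec (w - / z) 0) as [|N']; [easy|].
  exfalso. revert E. apply Cmult_neq_0; [|easy]. intros C. apply N. now apply Ceq_minus.
Qed.

(** Replacing [z] by [1/z] changes the sign of both the numerator and the sine, so it does not
    matter which root [expi] selects. *)
Lemma AW_cosz q f (z : C) : (0 < q < 1)%R -> z <> 0 -> sinz z <> 0 ->
  AW q f (cosz z) = (f (cosz (sq q * z)) - f (cosz (/ sq q * z))) / (Ci * (sq q - / sq q) * sinz z).
Proof.
  intros Hq Hz Hs. assert (N := sq_neq0 q). assert (L := sq_lt1 q Hq).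
  assert (E : AW_quotient q f (cosz z)
    = (f (cosz (sq q * z)) - f (cosz (/ sq q * z))) / (Ci * (sq q - / sq q) * sinz z)).
  { unfold AW_quotient. rewrite RtoC_minus, sq_inv. fold (sq q).
    destruct (expi_cosz z Hz) as [->| ->]; [easy|].
    replace (sq q * / z) with (/ (/ sq q * z)) by (field; auto).
    replace (/ sq q * / z) with (/ (sq q * z)) by (field; auto).
    rewrite !cosz_inv, sinz_inv; auto.
    - set (A := f _). set (B := f _). assert (L2 : sq q * sq q - 1 <> 0).
      { intros C. apply L. replace (sq q - / sq q) with ((sq q * sq q - 1) * / sq q) by (now field).
        rewrite C. ring. }
      field. repeat split; auto using Ci_nz.
    - now apply Cmult_neq_0.
    - apply Cmult_neq_0; [|easy]. intros C. apply C1_nz.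
      replace (RtoC 1) with (sq q * / sq q) by (now field). rewrite C. ring. }
  unfold AW. destruct (Ceq_dec (sinz (expi (cosz z))) 0) as [C|_]; [|easy].
  exfalso. destruct (expi_cosz z Hz) as [T|T]; rewrite T in C; [easy|].
  rewrite sinz_inv in C by easy. apply Hs. replace (sinz z) with (- - sinz z) by ring. rewrite C. ring.
Qed.

(** Over such a set every iterate of [AW] takes the quotient branch, so that [D_q^k f] at a point is
    a finite combination of values of [f]. *)
Definition admissible (q : R) (P : C -> Prop) : Prop :=
  forall z, P z -> z <> 0 /\ sinz z <> 0 /\ P (sq q * z) /\ P (/ sq q * z).

Lemma AW_iter_S q k f : AW_iter q (S k) f = AW q (AW_iter q k f).
Proof. reflexivity. Qed.

Lemma AW_iter_series q P c (g : nat -> C -> C) f : (0 < q < 1)%R -> admissible q P ->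
  (forall z, P z -> cv (csum (fun n => c n * g n (cosz z))) (f (cosz z))) ->
  forall k z, P z -> cv (csum (fun n => c n * AW_iter q k (g n) (cosz z))) (AW_iter q k f (cosz z)).
Proof.
  intros Hq HP H. induction k; intros z Hz; [now apply H|].
  destruct (HP z Hz) as [N0 [N1 [P1 P2]]].
  rewrite AW_iter_S, AW_cosz by easy.
  apply cv_ext_from with 0%nat (fun n => / (Ci * (sq q - / sq q) * sinz z) *
    (csum (fun n => c n * AW_iter q k (g n) (cosz (sq q * z))) n
     - csum (fun n => c n * AW_iter q k (g n) (cosz (/ sq q * z))) n)).
  - intros n _. rewrite <- csum_minus, <- csum_scal. apply csum_ext. intros m _.
    rewrite AW_iter_S, AW_cosz by easy. unfold Cdiv. ring.
  - unfold Cdiv. match goal with |- cv _ (?a * ?b) => rewrite (Cmult_comm a b) end. apply cv_scal. apply cv_minus; now apply IHk.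
Qed.

Lemma rho_0 q x : rho q 0 x = 1.
Proof. reflexivity. Qed.

Lemma nat_pair_ind (P : nat -> Prop) : P 0%nat -> P 1%nat -> (forall n, P n -> P (S (S n))) -> forall n, P n.
Proof.
  intros H0 H1 H n. enough (P n /\ P (S n)) by tauto. induction n; [easy|]. destruct IHn. auto.
Qed.

Lemma rho_cosz q n (z : C) : (0 < q)%R -> z <> 0 -> rho q n (cosz z) = rhoz q n z.
Proof.
  intros Hq Hz. induction n using nat_pair_ind; [easy| |].
  - now rewrite rho_1, rhoz_1.
  - now rewrite rho_SS, rhoz_SS, IHn.
Qed.

(** The two half-step shifts move the [q^2]-product of [rhoz (n + 1)] in opposite directions. Both
    results contain the product of [rhoz n], with one extra factor at the upper end in one case and
    at the lower end in the other. *)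
Lemma rhoz_diff q n (z : C) : (0 < q)%R -> z <> 0 ->
  rhoz q (S n) (sq q * z) - rhoz q (S n) (/ sq q * z)
  = (sq q ^ S n - / sq q ^ S n) * (z - / z) * rhoz q n z.
Proof.
  intros Hq Hz. assert (N := sq_neq0 q). assert (Es := sq_sq q Hq).
  destruct n as [|m].
  - rewrite !rhoz_1; try (now apply Cmult_neq_0).
    + unfold rhoz, cosz. simpl. field. auto.
    + apply Cmult_neq_0; [|easy]. intros C. apply C1_nz.
      replace (RtoC 1) with (sq q * / sq q) by (now field). rewrite C. ring.
  - unfold rhoz. set (s := sq q) in *. set (Q := (q ^ 2)%R).
    assert (Hpow : (q ^ m <> 0)%R) by (apply pow_nonzero; lra).
    assert (Hb : RtoC (q ^ S m) = s ^ S (S m) * s ^ S (S m) / (s * s)).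
    { replace (s ^ S (S m)) with (s * s ^ S m) by reflexivity.
      replace (s * s ^ S m * (s * s ^ S m) / (s * s)) with (s ^ S m * s ^ S m) by (field; easy).
      rewrite <- Cpow_mult_l, Es. clear. induction (S m); simpl; [easy|]. now rewrite RtoC_mult, IHn. }
    set (a := - RtoC (q / q ^ m) * z ^ 2).
    replace (- RtoC (q / q ^ S m) * (s * z) ^ 2) with a.
    2: { unfold a. replace (q / q ^ m)%R with (q / q ^ S m * q)%R by (simpl; field; split; [easy|lra]).
         rewrite (RtoC_mult _ q), <- Es. ring. }
    rewrite (qpoch_split (- RtoC (q / q ^ S m) * (/ s * z) ^ 2)).
    replace (- RtoC (q / q ^ S m) * (/ s * z) ^ 2 * RtoC Q) with a.
    2: { unfold a, Q. replace (q / q ^ m)%R with (q / q ^ S m * q)%R by (simpl; field; split; [easy|lra]).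
         simpl (q ^ 2)%R. rewrite Rmult_1_r, !RtoC_mult, <- Es. field. easy. }
    change (qpoch a Q (S m)) with (qpoch a Q m * (1 - a * RtoC (Q ^ m))).
    replace (a * RtoC (Q ^ m)) with (- RtoC (q ^ S m) * z ^ 2).
    2: { unfold a. replace (q ^ S m)%R with (q / q ^ m * Q ^ m)%R.
         2: { unfold Q. rewrite <- pow_mult. replace (2 * m)%nat with (m + m)%nat by lia.
              rewrite pow_add. simpl. field. easy. }
         rewrite (RtoC_mult _ (Q ^ m)). ring. }
    set (P := qpoch a Q m).
    replace (RtoC (q / q ^ S m)) with (/ RtoC (q ^ m)).
    2: { rewrite <- RtoC_inv by easy. f_equal. simpl. field. split; [easy|lra]. }
    replace (RtoC (q ^ m)) with (RtoC (q ^ S m) / (s * s)).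
    2: { rewrite Es. simpl. rewrite RtoC_mult. field. intros C. apply RtoC_inj in C. lra. }
    rewrite Hb, !Cpow_mult_l, !Cpow_inv by easy.
    assert (Hw : s ^ S (S m) <> 0) by now apply Cpow_nz.
    assert (Hzm : z ^ S m <> 0) by now apply Cpow_nz.
    replace (z ^ S (S m)) with (z * z ^ S m) by reflexivity.
    set (w := s ^ S (S m)) in *. set (y := z ^ S m) in *. clearbody w y P s. field. auto.
Qed.

Definition en (q : R) (n : nat) (x : C) : C :=
  RtoC (Rpower q (INR n ^ 2 / 4)) / qpoch (RtoC q) q n * rho q n x.

Lemma qpoch_q_R q n : (0 < q < 1)%R -> exists r : R, (0 < r <= 1)%R /\ qpoch (RtoC q) q n = RtoC r.
Proof.
  intros Hq. induction n; simpl.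
  - exists 1%R. split; [lra|easy].
  - destruct IHn as [r [Hr ->]]. exists (r * (1 - q * q ^ n))%R.
    assert (0 < q ^ n)%R by (apply pow_lt; lra).
    assert (q ^ n <= 1)%R by (rewrite <- (pow1 n); apply pow_incr; lra).
    assert (q * q ^ n < 1)%R by nra.
    split; [split; nra|]. now rewrite RtoC_mult, RtoC_minus, RtoC_mult.
Qed.

Lemma qpoch_q_neq0 q n : (0 < q < 1)%R -> qpoch (RtoC q) q n <> 0.
Proof.
  intros Hq C. destruct (qpoch_q_R q n Hq) as [r [Hr E]]. rewrite E in C. apply RtoC_inj in C. lra.
Qed.

(** * Action on the normalised basis *)

Lemma gamma_pos q : (0 < q < 1)%R -> (0 < gamma q)%R.
Proof.
  intros Hq. unfold gamma. apply Rdiv_lt_0_compat; [|lra].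
  apply Rmult_lt_0_compat; [lra|]. apply exp_pos.
Qed.

Lemma sq_pow q n : sq q ^ n = RtoC (Rpower q (INR n / 2)).
Proof.
  induction n.
  - simpl. unfold Rpower. unfold Rdiv. now rewrite Rmult_0_l, Rmult_0_l, exp_0.
  - rewrite Cpow_S, IHn. unfold sq. rewrite <- RtoC_mult, <- Rpower_plus. do 2 f_equal.
    rewrite S_INR. field.
Qed.

(** [(n+1)^2 / 4 = n^2 / 4 + n / 2 + 1 / 4] accounts for the powers of [q], and
    [q^((n+1)/2) - q^(-(n+1)/2)] cancels the last factor of [(q; q)_(n+1)]. *)
Lemma gamma_step q n : (0 < q < 1)%R ->
  RtoC (Rpower q (INR (S n) ^ 2 / 4)) / qpoch (RtoC q) q (S n)
    * (2 * ((sq q ^ S n - / sq q ^ S n) / (sq q - / sq q)))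
  = RtoC (gamma q) * (RtoC (Rpower q (INR n ^ 2 / 4)) / qpoch (RtoC q) q n).
Proof.
  intros Hq. assert (N := sq_neq0 q). assert (L := sq_lt1 q Hq).
  simpl (qpoch (RtoC q) q (S n)).
  assert (Hr := qpoch_q_neq0 q n Hq). set (r := qpoch (RtoC q) q n) in *.
  assert (Hqn : 1 - RtoC q * RtoC (q ^ n) <> 0).
  { assert (T := qpoch_q_neq0 q (S n) Hq). simpl in T. fold r in T. intros C. apply T. rewrite C. ring. }
  assert (Eg : RtoC (gamma q) = 2 * RtoC (Rpower q (1 / 4)) / (1 - RtoC q)).
  { unfold gamma. rewrite RtoC_div, RtoC_mult, RtoC_minus by lra. easy. }
  assert (Hq1 : 1 - RtoC q <> 0). { rewrite <- RtoC_minus. intros C. apply RtoC_inj in C. lra. }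
  assert (Es := sq_sq q ltac:(lra)).
  assert (Epow : sq q ^ S n * sq q ^ S n = RtoC q * RtoC (q ^ n)).
  { rewrite <- Cpow_mult_l, Es. clear. simpl. f_equal. induction n; simpl; [easy|]. now rewrite RtoC_mult, IHn. }
  assert (Emain : RtoC (Rpower q (INR (S n) ^ 2 / 4)) * sq q
     = RtoC (Rpower q (1 / 4)) * RtoC (Rpower q (INR n ^ 2 / 4)) * sq q ^ S n).
  { rewrite sq_pow. unfold sq. rewrite <- !RtoC_mult, <- !Rpower_plus. do 2 f_equal.
    rewrite S_INR. field. }
  assert (Hp : sq q ^ S n <> 0) by now apply Cpow_nz.
  rewrite Eg, <- Epow, <- Es in *.
  set (s := sq q) in *. set (p := s ^ S n) in *.
  assert (L2 : s * s - 1 <> 0).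
  { intros C. apply L. replace (s - / s) with ((s * s - 1) * / s) by (now field). rewrite C. ring. }
  replace (RtoC (Rpower q (INR (S n) ^ 2 / 4)))
    with (RtoC (Rpower q (1 / 4)) * RtoC (Rpower q (INR n ^ 2 / 4)) * p * / s).
  2: { rewrite <- Emain. field. easy. }
  field. repeat split; auto.
Qed.

Lemma AW_quotient_step q n (z c G : C) : (0 < q < 1)%R -> z <> 0 -> sinz z <> 0 ->
  c * ((sq q ^ S n - / sq q ^ S n) * (z - / z) * G) / (Ci * (sq q - / sq q) * sinz z)
  = c * (2 * ((sq q ^ S n - / sq q ^ S n) / (sq q - / sq q))) * G.
Proof.
  intros Hq Hz Hs. assert (N := sq_neq0 q). assert (L := sq_lt1 q Hq).
  assert (Hzz : z - / z <> 0).
  { intros C. apply Hs. unfold sinz. rewrite C. field. apply Ci_nz. }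
  assert (sq q ^ S n <> 0) by now apply Cpow_nz. unfold sinz. set (s := sq q) in *. set (p := s ^ S n) in *.
  assert (L2 : s * s - 1 <> 0).
  { intros C. apply L. replace (s - / s) with ((s * s - 1) * / s) by (now field). rewrite C. ring. }
  assert (L3 : z * z - 1 <> 0).
  { intros C. apply Hzz. replace (z - / z) with ((z * z - 1) * / z) by (now field). rewrite C. ring. }
  field. repeat split; auto using Ci_nz.
Qed.

Lemma sq_inv_neq0 q : / sq q <> 0.
Proof.
  assert (N := sq_neq0 q). intros C. apply C1_nz.
  replace (RtoC 1) with (sq q * / sq q) by (now field). rewrite C. ring.
Qed.

Lemma AW_en q n (z : C) : (0 < q < 1)%R -> z <> 0 -> sinz z <> 0 ->
  AW q (en q (S n)) (cosz z) = RtoC (gamma q) * en q n (cosz z).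
Proof.
  intros Hq Hz Hs. rewrite AW_cosz by easy. unfold en.
  assert (N := sq_neq0 q). assert (N' := sq_inv_neq0 q).
  rewrite !rho_cosz by (try apply Cmult_neq_0; easy || lra).
  rewrite (Cmult_assoc (RtoC (gamma q))), <- gamma_step by easy.
  rewrite <- AW_quotient_step with (z := z) by easy. f_equal.
  rewrite <- rhoz_diff by (easy || lra). ring.
Qed.

Lemma AW_en_0 q (z : C) : (0 < q < 1)%R -> z <> 0 -> sinz z <> 0 -> AW q (en q 0) (cosz z) = 0.
Proof. intros Hq Hz Hs. rewrite AW_cosz by easy. unfold en. rewrite !rho_0. unfold Cdiv, Cminus. ring. Qed.

(** The Appell property for [D_q]. It is isolated because two sequences have it, [en] and [psi]. *)
Definition lowered (q : R) (P : C -> Prop) (g : nat -> C -> C) : Prop :=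
  forall z, P z -> AW q (g 0%nat) (cosz z) = 0 /\
    forall n, AW q (g (S n)) (cosz z) = RtoC (gamma q) * g n (cosz z).

Lemma AW_iter_lowered q P g : (0 < q < 1)%R -> admissible q P -> lowered q P g ->
  forall k n z, P z -> AW_iter q k (g n) (cosz z)
    = if le_dec k n then RtoC (gamma q) ^ k * g (n - k)%nat (cosz z) else 0.
Proof.
  intros Hq HP Hg. induction k; intros n z Hz.
  - destruct (le_dec 0 n); [|lia]. simpl. rewrite Nat.sub_0_r. ring.
  - destruct (HP z Hz) as [N0 [N1 [P1 P2]]]. destruct (Hg z Hz) as [G0 G1].
    rewrite AW_cosz in G0 by easy.
    rewrite AW_iter_S, AW_cosz, !IHk by easy.
    destruct (le_dec k n) as [L|L]; destruct (le_dec (S k) n) as [L'|L']; try lia.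
    + specialize (G1 (n - S k)%nat). rewrite AW_cosz in G1 by easy.
      replace (S (n - S k)) with (n - k)%nat in G1 by lia.
      transitivity (RtoC (gamma q) ^ k * (RtoC (gamma q) * g (n - S k)%nat (cosz z))); [|rewrite Cpow_S; ring].
      rewrite <- G1. unfold Cdiv. ring.
    + replace (n - k)%nat with 0%nat by lia.
      rewrite <- (Cmult_0_r (RtoC (gamma q) ^ k)), <- G0. unfold Cdiv. ring.
    + unfold Cdiv, Cminus. ring.
Qed.

Lemma en_lowered q P : (0 < q < 1)%R -> admissible q P -> lowered q P (en q).
Proof.
  intros Hq HP z Hz. destruct (HP z Hz) as [N0 [N1 _]]. split; [now apply AW_en_0|].
  intros n. now apply AW_en.
Qed.

Definition lattice_i (q : R) (z : C) : Prop := exists k : Z, z = Ci * RtoC (Rpower q (IZR k / 2)).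

Definition lattice_eta (q : R) (z : C) : Prop := exists k : Z, z = RtoC (Rpower q (1 / 4 + IZR k / 2)).

Lemma Rpower_sq_step q a : RtoC (Rpower q (a + 1 / 2)) = sq q * RtoC (Rpower q a).
Proof. unfold sq. rewrite <- RtoC_mult, <- Rpower_plus. do 2 f_equal. ring. Qed.

Lemma Rpower_sq_step' q a : RtoC (Rpower q (a - 1 / 2)) = / sq q * RtoC (Rpower q a).
Proof. rewrite <- sq_inv, <- RtoC_mult, <- Rpower_plus. do 2 f_equal. ring. Qed.

Lemma Rpower_C_neq0 q a : RtoC (Rpower q a) <> 0.
Proof. intros C. apply RtoC_inj in C. assert (H := exp_pos (a * ln q)). unfold Rpower in C. lra. Qed.

Lemma sinz_neq0 (z : C) : z <> 0 -> z * z <> 1 -> sinz z <> 0.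
Proof.
  intros Hz H C. apply H.
  replace (z * z) with (2 * Ci * z * sinz z + 1).
  - rewrite C. ring.
  - unfold sinz. field. split; [easy|apply Ci_nz].
Qed.

Lemma Ci_Ci : Ci * Ci = - (1).
Proof. unfold Ci, RtoC, Cmult, Copp; simpl. f_equal; ring. Qed.

(** Here [z * z] is a negative real number, hence not 1. *)
Lemma lattice_i_admissible q : (0 < q < 1)%R -> admissible q (lattice_i q).
Proof.
  intros Hq z [k ->].
  assert (N : Ci * RtoC (Rpower q (IZR k / 2)) <> 0).
  { apply Cmult_neq_0; [apply Ci_nz|apply Rpower_C_neq0]. }
  split; [easy|split; [|split]].
  - apply sinz_neq0; [easy|]. intros C.
    assert (E : RtoC (- (Rpower q (IZR k / 2) * Rpower q (IZR k / 2))) = RtoC 1).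
    { rewrite <- C, RtoC_opp, RtoC_mult.
      transitivity (Ci * Ci * (RtoC (Rpower q (IZR k / 2)) * RtoC (Rpower q (IZR k / 2)))); [rewrite Ci_Ci; ring|ring]. }
    apply RtoC_inj in E. nra.
  - exists (k + 1)%Z. rewrite plus_IZR.
    replace ((IZR k + 1) / 2)%R with (IZR k / 2 + 1 / 2)%R by field. rewrite Rpower_sq_step. ring.
  - exists (k - 1)%Z. rewrite minus_IZR.
    replace ((IZR k - 1) / 2)%R with (IZR k / 2 - 1 / 2)%R by field. rewrite Rpower_sq_step'. ring.
Qed.

(** [z * z = q^(1/2 + k) = 1] would give [1 + 2 k = 0]. *)
Lemma lattice_eta_admissible q : (0 < q < 1)%R -> admissible q (lattice_eta q).
Proof.
  intros Hq z [k ->].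
  split; [apply Rpower_C_neq0|split; [|split]].
  - apply sinz_neq0; [apply Rpower_C_neq0|]. rewrite <- RtoC_mult, <- Rpower_plus. intros C.
    apply RtoC_inj in C. unfold Rpower in C. apply (eq_trans (z := exp 0)) in C; [|now rewrite exp_0]. apply exp_inv in C.
    assert (Lq := lnq_pos q Hq). rewrite ln_Rinv in Lq by lra.
    assert (E : (IZR (1 + 2 * k) = 0)%R). { rewrite plus_IZR, mult_IZR. apply Rmult_integral in C. lra. }
    apply eq_IZR in E. lia.
  - exists (k + 1)%Z. rewrite plus_IZR.
    replace (1 / 4 + (IZR k + 1) / 2)%R with (1 / 4 + IZR k / 2 + 1 / 2)%R by field. now rewrite Rpower_sq_step.
  - exists (k - 1)%Z. rewrite minus_IZR.
    replace (1 / 4 + (IZR k - 1) / 2)%R with (1 / 4 + IZR k / 2 - 1 / 2)%R by field. now rewrite Rpower_sq_step'.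
Qed.

Lemma cosz_i q : exists z, lattice_i q z /\ cosz z = 0.
Proof.
  exists Ci. split.
  - exists 0%Z. unfold Rpower, Rdiv. rewrite !Rmult_0_l, exp_0. ring.
  - unfold cosz. replace (/ Ci) with (- Ci); [unfold Cdiv; ring|].
    unfold Cinv, Copp, Ci; simpl. f_equal; field.
Qed.

Lemma cosz_eta q : exists z, lattice_eta q z /\ cosz z = eta q.
Proof.
  exists (RtoC (Rpower q (1 / 4))). split.
  - exists 0%Z. do 2 f_equal. field.
  - unfold cosz, eta. rewrite Rpower_Ropp, RtoC_div, RtoC_plus, RtoC_inv; [easy| |lra].
    assert (H := exp_pos (1 / 4 * ln q)). unfold Rpower. lra.
Qed.

(** Odd [rho] contain the factor [x]; even ones of positive index contain [x ^ 2 - node q 0], and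
    [node q 0 = 0]. *)
Lemma en_at_0 q n : (0 < q < 1)%R -> en q n 0 = if Nat.eq_dec n 0 then 1 else 0.
Proof.
  intros Hq. unfold en. destruct (Nat.eq_dec n 0) as [->|Hn].
  - rewrite rho_0. simpl. unfold Rpower, Rdiv. rewrite !Rmult_0_l, exp_0. field.
  - replace (rho q n 0) with (RtoC 0); [ring|].
    destruct n as [|n]; [easy|]. clear Hn. symmetry. induction n using nat_pair_ind.
    + rewrite rho_1 by lra. ring.
    + rewrite rho_SS by lra. unfold node. simpl.
      replace ((2 - 1 - / 1) / 4)%R with 0%R by field. ring.
    + rewrite rho_SS, IHn by lra. ring.
Qed.

(** * The expansion in [rho] *)

Definition dcoef (q : R) (f : C -> C) (m : nat) : C := / RtoC (gamma q) ^ m * AW_iter q m f 0.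

Lemma gamma_C_neq0 q : (0 < q < 1)%R -> RtoC (gamma q) <> 0.
Proof. intros Hq C. apply RtoC_inj in C. assert (H := gamma_pos q Hq). lra. Qed.

Lemma cv_csum_single (a : nat -> C) k : (forall n, n <> k -> a n = 0) -> cv (csum a) (a k).
Proof.
  intros H. apply cv_ext_from with (S k) (fun _ => a k); [|apply cv_const].
  intros n Hn. replace n with (k + (1 + (n - S k)))%nat by lia. rewrite csum_add.
  rewrite csum_zero by (intros; apply H; lia). rewrite csum_S_l, Nat.add_0_r.
  rewrite csum_zero by (intros; apply H; lia). ring.
Qed.

Lemma rho_coef_en q f k x : (0 < q < 1)%R ->
  rho_coef q f k * rho q k x = dcoef q f k * en q k x.
Proof.
  intros Hq. unfold rho_coef, dcoef, en. assert (Hp := qpoch_q_neq0 q k Hq).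
  assert (Hg := gamma_C_neq0 q Hq). assert (Hgk : RtoC (gamma q) ^ k <> 0) by now apply Cpow_nz.
  assert (H2 : RtoC 2 ^ k <> 0) by (apply Cpow_nz, C2_neq0).
  assert (E : RtoC (Rpower q ((INR k ^ 2 - INR k) / 4) * (1 - q) ^ k) * RtoC (gamma q) ^ k
     = 2 ^ k * RtoC (Rpower q (INR k ^ 2 / 4))).
  { assert (P : forall (r : R), RtoC r ^ k = RtoC (r ^ k)).
    { intros r. induction k; simpl; [easy|]. rewrite IHk, RtoC_mult; auto using qpoch_q_neq0.
      - now apply Cpow_nz.
      - apply Cpow_nz, C2_neq0. }
    rewrite !P, <- !RtoC_mult. f_equal. unfold gamma, Rdiv.
    rewrite !Rpow_mult_distr, pow_inv.
    replace (Rpower q (1 * / 4) ^ k)%R with (Rpower q (INR k / 4)).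
    2: { rewrite <- Rpower_pow by apply exp_pos. rewrite Rpower_mult. f_equal. field. }
    transitivity (2 ^ k * (Rpower q ((INR k ^ 2 - INR k) * / 4) * Rpower q (INR k / 4)))%R.
    - field. apply pow_nonzero. lra.
    - rewrite <- Rpower_plus. do 2 f_equal. field. }
  transitivity (RtoC (Rpower q ((INR k ^ 2 - INR k) / 4) * (1 - q) ^ k) * RtoC (gamma q) ^ k
    / (2 ^ k * qpoch (RtoC q) q k) * / RtoC (gamma q) ^ k * AW_iter q k f 0 * rho q k x).
  - field. auto.
  - rewrite E. field. auto.
Qed.

(** Some expansion exists; applying [D_q^k] to it at [x = 0], along [lattice_i], leaves only the
    term of index [k] and so determines its coefficient. *)
Theorem en_expansion q f K alpha : (0 < q < 1)%R -> (forall z, cdiff f z) -> growth_bound q f K alpha ->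
  forall x, cv (csum (fun k => dcoef q f k * en q k x)) (f x).
Proof.
  intros Hq Hf HG.
  set (c := fun k => ecoef q f k * qpoch (RtoC q) q k / RtoC (Rpower q (INR k ^ 2 / 4))).
  assert (H : forall x, cv (csum (fun k => c k * en q k x)) (f x)).
  { intros x. apply cv_ext_from with 0%nat (csum (fun k => ecoef q f k * rho q k x)).
    - intros n _. apply csum_ext. intros k _. unfold c, en. field.
      split; [now apply qpoch_q_neq0|apply Rpower_C_neq0].
    - now apply rho_expansion_exists with K alpha. }
  enough (E : forall k, dcoef q f k = c k).
  { intros x. apply cv_ext_from with 0%nat (csum (fun k => c k * en q k x)); [|easy].
    intros n _. apply csum_ext. intros k _. now rewrite E. }
  intros k. destruct (cosz_i q) as [z [Hz H0]].
  assert (Ad := lattice_i_admissible q Hq).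
  assert (A : cv (csum (fun n => c n * AW_iter q k (en q n) (cosz z))) (AW_iter q k f (cosz z))).
  { apply AW_iter_series with (lattice_i q); auto. }
  assert (B : cv (csum (fun n => c n * AW_iter q k (en q n) (cosz z))) (c k * AW_iter q k (en q k) (cosz z))).
  { apply (cv_csum_single (fun n => c n * AW_iter q k (en q n) (cosz z))). intros n Hn.
    rewrite (AW_iter_lowered q (lattice_i q)); auto using en_lowered.
    destruct (le_dec k n) as [L|L]; [|ring].
    rewrite H0, en_at_0 by easy. destruct (Nat.eq_dec (n - k) 0); [lia|ring]. }
  assert (E := cv_unique _ _ _ A B).
  rewrite (AW_iter_lowered q (lattice_i q)) in E; auto using en_lowered.
  destruct (le_dec k k) as [_|]; [|lia]. rewrite Nat.sub_diag, H0, en_at_0 in E by easy.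
  destruct (Nat.eq_dec 0 0) as [_|]; [|lia].
  unfold dcoef. rewrite E. field. apply Cpow_nz. now apply gamma_C_neq0.
Qed.

(** * The functions [psi] : coefficients of the defining series of [qE_disc] *)

Definition phiz (q : R) (m : nat) (z : C) : C :=
  let s := RtoC (Rpower q ((1 - INR m) / 2)) in
  qpoch (- Ci * z * s) q m * qpoch (- Ci * / z * s) q m.

Definition psi (q : R) (m : nat) (x : C) : C :=
  (- Ci) ^ m * (RtoC (Rpower q (INR m ^ 2 / 4)) / qpoch (RtoC q) q m) * phiz q m (expi x).

Fixpoint cprod (a : nat -> C) (n : nat) : C :=
  match n with O => 1 | S m => cprod a m * a m end.

(** Pairing the factors in [z] and [1/z] exhibits a polynomial in [x], which settles both the
    independence of [expi] and differentiability. *)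
Lemma phiz_cosz q m (z : C) : z <> 0 -> phiz q m z
  = cprod (fun j => (1 - RtoC (Rpower q ((1 - INR m) / 2) * q ^ j) ^ 2)
                    + (2 * Ci * RtoC (Rpower q ((1 - INR m) / 2) * q ^ j)) * cosz z) m.
Proof.
  intros Hz. unfold phiz. set (s := Rpower q ((1 - INR m) / 2)).
  clearbody s. induction m as [|n IHn]; cbn [qpoch cprod]; [ring|].
  rewrite <- IHn. rewrite !RtoC_mult. set (A := qpoch _ q n). set (B := qpoch _ q n).
  assert (E : (1 - - Ci * z * RtoC s * RtoC (q ^ n)) * (1 - - Ci * / z * RtoC s * RtoC (q ^ n))
    = 1 + RtoC s * RtoC (q ^ n) * (RtoC s * RtoC (q ^ n)) * (Ci * Ci) + 2 * Ci * (RtoC s * RtoC (q ^ n)) * cosz z).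
  { unfold cosz. field. easy. }
  rewrite Ci_Ci in E.
  transitivity (A * B * ((1 - - Ci * z * RtoC s * RtoC (q ^ n)) * (1 - - Ci * / z * RtoC s * RtoC (q ^ n)))); [ring|].
  rewrite E. ring.
Qed.

Lemma psi_cosz q m (z : C) : z <> 0 -> psi q m (cosz z)
  = (- Ci) ^ m * (RtoC (Rpower q (INR m ^ 2 / 4)) / qpoch (RtoC q) q m) * phiz q m z.
Proof.
  intros Hz. unfold psi. f_equal. destruct (expi_spec (cosz z)) as [H1 H2].
  rewrite !phiz_cosz, H2 by easy. reflexivity.
Qed.

Lemma phiz_diff q m (z : C) : (0 < q < 1)%R -> z <> 0 ->
  phiz q (S m) (sq q * z) - phiz q (S m) (/ sq q * z)
  = (sq q ^ S m - / sq q ^ S m) * (z - / z) * (Ci * phiz q m z).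
Proof.
  intros Hq Hz. assert (N := sq_neq0 q). assert (Es := sq_sq q ltac:(lra)).
  unfold phiz.
  assert (Hm : sq q ^ m <> 0) by now apply Cpow_nz.
  assert (E1 : RtoC (Rpower q ((1 - INR (S m)) / 2)) = / sq q ^ m).
  { rewrite sq_pow, <- RtoC_inv.
    - rewrite <- Rpower_Ropp. do 2 f_equal. rewrite S_INR. field.
    - assert (H := exp_pos (INR m / 2 * ln q)). unfold Rpower. lra. }
  assert (E2 : RtoC (Rpower q ((1 - INR m) / 2)) = sq q / sq q ^ m).
  { unfold Cdiv. rewrite <- E1. unfold sq. rewrite <- RtoC_mult, <- Rpower_plus. do 2 f_equal.
    rewrite S_INR. field. }
  assert (E3 : RtoC (q ^ m) = sq q ^ m * sq q ^ m).
  { rewrite <- Cpow_mult_l, Es. clear. induction m; simpl; [easy|]. now rewrite RtoC_mult, IHm. }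
  rewrite E1, E2. set (s := sq q) in *. set (p := s ^ m) in *.
  set (a := - Ci * z * (s / p)). set (b := - Ci * / z * (s / p)).
  assert (Sr : forall t, qpoch t q (S m) = qpoch t q m * (1 - t * RtoC (q ^ m))) by reflexivity.
  replace (- Ci * (s * z) * / p) with a by (unfold a; field; auto).
  replace (- Ci * / (/ s * z) * / p) with b by (unfold b; field; auto).
  rewrite !(Sr a), !(Sr b), !(qpoch_split (_ * / p)).
  replace (- Ci * / (s * z) * / p * RtoC q) with b by (rewrite <- Es; unfold b; field; auto).
  replace (- Ci * (/ s * z) * / p * RtoC q) with a by (rewrite <- Es; unfold a; field; auto).
  set (A := qpoch a q m). set (B := qpoch b q m). rewrite E3. unfold a, b.
  clearbody A B. rewrite Cpow_S. fold p. field. auto.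
Qed.

Lemma psi_0 q x : psi q 0 x = 1.
Proof.
  unfold psi, phiz. simpl. unfold Rpower, Rdiv. rewrite !Rmult_0_l, exp_0. field.
Qed.

Lemma psi_lowered q P : (0 < q < 1)%R -> admissible q P -> lowered q P (psi q).
Proof.
  intros Hq HP z Hz. destruct (HP z Hz) as [N0 [N1 _]].
  assert (N := sq_neq0 q). assert (N' := sq_inv_neq0 q).
  split.
  - rewrite AW_cosz by easy. rewrite !psi_0. unfold Cdiv. ring.
  - intros n. rewrite AW_cosz by easy.
    rewrite !psi_cosz by (try apply Cmult_neq_0; easy).
    set (c := RtoC (Rpower q (INR (S n) ^ 2 / 4)) / qpoch (RtoC q) q (S n)).
    transitivity ((- Ci) ^ S n * (c * ((sq q ^ S n - / sq q ^ S n) * (z - / z) * (Ci * phiz q n z)) / (Ci * (sq q - / sq q) * sinz z))).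
    { rewrite <- phiz_diff by easy. unfold Cdiv. ring. }
    rewrite AW_quotient_step by easy. unfold c. rewrite gamma_step by easy.
    rewrite Cpow_S. transitivity (- (Ci * Ci) * ((- Ci) ^ n * (RtoC (gamma q) * (RtoC (Rpower q (INR n ^ 2 / 4)) / qpoch (RtoC q) q n) * phiz q n z))); [ring|].
    rewrite Ci_Ci. ring.
Qed.

Lemma cdiff_ext f g x : (forall y, f y = g y) -> cdiff f x -> cdiff g x.
Proof. intros E. apply (cdiff_locally_ext f g x 1); [lra|auto]. Qed.

Lemma psi_cprod q m x : psi q m x = (- Ci) ^ m * (RtoC (Rpower q (INR m ^ 2 / 4)) / qpoch (RtoC q) q m)
  * cprod (fun j => (1 - RtoC (Rpower q ((1 - INR m) / 2) * q ^ j) ^ 2)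
                    + (2 * Ci * RtoC (Rpower q ((1 - INR m) / 2) * q ^ j)) * x) m.
Proof.
  unfold psi. destruct (expi_spec x) as [H1 H2]. now rewrite phiz_cosz, H2.
Qed.

Lemma psi_cdiff q m x : cdiff (psi q m) x.
Proof.
  apply (cdiff_ext (fun x => (- Ci) ^ m * (RtoC (Rpower q (INR m ^ 2 / 4)) / qpoch (RtoC q) q m)
  * cprod (fun j => (1 - RtoC (Rpower q ((1 - INR m) / 2) * q ^ j) ^ 2)
                    + (2 * Ci * RtoC (Rpower q ((1 - INR m) / 2) * q ^ j)) * x) m)).
  { intros y. now rewrite psi_cprod. }
  apply cdiff_mult; [apply cdiff_const|].
  generalize m at 3. intros n. induction n; simpl; [apply cdiff_const|].
  apply cdiff_mult; [easy|]. apply cdiff_plus; [apply cdiff_const|].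
  apply cdiff_mult; [apply cdiff_const|apply cdiff_id].
Qed.

Lemma exp_abs_bound (a b l : R) : (0 <= a)%R -> (0 <= b)%R -> (a + b * exp l <= (a + b) * exp (Rabs l))%R.
Proof.
  intros Ha Hb. assert (E1 := exp_le_mono l (Rabs l) (Rle_abs l)).
  assert (E2 := exp_ineq1_le (Rabs l)). assert (P := Rabs_pos l). nra.
Qed.

(** A polynomial of degree at most [m] is bounded by a multiple of [exp (m |l|)], [l = ln |x|], and
    completing the square gives [m |l| <= m^2 L / 4 + l^2 / L]. *)
Lemma psi_growth q m : (0 < q < 1)%R -> exists K, growth_bound q (psi q m) K 0.
Proof.
  intros Hq. assert (HL := lnq_pos q Hq). set (L := ln (/ q)) in *.
  set (c := (- Ci) ^ m * (RtoC (Rpower q (INR m ^ 2 / 4)) / qpoch (RtoC q) q m)).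
  set (s := Rpower q ((1 - INR m) / 2)).
  assert (Hs : (0 < s)%R) by apply exp_pos.
  set (A := (1 + s ^ 2 + 2 * s)%R). assert (HA : (0 < A)%R) by (unfold A; nra).
  assert (Hpos : (0 < A ^ m * exp (INR m ^ 2 * L / 4))%R).
  { apply Rmult_lt_0_compat; [now apply pow_lt|apply exp_pos]. }
  assert (Pc := Cmod_ge_0 c).
  exists ((Cmod c + 1) * (A ^ m * exp (INR m ^ 2 * L / 4)))%R. split; [|split].
  - apply Rmult_lt_0_compat; lra.
  - rewrite Rmult_0_l. assert (0 < ln 2)%R; [|lra]. rewrite <- ln_1. apply ln_increasing; lra.
  - intros x Hx. rewrite psi_cprod. fold c s L. rewrite Rmult_0_l, Rplus_0_l.
    set (l := ln (Cmod x)). assert (Hl : Cmod x = exp l).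
    { unfold l. rewrite exp_ln; [easy|]. now apply Cmod_gt_0. }
    assert (B : (Cmod (cprod (fun j => (1 - RtoC (s * q ^ j) ^ 2) + (2 * Ci * RtoC (s * q ^ j)) * x)%C m)
        <= (A * exp (Rabs l)) ^ m)%R).
    { generalize m at 1 2. intros n. induction n; simpl; [rewrite Cmod_1; lra|].
      rewrite Cmod_mult, Rmult_comm. apply Rmult_le_compat; try apply Cmod_ge_0; [|easy].
      assert (Hqn : (0 < q ^ n <= 1)%R).
      { split; [apply pow_lt; lra|]. rewrite <- (pow1 n). apply pow_incr; lra. }
      eapply Rle_trans; [apply Cmod_triangle|].
      eapply Rle_trans; [apply Rplus_le_compat_r, Cmod_sub_le|].
      change ((s * q ^ n)%R * ((s * q ^ n)%R * 1))%C with (RtoC (s * q ^ n) ^ 2).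
      rewrite !Cmod_mult, Cmod_pow, Cmod_Ci, Cmod_1, Cmod_RtoC_pos, Cmod_RtoC_pos, Hl by nra.
      assert (T := exp_abs_bound (1 + s ^ 2) (2 * s) l ltac:(nra) ltac:(lra)). fold A in T.
      eapply Rle_trans; [|exact T].
      assert (Pe := exp_pos l). assert (s * q ^ n <= s)%R by nra.
      assert ((s * q ^ n) ^ 2 <= s ^ 2)%R by (apply pow_incr; nra).
      assert (2 * 1 * (s * q ^ n) * exp l <= 2 * s * exp l)%R by nra. lra. }
    rewrite Cmod_mult. eapply Rle_trans.
    { apply Rmult_le_compat; [easy|apply Cmod_ge_0| |exact B]. apply Rle_trans with (Cmod c + 1)%R; [lra|apply Rle_refl]. }
    rewrite Rmult_assoc. apply Rmult_le_compat_l; [lra|].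
    rewrite Rpow_mult_distr, exp_pow, Rmult_assoc, <- exp_plus.
    apply Rmult_le_compat_l; [apply Rlt_le; now apply pow_lt|]. apply exp_le_mono.
    rewrite <- (pow2_abs l). set (y := Rabs l).
    assert (0 <= (INR m * L / 2 - y) ^ 2 / L)%R.
    { apply Rmult_le_pos; [apply pow2_ge_0|]. now apply Rlt_le, Rinv_0_lt_compat. }
    replace ((INR m * L / 2 - y) ^ 2 / L)%R with (INR m ^ 2 * L / 4 - INR m * y + y ^ 2 / L)%R in H by (field; lra).
    lra.
Qed.

(** [D_q^k psi_m] is [gamma^k psi_(m-k)] and vanishes for [k > m], so the expansion stops. It
    exhibits [psi] as the convolution of [en] with the numbers [psi_j(0)]. *)
Theorem psi_expansion q m x : (0 < q < 1)%R ->
  psi q m x = csum (fun k => psi q (m - k) 0 * en q k x) (S m).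
Proof.
  intros Hq. destruct (psi_growth q m Hq) as [K HK].
  assert (H := en_expansion q (psi q m) K 0 Hq (psi_cdiff q m) HK x).
  apply cv_unique with (1 := H).
  apply cv_ext_from with (S m) (fun _ => csum (fun k => psi q (m - k) 0 * en q k x) (S m)); [|apply cv_const].
  assert (D : forall k, dcoef q (psi q m) k = if le_dec k m then psi q (m - k) 0 else 0).
  { intros k. destruct (cosz_i q) as [z [Hz H0]]. unfold dcoef. rewrite <- H0.
    assert (Ad := lattice_i_admissible q Hq).
    rewrite (AW_iter_lowered q (lattice_i q)); auto using psi_lowered.
    rewrite H0. destruct (le_dec k m); [|ring]. field. apply Cpow_nz. now apply gamma_C_neq0. }
  intros n Hn. replace n with (S m + (n - S m))%nat by lia. rewrite csum_add.
  rewrite (csum_zero _ (n - S m)).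
  - rewrite Cplus_0_r. apply csum_ext. intros k Hk. rewrite D. destruct (le_dec k m); [easy|lia].
  - intros k Hk. rewrite D. destruct (le_dec (S m + k) m); [lia|ring].
Qed.

(** * Cauchy products *)

Lemma rsum_arith_geom t n : (0 <= t < 1)%R ->
  (rsum (fun k => INR (S k) * t ^ k) n <= / (1 - t) * / (1 - t))%R.
Proof.
  intros Ht.
  assert (E : (rsum (fun k => INR (S k) * t ^ k) n * ((1 - t) * (1 - t)) = 1 - t ^ n - INR n * t ^ n * (1 - t))%R).
  { induction n; [simpl; ring|].
    change (rsum (fun k => INR (S k) * t ^ k)%R (S n)) with (rsum (fun k => INR (S k) * t ^ k)%R n + INR (S n) * t ^ n)%R.
    rewrite Rmult_plus_distr_r, IHn, S_INR. simpl. ring. }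
  assert (0 <= t ^ n)%R by (apply pow_le; lra). assert (P := pos_INR n).
  assert (0 < (1 - t) * (1 - t))%R by (apply Rmult_lt_0_compat; lra).
  apply Rmult_le_reg_r with ((1 - t) * (1 - t))%R; [easy|]. rewrite E.
  replace (/ (1 - t) * / (1 - t) * ((1 - t) * (1 - t)))%R with 1%R by (field; lra).
  assert (0 <= INR n * t ^ n * (1 - t))%R by (apply Rmult_le_pos; [apply Rmult_le_pos|]; lra). lra.
Qed.

Lemma rsum_const c n : rsum (fun _ => c) n = (INR n * c)%R.
Proof. induction n; [simpl; ring|]. rewrite S_INR. simpl rsum. rewrite IHn. ring. Qed.

(** Column [m] has [m + 1] entries, so the sum of [(m + 1) t^m] is what counts. *)
Lemma triangular_geom (u : nat -> nat -> C) A t : (0 <= t < 1)%R ->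
  (forall m k, (k <= m)%nat -> (Cmod (u k m) <= A * t ^ m)%R) ->
  exists M, forall n, (rsum (fun m => rsum (fun k => Cmod (u k m)) (S m)) n <= M)%R.
Proof.
  intros Ht H. exists (A * (/ (1 - t) * / (1 - t)))%R. intros n.
  assert (HA : (0 <= A)%R). { specialize (H 0%nat 0%nat (le_n 0)). simpl in H. assert (P := Cmod_ge_0 (u 0%nat 0%nat)). lra. }
  eapply Rle_trans; [|apply Rmult_le_compat_l; [easy|apply (rsum_arith_geom t n Ht)]].
  rewrite <- rsum_scal. apply rsum_le. intros m _.
  apply Rle_trans with (rsum (fun _ => A * t ^ m) (S m))%R.
  - apply rsum_le. intros k Hk. apply H. lia.
  - rewrite rsum_const. right. ring.
Qed.

Lemma triangular_diag_summable (u : nat -> nat -> C) M :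
  (forall n, (rsum (fun m => rsum (fun k => Cmod (u k m)) (S m)) n <= M)%R) ->
  exists s, cv (csum (fun m => csum (fun k => u k m) (S m))) s.
Proof.
  intros H. apply summable_cv. apply summable_le with (fun m => rsum (fun k => Cmod (u k m)) (S m)) M; [|easy].
  intros k. apply Cmod_csum.
Qed.

Lemma cauchy_product a b al be A B t : (0 <= t < 1)%R ->
  (forall n, (Cmod (a n) <= A * t ^ n)%R) -> (forall n, (Cmod (b n) <= B * t ^ n)%R) ->
  cv (csum a) al -> cv (csum b) be ->
  cv (csum (fun m => csum (fun k => a k * b (m - k)%nat) (S m))) (al * be).
Proof.
  intros Ht Ha Hb HA HB.
  set (u := fun k m => a k * b (m - k)%nat).
  assert (Hu : forall m k, (k <= m)%nat -> (Cmod (u k m) <= A * B * t ^ m)%R).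
  { intros m k Hk. unfold u. rewrite Cmod_mult.
    replace (A * B * t ^ m)%R with (A * t ^ k * (B * t ^ (m - k)))%R.
    - apply Rmult_le_compat; try apply Cmod_ge_0; auto.
    - replace m with (k + (m - k))%nat at 2 by lia. rewrite pow_add. ring. }
  destruct (triangular_geom u (A * B)%R t Ht Hu) as [M HM].
  destruct (triangular_diag_summable u M HM) as [s Hs].
  replace (al * be) with s; [easy|].
  apply cv_unique with (csum (fun k => a k * be)).
  - apply (fubini_triangular u); [now exists M| |easy]. intros k.
    apply cv_ext_from with 0%nat (fun n => a k * csum b n).
    + intros n _. rewrite <- csum_scal. apply csum_ext. intros j _. unfold u. do 2 f_equal. lia.
    + now apply cv_scal.
  - apply cv_ext_from with 0%nat (fun n => be * csum a n).
    + intros n _. rewrite <- csum_scal. apply csum_ext. intros; ring.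
    + rewrite Cmult_comm. now apply cv_scal.
Qed.

(** * The q-binomial theorem *)

Lemma inv_one_minus_exp x q : (0 <= x <= q)%R -> (q < 1)%R -> (/ (1 - x) <= exp (x / (1 - q)))%R.
Proof.
  intros Hx Hq. eapply Rle_trans; [|apply exp_ineq1_le].
  assert (H : (/ (1 - x) <= / (1 - q))%R) by (apply Rinv_le_contravar; lra).
  replace (/ (1 - x))%R with (1 + x * / (1 - x))%R by (field; lra).
  apply Rplus_le_compat_l. unfold Rdiv. apply Rmult_le_compat_l; lra.
Qed.

Lemma pow_le_base q n : (0 < q < 1)%R -> (0 < q ^ S n <= q)%R /\ (q ^ S n <= q ^ n)%R.
Proof.
  intros Hq. assert (0 < q ^ n)%R by (apply pow_lt; lra).
  assert (q ^ n <= 1)%R by (rewrite <- (pow1 n); apply pow_incr; lra).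
  simpl. split; [split|]; nra.
Qed.

(** Each factor [1 / (1 - q^k)] is at most [exp (q^k / (1 - q))], and the exponents form a geometric
    series. *)
Lemma qpoch_q_inv_bound q n : (0 < q < 1)%R ->
  (Cmod (/ qpoch (RtoC q) q n) <= exp (/ (1 - q) / (1 - q)))%R.
Proof.
  intros Hq. rewrite Cmod_inv by now apply qpoch_q_neq0.
  apply Rle_trans with (exp (/ (1 - q) * rsum (fun k => q ^ k)%R n)).
  - induction n.
    + simpl. rewrite Cmod_1, Rinv_1, Rmult_0_r, exp_0. lra.
    + cbn [qpoch rsum]. rewrite Cmod_mult, Rinv_mult, Rmult_plus_distr_l, exp_plus.
      destruct (pow_le_base q n Hq) as [H1 H2].
      rewrite <- RtoC_mult, <- RtoC_minus, Cmod_RtoC_pos by (simpl in H1; lra).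
      apply Rmult_le_compat.
      * apply Rlt_le, Rinv_0_lt_compat, Cmod_gt_0. now apply qpoch_q_neq0.
      * apply Rlt_le, Rinv_0_lt_compat. simpl in H1. lra.
      * easy.
      * eapply Rle_trans; [apply (inv_one_minus_exp (q ^ S n) q); lra|].
        apply exp_le_mono. unfold Rdiv. rewrite Rmult_comm. apply Rmult_le_compat_l; [|easy].
        apply Rlt_le, Rinv_0_lt_compat. lra.
  - apply exp_le_mono. unfold Rdiv. apply Rmult_le_compat_l.
    + apply Rlt_le, Rinv_0_lt_compat. lra.
    + apply rsum_geom_le. lra.
Qed.

Definition bin_coef (a p : R) (k : nat) : C := qpoch (RtoC a) p k / qpoch (RtoC p) p k.

Lemma qpoch_R_bound a p k : (0 <= a <= 1)%R -> (0 < p < 1)%R -> (Cmod (qpoch (RtoC a) p k) <= 1)%R.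
Proof.
  intros Ha Hp. induction k; cbn [qpoch]; [rewrite Cmod_1; lra|].
  assert (0 < p ^ k)%R by (apply pow_lt; lra).
  assert (p ^ k <= 1)%R by (rewrite <- (pow1 k); apply pow_incr; lra).
  rewrite Cmod_mult, <- RtoC_mult, <- RtoC_minus, Cmod_RtoC_pos by nra.
  apply Rle_trans with (1 * 1)%R; [|lra]. apply Rmult_le_compat; [apply Cmod_ge_0|nra|easy|nra].
Qed.

Lemma bin_coef_bound a p k : (0 <= a <= 1)%R -> (0 < p < 1)%R ->
  (Cmod (bin_coef a p k) <= exp (/ (1 - p) / (1 - p)))%R.
Proof.
  intros Ha Hp. unfold bin_coef, Cdiv. rewrite Cmod_mult.
  rewrite <- (Rmult_1_l (exp _)). apply Rmult_le_compat; try apply Cmod_ge_0.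
  - now apply qpoch_R_bound.
  - now apply qpoch_q_inv_bound.
Qed.

(** The basic hypergeometric series [1phi0(a; -; p, t)]. *)
Definition binF (a p : R) (t : C) : C := the_C (cv (csum (fun k => bin_coef a p k * t ^ k))).

Lemma geom_term_bound (c : nat -> C) M t : (forall k, (Cmod (c k) <= M)%R) ->
  forall k, (Cmod (c k * t ^ k) <= M * Cmod t ^ k)%R.
Proof.
  intros H k. rewrite Cmod_mult, Cmod_pow. apply Rmult_le_compat_r; [apply pow_le, Cmod_ge_0|easy].
Qed.

Lemma binF_cv a p t : (0 <= a <= 1)%R -> (0 < p < 1)%R -> (Cmod t < 1)%R ->
  cv (csum (fun k => bin_coef a p k * t ^ k)) (binF a p t).
Proof.
  intros Ha Hp Ht. unfold binF, the_C. apply epsilon_spec. apply summable_cv.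
  apply summable_geom with (exp (/ (1 - p) / (1 - p))) (Cmod t).
  - split; [apply Cmod_ge_0|easy].
  - apply geom_term_bound. intros k. now apply bin_coef_bound.
Qed.

Lemma bin_coef_rec a p k : (0 < p < 1)%R ->
  bin_coef a p (S k) * (1 - RtoC (p ^ S k)) = bin_coef a p k * (1 - RtoC a * RtoC (p ^ k)).
Proof.
  intros Hp. unfold bin_coef. cbn [qpoch].
  assert (N := qpoch_q_neq0 p k Hp). assert (N' := qpoch_q_neq0 p (S k) Hp). cbn [qpoch] in N'.
  replace (RtoC (p ^ S k)) with (RtoC p * RtoC (p ^ k)) by (simpl; now rewrite RtoC_mult).
  assert (1 - RtoC p * RtoC (p ^ k) <> 0). { intros C. apply N'. rewrite C. ring. }
  field. auto.
Qed.

Lemma Cmod_pmult p t : (0 < p < 1)%R -> Cmod (RtoC p * t) = (p * Cmod t)%R.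
Proof. intros Hp. rewrite Cmod_mult, Cmod_RtoC_pos; lra. Qed.

Lemma binF_step a p t : (0 <= a <= 1)%R -> (0 < p < 1)%R -> (Cmod t < 1)%R ->
  (1 - t) * binF a p t = (1 - RtoC a * t) * binF a p (RtoC p * t).
Proof.
  intros Ha Hp Ht. assert (Pt := Cmod_ge_0 t).
  assert (H1 := binF_cv a p t Ha Hp Ht).
  assert (H2 : cv (csum (fun k => bin_coef a p k * (RtoC p * t) ^ k)) (binF a p (RtoC p * t))).
  { apply binF_cv; auto. rewrite Cmod_pmult by easy. nra. }
  apply Ceq_minus.
  apply cv_unique with (fun n => (1 - t) * csum (fun k => bin_coef a p k * t ^ k) n
     - (1 - RtoC a * t) * csum (fun k => bin_coef a p k * (RtoC p * t) ^ k) n).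
  - apply cv_minus; now apply cv_scal.
  (* The partial sums satisfy the functional equation up to this one boundary term, which tends to
     0. *)
  - apply cv_ext_from with 0%nat (fun n => (- (1 - RtoC (p ^ n)) * bin_coef a p n) * t ^ n).
    + intros n _. induction n.
      * simpl. ring.
      * cbn [csum]. rewrite !Cmult_plus_distr_l.
        match goal with |- _ = ?u1 + ?u2 - (?v1 + ?v2) =>
          transitivity ((u1 - v1) + (u2 - v2)); [|ring] end.
        rewrite <- IHn. rewrite Cpow_mult_l.
        replace (RtoC p ^ n) with (RtoC (p ^ n)).
        2: { clear. induction n; simpl; [easy|]. now rewrite RtoC_mult, IHn. }
        replace (- (1 - RtoC (p ^ S n)) * bin_coef a p (S n)) with (- (bin_coef a p n * (1 - RtoC a * RtoC (p ^ n)))).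
        2: { rewrite <- bin_coef_rec by easy. ring. }
        rewrite Cpow_S. ring.
    + apply cv_0_geom with (2 * exp (/ (1 - p) / (1 - p)))%R (Cmod t); [lra|].
      apply geom_term_bound. intros k. rewrite Cmod_mult, Cmod_opp.
      apply Rmult_le_compat; try apply Cmod_ge_0; [|now apply bin_coef_bound].
      assert (0 < p ^ k)%R by (apply pow_lt; lra).
      assert (p ^ k <= 1)%R by (rewrite <- (pow1 k); apply pow_incr; lra).
      rewrite <- RtoC_minus, Cmod_RtoC_pos; lra.
Qed.

Lemma binF_iter a p t n : (0 <= a <= 1)%R -> (0 < p < 1)%R -> (Cmod t < 1)%R ->
  qpoch t p n * binF a p t = qpoch (RtoC a * t) p n * binF a p (RtoC (p ^ n) * t).
Proof.
  intros Ha Hp Ht. induction n; cbn [qpoch].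
  - simpl. rewrite !Cmult_1_l. reflexivity.
  - assert (0 < p ^ n)%R by (apply pow_lt; lra).
    assert (p ^ n <= 1)%R by (rewrite <- (pow1 n); apply pow_incr; lra).
    assert (Hs := binF_step a p (RtoC (p ^ n) * t) Ha Hp).
    transitivity ((1 - t * RtoC (p ^ n)) * (qpoch t p n * binF a p t)); [ring|]. rewrite IHn.
    transitivity (qpoch (RtoC a * t) p n * ((1 - RtoC (p ^ n) * t) * binF a p (RtoC (p ^ n) * t))); [ring|].
    rewrite Hs.
    + simpl (p ^ S n)%R.
      replace (RtoC p * (RtoC (p ^ n) * t)) with (RtoC (p * p ^ n) * t) by (rewrite RtoC_mult; ring). ring.
    + rewrite Cmod_mult, Cmod_RtoC_pos by lra. nra.
Qed.

Lemma binF_at_0 a p t : (0 <= a <= 1)%R -> (0 < p < 1)%R -> (Cmod t < 1)%R ->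
  cv (fun n => binF a p (RtoC (p ^ n) * t)) 1.
Proof.
  intros Ha Hp Ht. set (M := exp (/ (1 - p) / (1 - p))). assert (Pt := Cmod_ge_0 t).
  assert (HM : (0 < M)%R) by apply exp_pos.
  assert (B : forall s, (Cmod s < 1)%R -> (Cmod (binF a p s - 1) <= M * Cmod s * / (1 - Cmod s))%R).
  { intros s Hs. assert (Ps := Cmod_ge_0 s).
    apply cv_le_bound with (fun n => csum (fun k => bin_coef a p k * s ^ k) (S n) - 1).
    - apply cv_minus; [|apply cv_const]. apply (cv_subseq S); [lia|]. now apply binF_cv.
    - intros n. rewrite csum_S_l. unfold bin_coef at 1. simpl (_ * s ^ 0).
      match goal with |- (Cmod ?x <= _)%R => replace x with (csum (fun k => bin_coef a p (S k) * s ^ S k) n) by (cbn [qpoch]; field) end.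
      eapply Rle_trans; [apply Cmod_csum|].
      apply Rle_trans with (rsum (fun k => M * Cmod s * Cmod s ^ k)%R n).
      + apply rsum_le. intros k _. rewrite Cmod_mult, Cmod_pow. simpl. rewrite Rmult_assoc.
        apply Rmult_le_compat_r; [|now apply bin_coef_bound].
        apply Rmult_le_pos; [easy|now apply pow_le].
      + rewrite rsum_scal. apply Rmult_le_compat_l; [nra|]. apply rsum_geom_le. lra. }
  intros e He.
  destruct (geom_small (M * / (1 - Cmod t)) p e ltac:(lra) He) as [N HN].
  exists N. intros n Hn. specialize (HN n Hn).
  assert (0 < p ^ n)%R by (apply pow_lt; lra).
  assert (p ^ n <= 1)%R by (rewrite <- (pow1 n); apply pow_incr; lra).
  assert (E : Cmod (RtoC (p ^ n) * t) = (p ^ n * Cmod t)%R) by (rewrite Cmod_mult, Cmod_RtoC_pos; lra).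
  eapply Rle_lt_trans; [apply B; rewrite E; nra|]. rewrite E.
  eapply Rle_lt_trans; [|exact HN].
  assert (I1 : (0 < / (1 - Cmod t))%R) by (apply Rinv_0_lt_compat; lra).
  apply Rle_trans with (M * (p ^ n * Cmod t) * / (1 - Cmod t))%R.
  - assert (L1 : (p ^ n * Cmod t <= Cmod t)%R) by (rewrite <- (Rmult_1_l (Cmod t)) at 2; apply Rmult_le_compat_r; lra).
    assert (L2 : (0 <= p ^ n * Cmod t)%R) by (apply Rmult_le_pos; lra).
    apply Rmult_le_compat_l; [apply Rmult_le_pos; lra|]. apply Rinv_le_contravar; lra.
  - replace (M * / (1 - Cmod t) * p ^ n)%R with (M * (p ^ n * 1) * / (1 - Cmod t))%R by ring.
    apply Rmult_le_compat_r; [lra|]. apply Rmult_le_compat_l; [lra|]. apply Rmult_le_compat_l; lra.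
Qed.

Lemma qpoch_0_l p n : qpoch (RtoC 0) p n = 1.
Proof. induction n; simpl; [easy|]. rewrite IHn. ring. Qed.

(** For [a = 0] the iterated functional equation reads [(t; p)_n F(t) = F(p^n t)], with limit 1.
    Hence [F(t)] is nonzero and the infinite product converges to [1 / F(t)]. *)
Lemma qpoch_inf_spec t p : (0 < p < 1)%R -> (Cmod t < 1)%R ->
  cv (qpoch t p) (qpoch_inf t p) /\ qpoch_inf t p <> 0.
Proof.
  intros Hp Ht. assert (Ha : (0 <= 0 <= 1)%R) by lra.
  assert (H := binF_at_0 0 p t Ha Hp Ht).
  assert (H' : cv (fun n => binF 0 p t * qpoch t p n) 1).
  { apply cv_ext_from with 0%nat (fun n => binF 0 p (RtoC (p ^ n) * t)); [|easy].
    intros n _. rewrite (Cmult_comm (binF 0 p t)), binF_iter by easy.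
    replace (RtoC 0 * t) with (RtoC 0) by ring. rewrite qpoch_0_l. ring. }
  assert (N : binF 0 p t <> 0).
  { intros C. apply C1_nz. apply (cv_unique _ _ _ H').
    apply cv_ext_from with 0%nat (fun _ => RtoC 0); [|apply cv_const]. intros n _. rewrite C. ring. }
  assert (K : cv (qpoch t p) (/ binF 0 p t)).
  { apply cv_ext_from with 0%nat (fun n => / binF 0 p t * (binF 0 p t * qpoch t p n)).
    - intros n _. field. easy.
    - replace (/ binF 0 p t) with (/ binF 0 p t * 1) at 1 by ring. now apply cv_scal. }
  assert (E : cv (qpoch t p) (qpoch_inf t p)).
  { unfold qpoch_inf, the_C. apply cv_filterlim. apply epsilon_spec.
    exists (/ binF 0 p t). now apply cv_filterlim. }
  split; [easy|]. rewrite (cv_unique _ _ _ E K). intros C.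
  apply C1_nz. replace (RtoC 1) with (binF 0 p t * / binF 0 p t) by (now field). rewrite C. ring.
Qed.

Theorem q_binomial a p t : (0 <= a <= 1)%R -> (0 < p < 1)%R -> (Cmod t < 1)%R ->
  qpoch_inf t p * binF a p t = qpoch_inf (RtoC a * t) p.
Proof.
  intros Ha Hp Ht.
  assert (Hat : (Cmod (RtoC a * t) < 1)%R).
  { rewrite Cmod_mult, Cmod_RtoC_pos by lra. assert (P := Cmod_ge_0 t). nra. }
  destruct (qpoch_inf_spec t p Hp Ht) as [H1 _]. destruct (qpoch_inf_spec _ p Hp Hat) as [H2 _].
  apply cv_unique with (fun n => qpoch t p n * binF a p t).
  - apply cv_mult; [easy|apply cv_const].
  - apply cv_ext_from with 0%nat (fun n => qpoch (RtoC a * t) p n * binF a p (RtoC (p ^ n) * t)).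
    + intros n _. now rewrite binF_iter.
    + rewrite <- (Cmult_1_r (qpoch_inf (RtoC a * t) p)). apply cv_mult; [easy|]. now apply binF_at_0.
Qed.

(** * The generating function of the normalised basis *)

(** At [z = i] the two products of [phiz] merge into [(q^(1-m); q^2)_m], which gains one factor at
    each end when [m] grows by 2. *)
Lemma psi_at_0_rec q m : (0 < q < 1)%R ->
  psi q (S (S m)) 0 = psi q m 0 * ((1 - RtoC (q ^ S m)) / (1 - RtoC (q ^ S (S m)))).
Proof.
  intros Hq.
  assert (H0 : cosz Ci = 0).
  { unfold cosz. replace (/ Ci) with (- Ci); [unfold Cdiv; ring|].
    unfold Cinv, Copp, Ci; simpl. f_equal; field. }
  assert (W : forall n, phiz q n Ci = qpoch (RtoC (Rpower q (1 - INR n))) (q ^ 2) n).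
  { intros n. unfold phiz. set (s := Rpower q ((1 - INR n) / 2)).
    replace (Rpower q (1 - INR n)) with (s * s)%R.
    2: { unfold s. rewrite <- Rpower_plus. f_equal. field. }
    replace (- Ci * Ci * RtoC s) with (RtoC s).
    2: { transitivity (- (Ci * Ci) * RtoC s); [rewrite Ci_Ci|]; ring. }
    replace (- Ci * / Ci * RtoC s) with (- RtoC s) by (field; apply Ci_nz).
    clearbody s. induction n; [simpl; ring|]. cbn [qpoch].
    rewrite <- IHn. rewrite <- pow_mult. replace (2 * n)%nat with (n + n)%nat by lia.
    rewrite pow_add, !RtoC_mult. ring. }
  rewrite <- H0 at 1 2. rewrite !psi_cosz, !W by apply Ci_nz.
  set (Q := (q ^ 2)%R).
  assert (Hq1 : (q ^ S m <> 0)%R) by (apply pow_nonzero; lra).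
  assert (E1 : Rpower q (1 - INR (S (S m))) = (/ q ^ S m)%R).
  { rewrite <- Rpower_opp_nat by lra. f_equal. rewrite !S_INR. ring. }
  rewrite E1, (qpoch_split (RtoC (/ q ^ S m))).
  replace (RtoC (/ q ^ S m) * RtoC Q) with (RtoC (Rpower q (1 - INR m))).
  2: { rewrite <- RtoC_mult. f_equal. rewrite <- E1. unfold Q. rewrite <- Rpower_pow, <- Rpower_plus by lra.
       f_equal. rewrite !S_INR. simpl. ring. }
  assert (Sr : forall t, qpoch t Q (S m) = qpoch t Q m * (1 - t * RtoC (Q ^ m))) by reflexivity.
  rewrite Sr.
  replace (RtoC (Rpower q (1 - INR m)) * RtoC (Q ^ m)) with (RtoC (q ^ S m)).
  2: { rewrite <- RtoC_mult. f_equal. unfold Q. rewrite <- pow_mult.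
       rewrite <- !Rpower_pow, <- Rpower_plus by lra. f_equal. rewrite S_INR, mult_INR. simpl. ring. }
  set (P := qpoch _ Q m). cbn [qpoch].
  assert (E2 : RtoC (Rpower q (INR (S (S m)) ^ 2 / 4)) = RtoC (Rpower q (INR m ^ 2 / 4)) * RtoC (q ^ S m)).
  { rewrite <- RtoC_mult, <- (Rpower_pow (S m) q), <- Rpower_plus by lra. do 2 f_equal. rewrite !S_INR. field. }
  rewrite E2.
  replace (RtoC q * RtoC (q ^ m)) with (RtoC (q ^ S m)) by (simpl; now rewrite RtoC_mult).
  replace (RtoC q * RtoC (q ^ S m)) with (RtoC (q ^ S (S m))) by (simpl; now rewrite !RtoC_mult).
  assert (N1 := qpoch_q_neq0 q m Hq).
  assert (N2 : forall k, 1 - RtoC (q ^ S k) <> 0).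
  { intros k C. rewrite <- RtoC_minus in C. apply RtoC_inj in C. destruct (pow_le_base q k Hq). lra. }
  rewrite RtoC_inv by easy.
  assert (N3 : RtoC (q ^ S m) <> 0) by (intros C; now apply RtoC_inj in C).
  replace ((- Ci) ^ S (S m)) with (- (- Ci) ^ m).
  2: { rewrite !Cpow_S. transitivity (Ci * Ci * (- Ci) ^ m); [rewrite Ci_Ci|]; ring. }
  assert (N4 := N2 m). assert (N5 := N2 (S m)).
  set (x := RtoC (q ^ S m)) in *. set (y := RtoC (q ^ S (S m))) in *. clearbody x y.
  field. auto.
Qed.

Lemma psi_1_at_0 q : (0 < q < 1)%R -> psi q 1 0 = 0.
Proof.
  intros Hq. rewrite psi_cprod. cbn [cprod]. simpl (INR 1).
  replace ((1 - 1) / 2)%R with 0%R by field. rewrite Rpower_O by lra.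
  replace (1 * q ^ 0)%R with 1%R by (simpl; ring). ring.
Qed.

(** Together with [psi_odd_at_0], this makes the generating function of [psi_m(0)] a q-binomial
    series in [w ^ 2] with base [q ^ 2], whose sum is the inverse of the prefactor of [qE_disc]. *)
Lemma psi_even_at_0 q k : (0 < q < 1)%R -> psi q (2 * k) 0 = bin_coef q (q ^ 2) k.
Proof.
  intros Hq. assert (Hp : (0 < q ^ 2 < 1)%R) by (simpl; nra).
  induction k.
  - simpl (2 * 0)%nat. rewrite psi_0. unfold bin_coef. simpl. field.
  - replace (2 * S k)%nat with (S (S (2 * k))) by lia. rewrite psi_at_0_rec, IHk by easy.
    assert (R := bin_coef_rec q (q ^ 2) k Hp).
    assert (N : 1 - RtoC ((q ^ 2) ^ S k) <> 0).
    { intros C. rewrite <- RtoC_minus in C. apply RtoC_inj in C. destruct (pow_le_base (q ^ 2) k Hp). lra. }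
    replace (q ^ S (S (2 * k)))%R with ((q ^ 2) ^ S k)%R by (rewrite <- pow_mult; f_equal; lia).
    replace (RtoC (q ^ S (2 * k))) with (RtoC q * RtoC ((q ^ 2) ^ k)).
    2: { rewrite <- RtoC_mult. f_equal. rewrite <- pow_mult. reflexivity. }
    transitivity (bin_coef q (q ^ 2) k * (1 - RtoC q * RtoC ((q ^ 2) ^ k)) / (1 - RtoC ((q ^ 2) ^ S k))); [field; easy|].
    rewrite <- R. field. easy.
Qed.

Lemma psi_odd_at_0 q k : (0 < q < 1)%R -> psi q (2 * k + 1) 0 = 0.
Proof.
  intros Hq. induction k; [now apply psi_1_at_0|].
  replace (2 * S k + 1)%nat with (S (S (2 * k + 1))) by lia. rewrite psi_at_0_rec, IHk by easy. ring.
Qed.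

Lemma psi_at_0_bound q m : (0 < q < 1)%R -> (Cmod (psi q m 0) <= 1)%R.
Proof.
  intros Hq. induction m using nat_pair_ind.
  - rewrite psi_0, Cmod_1. lra.
  - rewrite psi_1_at_0, Cmod_0 by easy. lra.
  - rewrite psi_at_0_rec, <- !RtoC_minus, <- RtoC_div, Cmod_mult by
      (try easy; destruct (pow_le_base q (S m) Hq); lra).
    destruct (pow_le_base q m Hq) as [A1 A2]. destruct (pow_le_base q (S m) Hq) as [B1 B2].
    assert (F : (0 <= (1 - q ^ S m) / (1 - q ^ S (S m)) <= 1)%R).
    { split.
      - apply Rmult_le_pos; [lra|]. apply Rlt_le, Rinv_0_lt_compat. lra.
      - apply Rmult_le_reg_r with (1 - q ^ S (S m))%R; [lra|]. unfold Rdiv. rewrite Rmult_assoc, Rinv_l; lra. }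
    rewrite Cmod_RtoC_pos by easy. nra.
Qed.

Lemma en_step q n x : (0 < q < 1)%R ->
  en q (S (S n)) x = en q n x * (RtoC (q ^ S n) * (4 * (x ^ 2 - RtoC (node q n)))
      / ((1 - RtoC (q ^ S n)) * (1 - RtoC (q ^ S (S n))))).
Proof.
  intros Hq. unfold en. rewrite rho_SS by lra. cbn [qpoch].
  assert (E2 : RtoC (Rpower q (INR (S (S n)) ^ 2 / 4)) = RtoC (Rpower q (INR n ^ 2 / 4)) * RtoC (q ^ S n)).
  { rewrite <- RtoC_mult, <- (Rpower_pow (S n) q), <- Rpower_plus by lra. do 2 f_equal. rewrite !S_INR. field. }
  rewrite E2.
  replace (RtoC q * RtoC (q ^ n)) with (RtoC (q ^ S n)) by (simpl; now rewrite RtoC_mult).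
  replace (RtoC q * RtoC (q ^ S n)) with (RtoC (q ^ S (S n))) by (simpl; now rewrite !RtoC_mult).
  assert (N1 := qpoch_q_neq0 q n Hq).
  assert (N2 : forall k, 1 - RtoC (q ^ S k) <> 0).
  { intros k C. rewrite <- RtoC_minus in C. apply RtoC_inj in C. destruct (pow_le_base q k Hq). lra. }
  field. auto.
Qed.

(** The step factor from [n] to [n + 2] is at most [exp (D q^n)]: the weight [q^(n+1)] compensates
    the node of size [q^(-n)], and each of the two denominators adds [q^n / (1 - q)] to the
    exponent. The product of these factors is bounded. *)
Lemma en_bounded q x : (0 < q < 1)%R -> exists M, (0 < M)%R /\ forall n, (Cmod (en q n x) <= M)%R.
Proof.
  intros Hq. set (K := (Cmod (en q 0 x) + Cmod (en q 1 x) + 1)%R).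
  assert (P0 := Cmod_ge_0 (en q 0 x)). assert (P1 := Cmod_ge_0 (en q 1 x)).
  set (X := (4 * Cmod x ^ 2)%R). assert (HX : (0 <= X)%R) by (unfold X; assert (T := pow2_ge_0 (Cmod x)); lra).
  set (D := (X + 2 / (1 - q))%R).
  assert (Hi : (0 < / (1 - q))%R) by (apply Rinv_0_lt_compat; lra).
  assert (HD : (0 <= D)%R) by (unfold D, Rdiv; lra).
  assert (HK : (0 < K)%R) by (unfold K; lra).
  assert (B : forall n, (Cmod (en q n x) <= K * exp (D * rsum (fun j => q ^ j)%R n))%R).
  { assert (E1 : forall n, (1 <= exp (D * rsum (fun j => q ^ j)%R n))%R).
    { intros n. rewrite <- exp_0. apply exp_le_mono. apply Rmult_le_pos; [easy|].
      apply rsum_pos. intros. apply pow_le; lra. }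
    intros n. induction n using nat_pair_ind.
    - specialize (E1 0%nat). unfold K in *. nra.
    - specialize (E1 1%nat). unfold K in *. nra.
    - rewrite en_step, Cmod_mult by easy.
      destruct (pow_le_base q n Hq) as [A1 A2]. destruct (pow_le_base q (S n) Hq) as [C1 C2].
      assert (F : (Cmod (RtoC (q ^ S n) * (4 * (x ^ 2 - RtoC (node q n)))
          / ((1 - RtoC (q ^ S n)) * (1 - RtoC (q ^ S (S n))))) <= exp (D * q ^ n))%R).
      { unfold Cdiv. rewrite <- !RtoC_minus, <- RtoC_mult, <- RtoC_inv, !Cmod_mult by nra.
        rewrite (Cmod_RtoC_pos (/ _)) by (apply Rlt_le, Rinv_0_lt_compat; nra).
        rewrite Cmod_RtoC_pos, Cmod_RtoC_pos, Rinv_mult by lra.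
        assert (G1 := inv_one_minus_exp (q ^ S n) q ltac:(lra) ltac:(lra)).
        assert (G2 := inv_one_minus_exp (q ^ S (S n)) q ltac:(lra) ltac:(lra)).
        assert (G3 : (q ^ S n * (4 * Cmod (x ^ 2 - RtoC (node q n))) <= exp (X * q ^ n))%R).
        { eapply Rle_trans; [|apply exp_ineq1_le].
          apply Rle_trans with (q ^ S n * (X + / q ^ n))%R.
          - apply Rmult_le_compat_l; [lra|].
            assert (T := Cmod_sub_le (x ^ 2) (RtoC (node q n))). rewrite Cmod_R, Cmod_pow in T.
            assert (T2 := node_abs q n Hq). unfold X. lra.
          - simpl. replace (q * q ^ n * (X + / q ^ n))%R with (q * (X * q ^ n) + q)%R by (field; lra).
            assert (0 <= X * q ^ n)%R by nra. nra. }
        replace (D * q ^ n)%R with (X * q ^ n + (q ^ n / (1 - q) + q ^ n / (1 - q)))%R by (unfold D; field; lra).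
        rewrite !exp_plus. apply Rmult_le_compat; [|  |easy|].
        - apply Rmult_le_pos; [lra|]. apply Rmult_le_pos; [lra|apply Cmod_ge_0].
        - apply Rmult_le_pos; apply Rlt_le, Rinv_0_lt_compat; lra.
        - apply Rmult_le_compat; try (apply Rlt_le, Rinv_0_lt_compat; lra).
          + eapply Rle_trans; [exact G1|]. apply exp_le_mono. unfold Rdiv. apply Rmult_le_compat_r; lra.
          + eapply Rle_trans; [exact G2|]. apply exp_le_mono. unfold Rdiv. apply Rmult_le_compat_r; lra. }
      eapply Rle_trans; [apply Rmult_le_compat; [apply Cmod_ge_0|apply Cmod_ge_0|exact IHn|exact F]|].
      rewrite Rmult_assoc, <- exp_plus. apply Rmult_le_compat_l; [lra|]. apply exp_le_mono.
      cbn [rsum]. nra. }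
  exists (K * exp (D * / (1 - q)))%R. split; [apply Rmult_lt_0_compat; [easy|apply exp_pos]|].
  intros n. eapply Rle_trans; [apply B|]. apply Rmult_le_compat_l; [lra|]. apply exp_le_mono.
  apply Rmult_le_compat_l; [easy|]. apply rsum_geom_le. lra.
Qed.

Lemma en_series_cv q x w : (0 < q < 1)%R -> (Cmod w < 1)%R -> exists l, cv (csum (fun n => en q n x * w ^ n)) l.
Proof.
  intros Hq Hw. destruct (en_bounded q x Hq) as [M [HM B]]. apply summable_cv.
  apply summable_geom with M (Cmod w); [split; [apply Cmod_ge_0|easy]|]. now apply geom_term_bound.
Qed.

(** By [psi_expansion] the defining series is the Cauchy product of the sum of [en q n x * w ^ n]
    with [binF q (q ^ 2) (w ^ 2)], and [q_binomial] shows that the prefactor cancels the second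
    factor. *)
Theorem qE_series q x w : (0 < q < 1)%R -> (Cmod w < 1)%R ->
  cv (csum (fun n => en q n x * w ^ n)) (qE q x w).
Proof.
  intros Hq Hw. assert (Pw := Cmod_ge_0 w).
  destruct (en_series_cv q x w Hq Hw) as [l Hl]. replace (qE q x w) with l; [easy|].
  unfold qE. destruct (Rlt_dec (Cmod w) 1) as [_|]; [|lra].
  assert (Hp : (0 < q ^ 2 < 1)%R) by (simpl; nra).
  assert (Hw2 : (Cmod (w ^ 2) < 1)%R) by (rewrite Cmod_pow; simpl; nra).
  destruct (en_bounded q x Hq) as [M [HM B]].
  assert (U : cv (csum (fun n => psi q n 0 * w ^ n)) (binF q (q ^ 2) (w ^ 2))).
  { rewrite <- (Cplus_0_r (binF _ _ _)). apply cv_interleave.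
    - apply cv_ext_from with 0%nat (csum (fun k => bin_coef q (q ^ 2) k * (w ^ 2) ^ k)).
      + intros n _. apply csum_ext. intros k _. now rewrite psi_even_at_0, Cpow_mult_r.
      + apply binF_cv; auto. lra.
    - apply cv_ext_from with 0%nat (fun _ => RtoC 0); [|apply cv_const].
      intros n _. symmetry. apply csum_zero. intros k _. rewrite psi_odd_at_0 by easy. ring. }
  assert (HS : cv (csum (fun m => psi q m x * w ^ m)) (l * binF q (q ^ 2) (w ^ 2))).
  { apply cv_ext_from with 0%nat (csum (fun m => csum (fun k => (en q k x * w ^ k) * (psi q (m - k) 0 * w ^ (m - k))) (S m))).
    - intros n _. apply csum_ext. intros m _. rewrite (psi_expansion q m x Hq).
      rewrite Cmult_comm, <- csum_scal. apply csum_ext. intros k Hk.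
      replace (w ^ m) with (w ^ k * w ^ (m - k)) by (rewrite <- Cpow_add_r; f_equal; lia). ring.
    - apply (cauchy_product (fun n => en q n x * w ^ n) (fun n => psi q n 0 * w ^ n) _ _ M 1%R (Cmod w)); auto; try lra.
      + now apply geom_term_bound.
      + apply geom_term_bound. intros. now apply psi_at_0_bound. }
  unfold qE_disc.
  match goal with |- _ = _ * Cseries ?f => assert (E : Cseries f = l * binF q (q ^ 2) (w ^ 2)) end.
  { match goal with |- Cseries ?f = _ => assert (H : cv (csum f) (l * binF q (q ^ 2) (w ^ 2))) end.
    { apply cv_ext_from with 0%nat (csum (fun m => psi q m x * w ^ m)); [|easy].
      intros n _. apply csum_ext. intros m _. unfold psi, phiz. rewrite Cpow_mult_l. unfold Cdiv. ring. }
    unfold Cseries, the_C. eapply cv_unique; [|exact H]. apply is_series_cv. apply epsilon_spec.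
    exists (l * binF q (q ^ 2) (w ^ 2)). now apply is_series_cv. }
  rewrite E.
  assert (Q := q_binomial q (q ^ 2) (w ^ 2) ltac:(lra) Hp Hw2).
  destruct (qpoch_inf_spec (w ^ 2) (q ^ 2) Hp Hw2) as [_ N1].
  assert (Hqw : (Cmod (RtoC q * w ^ 2) < 1)%R).
  { rewrite Cmod_pmult by easy. nra. }
  destruct (qpoch_inf_spec (RtoC q * w ^ 2) (q ^ 2) Hp Hqw) as [_ N2].
  rewrite <- Q in N2 |- *.
  assert (N3 : binF q (q ^ 2) (w ^ 2) <> 0). { intros C. apply N2. rewrite C. ring. }
  field. auto.
Qed.

(** * Generating functions *)

Lemma is_pseries_cv a w l :
  is_pseries (K := C_AbsRing) (V := C_NormedModule) a w l <-> cv (csum (fun n => a n * w ^ n)) l.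
Proof.
  unfold is_pseries. rewrite is_series_cv.
  assert (E : forall n, @scal C_Ring C_NormedModule (pow_n w n) (a n) = a n * w ^ n).
  { intros n. apply Cmult_comm. }
  split; apply cv_ext_from with 0%nat; intros n _; apply csum_ext; intros k _; auto.
Qed.

(** Only a punctured disc is assumed, since the generating functions are not meaningful at 0. Once
    the lower coefficients vanish, the next one is bounded by the terms after it, which are small
    near 0. *)
Lemma pseries_zero (c : nat -> C) r : (0 < r)%R ->
  (forall w : C, w <> 0 -> (Cmod w < r)%R -> cv (csum (fun n => c n * w ^ n)) 0) -> forall n, c n = 0.
Proof.
  intros Hr H. set (r0 := (r / 2)%R). assert (Hr0 : (0 < r0)%R) by (unfold r0; lra).
  assert (exists M, (0 < M)%R /\ forall k, (Cmod (c k) * r0 ^ k <= M)%R) as [M [HM B]].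
  { assert (K := H (RtoC r0)). destruct (cv_bounded (csum (fun n => c n * RtoC r0 ^ n)) 0) as [M [HM B]].
    { apply K.
      - intros C. apply RtoC_inj in C. lra.
      - rewrite Cmod_RtoC_pos; unfold r0; lra. }
    exists (2 * M)%R. split; [lra|]. intros k.
    replace (Cmod (c k) * r0 ^ k)%R with (Cmod (c k * RtoC r0 ^ k)).
    2: { rewrite Cmod_mult, Cmod_pow, Cmod_RtoC_pos; lra. }
    replace (c k * RtoC r0 ^ k) with (csum (fun n => c n * RtoC r0 ^ n) (S k) - csum (fun n => c n * RtoC r0 ^ n) k)
      by (simpl; ring).
    eapply Rle_trans; [apply Cmod_sub_le|]. assert (B1 := B (S k)). assert (B2 := B k). lra. }
  intros n. induction n as [n IH] using lt_wf_ind.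
  apply Cmod_small_eq0. intros e He.
  assert (Hp : (0 < r0 ^ n)%R) by now apply pow_lt.
  (* [t <= 1 / 2] gives [1 / (1 - t) <= 2], and the other bound makes [2 * M * t] at most
     [e * r0 ^ n]. *)
  set (t := Rmin (1 / 2) (e * r0 ^ n / (2 * M))).
  assert (Ht : (0 < t)%R).
  { apply Rmin_pos; [lra|]. apply Rdiv_lt_0_compat; [now apply Rmult_lt_0_compat|lra]. }
  assert (T1 : (t <= 1 / 2)%R) by apply Rmin_l. assert (T2 : (t <= e * r0 ^ n / (2 * M))%R) by apply Rmin_r.
  set (w := RtoC (t * r0)). assert (Hw : Cmod w = (t * r0)%R) by (unfold w; apply Cmod_RtoC_pos; nra).
  assert (K : cv (csum (fun n => c n * w ^ n)) 0).
  { apply H.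
    - apply Cmod_gt_0. rewrite Hw. nra.
    - rewrite Hw. unfold r0 in *. nra. }
  assert (Bk : forall k, (Cmod (c k * w ^ k) <= M * t ^ k)%R).
  { intros k. rewrite Cmod_mult, Cmod_pow, Hw, Rpow_mult_distr.
    assert (0 <= t ^ k)%R by (apply pow_le; lra). specialize (B k). nra. }
  assert (D : (Cmod (c n * w ^ n) <= M * (t ^ S n * / (1 - t)))%R).
  { replace (c n * w ^ n) with (- (0 - c n * w ^ n)) by ring. rewrite Cmod_opp.
    apply cv_le_bound with (fun m => csum (fun n => c n * w ^ n) (S n + m) - c n * w ^ n).
    - apply cv_minus; [|apply cv_const]. apply (cv_subseq (fun m => (S n + m)%nat)); [lia|easy].
    - intros m. rewrite csum_add. simpl (csum _ (S n)).
      rewrite (csum_zero _ n) by (intros k Hk; rewrite (IH k Hk); ring).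
      match goal with |- (Cmod ?x <= _)%R =>
        replace x with (csum (fun k => c (S n + k)%nat * w ^ (S n + k)) m) by ring end.
      eapply Rle_trans; [apply Cmod_csum|].
      apply Rle_trans with (rsum (fun k => M * t ^ S n * t ^ k)%R m).
      + apply rsum_le. intros k _. rewrite Rmult_assoc, <- pow_add. apply Bk.
      + rewrite rsum_scal, <- Rmult_assoc. apply Rmult_le_compat_l.
        * apply Rmult_le_pos; [lra|apply pow_le; lra].
        * apply rsum_geom_le. lra. }
  rewrite Cmod_mult, Cmod_pow, Hw, Rpow_mult_distr in D.
  assert (Htn : (0 < t ^ n)%R) by now apply pow_lt.
  assert (D2 : (Cmod (c n) * r0 ^ n <= M * (t * / (1 - t)))%R).
  { apply Rmult_le_reg_r with (t ^ n)%R; [easy|].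
    replace (Cmod (c n) * r0 ^ n * t ^ n)%R with (Cmod (c n) * (t ^ n * r0 ^ n))%R by ring.
    eapply Rle_trans; [exact D|]. simpl. right. ring. }
  assert (I : (/ (1 - t) <= 2)%R).
  { replace 2%R with (/ (1 / 2))%R by field. apply Rinv_le_contravar; lra. }
  apply Rmult_le_reg_r with (r0 ^ n)%R; [easy|].
  eapply Rle_trans; [exact D2|].
  apply Rle_trans with (M * (t * 2))%R; [apply Rmult_le_compat_l; [lra|apply Rmult_le_compat_l; lra]|].
  apply Rle_trans with (2 * M * (e * r0 ^ n / (2 * M)))%R.
  - replace (M * (t * 2))%R with (2 * M * t)%R by ring. apply Rmult_le_compat_l; lra.
  - right. field. lra.
Qed.

Lemma gen_coef_eq G b : generated_by G b -> forall n, gen_coef G n = b n.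
Proof.
  intros Hb. assert (Hg : generated_by G (gen_coef G)).
  { unfold gen_coef. apply epsilon_spec. now exists b. }
  destruct Hb as [r1 [Hr1 H1]]. destruct Hg as [r2 [Hr2 H2]].
  intros n. apply Ceq_minus. revert n.
  apply (pseries_zero _ (Rmin r1 r2)); [now apply Rmin_pos|].
  intros w Hw Hwr. assert (M1 := Rmin_l r1 r2). assert (M2 := Rmin_r r1 r2).
  specialize (H1 w Hw ltac:(lra)). specialize (H2 w Hw ltac:(lra)).
  apply is_pseries_cv in H1. apply is_pseries_cv in H2.
  replace (RtoC 0) with (G w - G w) by ring.
  apply cv_ext_from with 0%nat (fun n => csum (fun k => gen_coef G k * w ^ k) n - csum (fun k => b k * w ^ k) n).
  - intros n _. rewrite <- csum_minus. apply csum_ext. intros; ring.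
  - now apply cv_minus.
Qed.

(** * Division of power series *)

Lemma deconv_exists (a e : nat -> C) : a 0%nat <> 0 ->
  exists B : nat -> C, forall n, csum (fun k => B k * a (n - k)%nat) (S n) = e n.
Proof.
  intros Ha.
  (* Course-of-values recursion: [F n] is a function that carries the first [n] coefficients and is
     0 beyond them. *)
  set (F := nat_rect (fun _ => nat -> C) (fun _ => RtoC 0)
    (fun n g k => if Nat.eq_dec k n then (e n - csum (fun j => g j * a (n - j)%nat) n) / a 0%nat else g k)).
  assert (FS : forall n k, F (S n) k = if Nat.eq_dec k n then (e n - csum (fun j => F n j * a (n - j)%nat) n) / a 0%nat else F n k) by reflexivity.
  assert (Fst : forall k m, F (S k + m)%nat k = F (S k) k).
  { intros k m. induction m; [now rewrite Nat.add_0_r|].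
    rewrite Nat.add_succ_r, FS. destruct (Nat.eq_dec k (S k + m)); [lia|easy]. }
  exists (fun n => F (S n) n). intros n. cbn [csum]. rewrite Nat.sub_diag, (FS n n).
  destruct (Nat.eq_dec n n) as [_|]; [|easy].
  rewrite (csum_ext (fun k => F (S k) k * a (n - k)%nat) (fun j => F n j * a (n - j)%nat)).
  - field. easy.
  - intros k Hk. f_equal. rewrite <- (Fst k (n - S k)%nat). f_equal. lia.
Qed.

(** Strong induction: the recursion bounds [|B n| |a 0| r^n] by [E + M |a 0| / 2], which closes for
    [M = 2 E / |a 0|]. This gives the quotient a bound on the disc without locating zeros of the
    denominator. *)
Lemma deconv_bound (a e B : nat -> C) r E : (0 < r)%R -> a 0%nat <> 0 ->
  (forall n, csum (fun k => B k * a (n - k)%nat) (S n) = e n) ->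
  (forall n, (Cmod (e n) * r ^ n <= E)%R) ->
  (forall n, (rsum (fun j => Cmod (a (S j)) * r ^ S j) n <= Cmod (a 0%nat) / 2)%R) ->
  forall n, (Cmod (B n) * r ^ n <= 2 * E / Cmod (a 0%nat))%R.
Proof.
  intros Hr Ha HB HE Hs. assert (Pa := proj1 (Cmod_gt_0 _) Ha). set (A := Cmod (a 0%nat)) in *.
  set (M := (2 * E / A)%R).
  assert (HE0 : (0 <= E)%R). { specialize (HE 0%nat). simpl in HE. assert (P := Cmod_ge_0 (e 0%nat)). lra. }
  assert (HM : (0 <= M)%R). { unfold M. apply Rmult_le_pos; [lra|]. now apply Rlt_le, Rinv_0_lt_compat. }
  intros n. induction n as [n IH] using lt_wf_ind.
  assert (Hn := HB n). cbn [csum] in Hn. rewrite Nat.sub_diag in Hn.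
  assert (Eq : B n * a 0%nat = e n - csum (fun k => B k * a (n - k)%nat) n) by (rewrite <- Hn; ring).
  assert (Hrn : (0 < r ^ n)%R) by now apply pow_lt.
  apply Rmult_le_reg_r with A; [easy|].
  replace (Cmod (B n) * r ^ n * A)%R with (Cmod (B n * a 0%nat) * r ^ n)%R by (rewrite Cmod_mult; unfold A; ring).
  rewrite Eq.
  apply Rle_trans with ((Cmod (e n) + Cmod (csum (fun k => B k * a (n - k)%nat)%C n)) * r ^ n)%R.
  { apply Rmult_le_compat_r; [lra|]. apply Cmod_sub_le. }
  rewrite Rmult_plus_distr_r.
  assert (K : (Cmod (csum (fun k => B k * a (n - k)%nat)%C n) * r ^ n <= M * (A / 2))%R).
  { eapply Rle_trans; [apply Rmult_le_compat_r; [lra|apply Cmod_csum]|].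
    rewrite Rmult_comm, <- rsum_scal.
    apply Rle_trans with (rsum (fun k => M * (Cmod (a (n - k)%nat) * r ^ (n - k)))%R n).
    - apply rsum_le. intros k Hk. rewrite Cmod_mult.
      replace (r ^ n)%R with (r ^ k * r ^ (n - k))%R by (rewrite <- pow_add; f_equal; lia).
      specialize (IH k Hk). assert (0 <= Cmod (a (n - k)%nat) * r ^ (n - k))%R.
      { apply Rmult_le_pos; [apply Cmod_ge_0|apply pow_le; lra]. }
      replace (r ^ k * r ^ (n - k) * (Cmod (B k) * Cmod (a (n - k)%nat)))%R
        with (Cmod (B k) * r ^ k * (Cmod (a (n - k)%nat) * r ^ (n - k)))%R by ring.
      now apply Rmult_le_compat_r.
    - rewrite rsum_scal. apply Rmult_le_compat_l; [easy|].
      eapply Rle_trans; [|apply (Hs n)]. right.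
      rewrite <- (rsum_rev (fun j => Cmod (a (S j)) * r ^ S j)%R n). apply rsum_ext. intros k Hk.
      replace (S (n - 1 - k)) with (n - k)%nat by lia. reflexivity. }
  assert (T2 : (M * A = 2 * E)%R) by (unfold M; field; lra).
  specialize (HE n). lra.
Qed.

(** * The values of the basis at [eta] *)

Lemma eta_node q n : (0 < q < 1)%R ->
  4 * (eta q ^ 2 - RtoC (node q n)) = RtoC (Rpower q (1 / 2) + / Rpower q (1 / 2) + q ^ n + / q ^ n).
Proof.
  intros Hq. unfold eta.
  replace (RtoC ((Rpower q (1 / 4) + Rpower q (- (1 / 4))) / 2) ^ 2)
    with (RtoC (((Rpower q (1 / 4) + Rpower q (- (1 / 4))) / 2) * ((Rpower q (1 / 4) + Rpower q (- (1 / 4))) / 2)))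
    by (rewrite RtoC_mult; ring).
  rewrite <- RtoC_minus, <- RtoC_mult. f_equal. unfold node.
  rewrite Rpower_Ropp. assert (H : (0 < Rpower q (1 / 4))%R) by apply exp_pos.
  replace (Rpower q (1 / 2)) with (Rpower q (1 / 4) * Rpower q (1 / 4))%R.
  - field. split; [apply pow_nonzero; lra|lra].
  - rewrite <- Rpower_plus. f_equal. field.
Qed.

(** Let [y = q^n]. The numerator [q y (s + 1/s + y + 1/y)], [s = q^(1/2)], is at most [4 q], as each
    of the four terms is at most [q]. The denominator is at least
    [(1 - q^2)(1 - q^3) >= 3 q (1 - q)^2]. The condition [n >= 1] provides [y <= q]. *)
Lemma en_eta_ratio q n : (0 < q < 1)%R -> (1 <= n)%nat ->
  (Cmod (en q (S (S n)) (eta q)) * ((1 - q) / 2) ^ 2 <= Cmod (en q n (eta q)) * / 3)%R.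
Proof.
  intros Hq Hn. rewrite en_step, eta_node by easy.
  set (s := Rpower q (1 / 2)). assert (Hs : (0 < s)%R) by apply exp_pos.
  assert (Hss : (s * s = q)%R).
  { unfold s. rewrite <- Rpower_plus. replace (1 / 2 + 1 / 2)%R with 1%R by field. apply Rpower_1. lra. }
  assert (Hs1 : (s < 1)%R) by nra.
  destruct n as [|n]; [lia|]. set (y := (q ^ S n)%R).
  destruct (pow_le_base q n Hq) as [Hy _]. fold y in Hy.
  replace (q ^ S (S n))%R with (q * y)%R by reflexivity.
  replace (q ^ S (S (S n)))%R with (q * (q * y))%R by reflexivity.
  assert (D1 : ((1 - q) * (1 + q) <= 1 - q * y)%R) by nra.
  assert (D2 : ((1 - q) * (1 + q + q * q) <= 1 - q * (q * y))%R).
  { nra. }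
  assert (P1 : (0 < (1 - q) * (1 + q))%R) by nra.
  assert (P2 : (0 < (1 - q) * (1 + q + q * q))%R) by nra.
  assert (P3 : (0 < / s)%R) by now apply Rinv_0_lt_compat.
  assert (P4 : (0 < / y)%R) by (apply Rinv_0_lt_compat; lra).
  rewrite <- !RtoC_minus, <- !RtoC_mult, <- RtoC_div, Cmod_mult by nra.
  rewrite Rmult_assoc. apply Rmult_le_compat_l; [apply Cmod_ge_0|].
  assert (N0 : (q * y * (s + / s + y + / y) <= 4 * q)%R).
  { assert (y * / s <= s)%R.
    { apply Rmult_le_reg_r with s; [easy|]. rewrite Rmult_assoc, Rinv_l, Hss; lra. }
    replace (q * y * (s + / s + y + / y))%R with (q * (y * s + y * / s + y * y + y * / y))%R by ring.
    rewrite Rinv_r by lra. assert (y * s <= 1)%R by nra. assert (y * y <= 1)%R by nra.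
    replace (4 * q)%R with (q * 4)%R by ring. apply Rmult_le_compat_l; lra. }
  assert (N1 : (0 <= q * y * (s + / s + y + / y))%R).
  { apply Rmult_le_pos; [nra|]. lra. }
  set (N := (q * y * (s + / s + y + / y))%R) in *.
  set (D := ((1 - q * y) * (1 - q * (q * y)))%R).
  assert (HD : ((1 - q) * (1 - q) * (3 * q) <= D)%R).
  { apply Rle_trans with ((1 - q) * (1 + q) * ((1 - q) * (1 + q + q * q)))%R.
    - assert (3 * q <= (1 + q) * (1 + q + q * q))%R by nra.
      replace ((1 - q) * (1 + q) * ((1 - q) * (1 + q + q * q)))%R with ((1 - q) * (1 - q) * ((1 + q) * (1 + q + q * q)))%R by ring.
      apply Rmult_le_compat_l; [nra|easy].
    - unfold D. apply Rmult_le_compat; lra. }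
  assert (HD0 : (0 < D)%R) by (unfold D; apply Rmult_lt_0_compat; lra).
  rewrite Cmod_RtoC_pos.
  2: { apply Rmult_le_pos; [easy|]. now apply Rlt_le, Rinv_0_lt_compat. }
  apply Rmult_le_reg_r with (3 * D)%R; [lra|].
  replace (N / D * ((1 - q) / 2) ^ 2 * (3 * D))%R with (N * (3 * ((1 - q) * (1 - q)) / 4))%R by (field; lra).
  replace (/ 3 * (3 * D))%R with D by field.
  eapply Rle_trans; [|exact HD].
  apply Rle_trans with (4 * q * (3 * ((1 - q) * (1 - q)) / 4))%R.
  - apply Rmult_le_compat_r; [nra|easy].
  - right. field.
Qed.

Lemma en_eta_1_neq0 q : (0 < q < 1)%R -> en q 1 (eta q) <> 0.
Proof.
  intros Hq. unfold en. rewrite rho_1 by lra.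
  assert (H1 := qpoch_q_neq0 q 1 Hq).
  assert (H2 : eta q <> 0).
  { unfold eta. intros C. apply RtoC_inj in C.
    assert (A := exp_pos (1 / 4 * ln q)). assert (B := exp_pos (- (1 / 4) * ln q)). unfold Rpower in C. lra. }
  apply Cmult_neq_0.
  - unfold Cdiv. apply Cmult_neq_0; [apply Rpower_C_neq0|].
    intros C. apply C1_nz. replace (RtoC 1) with (qpoch (RtoC q) q 1 * / qpoch (RtoC q) q 1) by (now field).
    rewrite C. ring.
  - apply Cmult_neq_0; [apply C2_neq0|easy].
Qed.

(** Coefficients of [(qE q eta w - qE q eta (- w)) / w]. *)
Definition eta_odd (q : R) (j : nat) : C := if Nat.even j then 2 * en q (S j) (eta q) else 0.

Lemma eta_odd_0 q : (0 < q < 1)%R -> eta_odd q 0 <> 0.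
Proof. intros Hq. apply Cmult_neq_0; [apply C2_neq0|now apply en_eta_1_neq0]. Qed.

Lemma eta_odd_even_bound q i : (0 < q < 1)%R ->
  (Cmod (eta_odd q (2 * i)) * ((1 - q) / 2) ^ (2 * i) <= Cmod (eta_odd q 0) * (/ 3) ^ i)%R.
Proof.
  intros Hq. assert (E : forall i, eta_odd q (2 * i) = 2 * en q (S (2 * i)) (eta q)).
  { intros j. unfold eta_odd. now rewrite Nat.even_mul. }
  induction i; [simpl; lra|].
  rewrite E in *. replace (2 * S i)%nat with (S (S (2 * i))) by lia.
  assert (H := en_eta_ratio q (S (2 * i)) Hq ltac:(lia)).
  rewrite Cmod_mult in *. set (r := ((1 - q) / 2)%R) in *.
  assert (Hr : (0 <= r ^ (2 * i))%R) by (apply pow_le; unfold r; lra).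
  assert (P2 := Cmod_ge_0 2).
  replace (Cmod 2 * Cmod (en q (S (S (S (2 * i)))) (eta q)) * r ^ S (S (2 * i)))%R
    with (Cmod 2 * r ^ (2 * i) * (Cmod (en q (S (S (S (2 * i)))) (eta q)) * r ^ 2))%R by (simpl; ring).
  eapply Rle_trans; [apply Rmult_le_compat_l; [now apply Rmult_le_pos|exact H]|].
  simpl ((/ 3) ^ S i)%R.
  replace (Cmod (eta_odd q 0) * (/ 3 * (/ 3) ^ i))%R with (Cmod (eta_odd q 0) * (/ 3) ^ i * / 3)%R by ring.
  rewrite <- Rmult_assoc. apply Rmult_le_compat_r; lra.
Qed.

(** Only even indices contribute and [1/3 + 1/9 + ... = 1/2]: the ratio of [en_eta_ratio] yields
    exactly the smallness that [deconv_bound] asks for. *)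
Lemma eta_odd_tail q n : (0 < q < 1)%R ->
  (rsum (fun j => Cmod (eta_odd q (S j)) * ((1 - q) / 2) ^ S j) n <= Cmod (eta_odd q 0) / 2)%R.
Proof.
  intros Hq. set (r := ((1 - q) / 2)%R).
  assert (Hr : (0 <= r)%R) by (unfold r; lra).
  (* Adding nonnegative terms up to [2 * n] lets them be treated in pairs, one of each parity. *)
  apply Rle_trans with (rsum (fun j => Cmod (eta_odd q (S j)) * r ^ S j)%R (2 * n)).
  { apply rsum_mono; [|lia]. intros k. apply Rmult_le_pos; [apply Cmod_ge_0|now apply pow_le]. }
  assert (P := Cmod_ge_0 (eta_odd q 0)).
  enough (H : (rsum (fun j => Cmod (eta_odd q (S j)) * r ^ S j)%R (2 * n) <= Cmod (eta_odd q 0) / 2 * (1 - (/ 3) ^ n))%R).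
  { eapply Rle_trans; [exact H|]. assert (0 <= (/ 3) ^ n)%R by (apply pow_le; lra).
    rewrite <- (Rmult_1_r (_ / 2)) at 2. apply Rmult_le_compat_l; lra. }
  induction n; [simpl; lra|].
  replace (2 * S n)%nat with (S (S (2 * n))) by lia. cbn [rsum].
  assert (E : eta_odd q (S (2 * n)) = 0).
  { unfold eta_odd. rewrite Nat.even_succ. replace (2 * n)%nat with (n * 2)%nat by lia.
    now rewrite Nat.odd_mul, Bool.andb_false_r. }
  rewrite E, Cmod_0.
  assert (B := eta_odd_even_bound q (S n) Hq). fold r in B.
  replace (2 * S n)%nat with (S (S (2 * n))) in B by lia.
  simpl ((/ 3) ^ S n)%R in *. lra.
Qed.

Lemma eta_odd_bound q j : (0 < q < 1)%R ->
  (Cmod (eta_odd q j) * ((1 - q) / 2) ^ j <= Cmod (eta_odd q 0))%R.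
Proof.
  intros Hq. assert (P := Cmod_ge_0 (eta_odd q 0)). destruct j; [simpl; lra|].
  assert (H := eta_odd_tail q (S j) Hq).
  assert (T := rsum_term (fun j => Cmod (eta_odd q (S j)) * ((1 - q) / 2) ^ S j)%R (S j) j). cbv beta in T.
  assert (Cmod (eta_odd q (S j)) * ((1 - q) / 2) ^ S j <= rsum (fun j => Cmod (eta_odd q (S j)) * ((1 - q) / 2) ^ S j)%R (S j))%R.
  { apply T; [|lia]. intros k. apply Rmult_le_pos; [apply Cmod_ge_0|apply pow_le; lra]. }
  lra.
Qed.

Lemma scaled_bound (c : nat -> C) M r w : (0 < r)%R -> (forall n, (Cmod (c n) * r ^ n <= M)%R) ->
  forall n, (Cmod (c n * w ^ n) <= M * (Cmod w / r) ^ n)%R.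
Proof.
  intros Hr H n. rewrite Cmod_mult, Cmod_pow. unfold Rdiv. rewrite Rpow_mult_distr, pow_inv.
  specialize (H n). assert (0 < r ^ n)%R by now apply pow_lt.
  assert (0 <= Cmod w ^ n)%R by (apply pow_le, Cmod_ge_0).
  replace (Cmod (c n) * Cmod w ^ n)%R with (Cmod (c n) * r ^ n * (Cmod w ^ n * / r ^ n))%R by (field; lra).
  apply Rmult_le_compat_r; [|easy]. apply Rmult_le_pos; [easy|]. now apply Rlt_le, Rinv_0_lt_compat.
Qed.

Lemma Cpow_opp (w : C) n : (- w) ^ n = if Nat.even n then w ^ n else - w ^ n.
Proof.
  induction n; [easy|]. rewrite Cpow_S, IHn, Nat.even_succ, <- Nat.negb_even.
  destruct (Nat.even n); simpl; ring.
Qed.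

(** The terms after the constant one add up to at most half of its modulus, so the sum cannot
    vanish. *)
Lemma eta_odd_series q w : (0 < q < 1)%R -> (Cmod w < (1 - q) / 2)%R ->
  exists al, cv (csum (fun n => eta_odd q n * w ^ n)) al /\ al <> 0 /\
    w * al = qE q (eta q) w - qE q (eta q) (- w).
Proof.
  intros Hq Hw. set (r := ((1 - q) / 2)%R) in *. assert (Pw := Cmod_ge_0 w).
  assert (Hr : (0 < r < 1)%R) by (unfold r; lra).
  assert (Ht : (0 <= Cmod w / r < 1)%R).
  { split; [apply Rmult_le_pos; [easy|apply Rlt_le, Rinv_0_lt_compat; lra]|].
    apply Rmult_lt_reg_r with r; [lra|]. unfold Rdiv. rewrite Rmult_assoc, Rinv_l; lra. }
  destruct (summable_cv (fun n => eta_odd q n * w ^ n)) as [al Hal].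
  { apply summable_geom with (Cmod (eta_odd q 0)) (Cmod w / r)%R; [easy|].
    apply scaled_bound; [lra|]. intros n. now apply eta_odd_bound. }
  exists al. split; [easy|split].
  - intros C. assert (N := proj1 (Cmod_gt_0 _) (eta_odd_0 q Hq)).
    assert (B : (Cmod (al - eta_odd q 0) <= Cmod (eta_odd q 0) / 2)%R).
    { apply cv_le_bound with (fun n => csum (fun n => eta_odd q n * w ^ n) (S n) - eta_odd q 0).
      - apply cv_minus; [|apply cv_const]. now apply (cv_subseq S); [lia|].
      - intros n. rewrite csum_S_l.
        match goal with |- (Cmod ?x <= _)%R => replace x with (csum (fun k => eta_odd q (S k) * w ^ S k) n) by (simpl; ring) end.
        eapply Rle_trans; [apply Cmod_csum|]. eapply Rle_trans; [|apply (eta_odd_tail q n Hq)].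
        apply rsum_le. intros k _. rewrite Cmod_mult, Cmod_pow. apply Rmult_le_compat_l; [apply Cmod_ge_0|].
        apply pow_incr. fold r. lra. }
    rewrite C in B. replace (0 - eta_odd q 0) with (- eta_odd q 0) in B by ring. rewrite Cmod_opp in B. lra.
  - apply cv_unique with (fun n => w * csum (fun n => eta_odd q n * w ^ n) n); [now apply cv_scal|].
    apply cv_ext_from with 0%nat (fun n => csum (fun k => en q k (eta q) * w ^ k) (S n) - csum (fun k => en q k (eta q) * (- w) ^ k) (S n)).
    + intros n _. rewrite <- csum_minus, csum_S_l, <- csum_scal.
      replace (en q 0 (eta q) * w ^ 0 - en q 0 (eta q) * (- w) ^ 0) with (RtoC 0) by (simpl; ring).
      rewrite Cplus_0_l. apply csum_ext. intros k _. unfold eta_odd.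
      rewrite Cpow_opp, Nat.even_succ, <- Nat.negb_even. destruct (Nat.even k); simpl; ring.
    + apply cv_minus; apply (cv_subseq S); try lia; apply qE_series; try easy; rewrite ?Cmod_opp; lra.
Qed.

(** Coefficients of [qE q eta (- w)]. *)
Definition alt_eta (q : R) (j : nat) : C := if Nat.even j then en q j (eta q) else - en q j (eta q).

(** [B] is obtained by formal division. Its bound makes the series converge for [|w| < (1-q)/2],
    where the Cauchy product identifies the sum with the generating function; multiplying by
    [E_q(eta;-w)] then gives [qbeta]. *)
Theorem qBernoulli_spec q x : (0 < q < 1)%R -> exists (B : nat -> C) (M : R),
  (forall n, csum (fun k => B k * eta_odd q (n - k)) (S n) = en q n x) /\
  (forall n, (Cmod (B n) * ((1 - q) / 2) ^ n <= M)%R) /\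
  (forall n, qBernoulli q n x = B n) /\
  (forall n, qbeta q n x = csum (fun k => B k * alt_eta q (n - k)) (S n)).
Proof.
  intros Hq. set (r := ((1 - q) / 2)%R). assert (Hr : (0 < r < 1)%R) by (unfold r; lra).
  destruct (deconv_exists (eta_odd q) (fun n => en q n x) (eta_odd_0 q Hq)) as [B HB].
  destruct (en_bounded q x Hq) as [E [HE BE]].
  assert (HM := deconv_bound (eta_odd q) (fun n => en q n x) B r E (proj1 Hr) (eta_odd_0 q Hq) HB).
  set (M := (2 * E / Cmod (eta_odd q 0))%R) in HM.
  assert (BM : forall n, (Cmod (B n) * r ^ n <= M)%R).
  { apply HM.
    - intros n. assert (0 <= r ^ n <= 1)%R. { split; [apply pow_le; lra|]. rewrite <- (pow1 n). apply pow_incr. lra. }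
      specialize (BE n). nra.
    - intros n. now apply eta_odd_tail. }
  destruct (en_bounded q (eta q) Hq) as [H [HH BH]].
  assert (Key : forall w : C, w <> 0 -> (Cmod w < r)%R ->
     (0 <= Cmod w / r < 1)%R /\
     cv (csum (fun n => B n * w ^ n)) (w * qE q x w / (qE q (eta q) w - qE q (eta q) (- w)))).
  { intros w Hw0 Hw. assert (Pw := Cmod_ge_0 w).
    assert (Ht : (0 <= Cmod w / r < 1)%R).
    { split; [apply Rmult_le_pos; [easy|apply Rlt_le, Rinv_0_lt_compat; lra]|].
      apply Rmult_lt_reg_r with r; [lra|]. unfold Rdiv. rewrite Rmult_assoc, Rinv_l; lra. }
    split; [easy|].
    destruct (eta_odd_series q w Hq Hw) as [al [Hal [Nal Eal]]].
    destruct (summable_cv (fun n => B n * w ^ n)) as [be Hbe].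
    { apply summable_geom with M (Cmod w / r)%R; [easy|]. apply scaled_bound; [lra|easy]. }
    assert (P : be * al = qE q x w).
    { apply cv_unique with (csum (fun n => en q n x * w ^ n)).
      - apply cv_ext_from with 0%nat (csum (fun m => csum (fun k => (B k * w ^ k) * (eta_odd q (m - k) * w ^ (m - k))) (S m))).
        + intros n _. apply csum_ext. intros m _. rewrite <- HB, Cmult_comm, <- csum_scal.
          apply csum_ext. intros k Hk. replace (w ^ m) with (w ^ k * w ^ (m - k)) by (rewrite <- Cpow_add_r; f_equal; lia). ring.
        + apply (cauchy_product (fun n => B n * w ^ n) (fun n => eta_odd q n * w ^ n) _ _ M (Cmod (eta_odd q 0)) (Cmod w / r)); auto.
          * apply scaled_bound; [lra|easy].
          * apply scaled_bound; [lra|]. intros; now apply eta_odd_bound.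
      - apply qE_series; [easy|lra]. }
    rewrite <- Eal, <- P. replace (w * (be * al) / (w * al)) with be by (field; auto). easy. }
  exists B, M. split; [easy|split; [easy|split]].
  - intros n. apply gen_coef_eq. exists r. split; [easy|]. intros w Hw0 Hw.
    apply is_pseries_cv. now apply Key.
  - intros n. revert n. apply gen_coef_eq. exists r. split; [easy|]. intros w Hw0 Hw.
    apply is_pseries_cv. destruct (Key w Hw0 Hw) as [Ht HBw].
    replace (w * qE q (eta q) (- w) * qE q x w / (qE q (eta q) w - qE q (eta q) (- w)))
      with (w * qE q x w / (qE q (eta q) w - qE q (eta q) (- w)) * qE q (eta q) (- w)) by (unfold Cdiv; ring).
    apply cv_ext_from with 0%nat (csum (fun m => csum (fun k => (B k * w ^ k) * (en q (m - k) (eta q) * (- w) ^ (m - k))) (S m))).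
    + intros n _. apply csum_ext. intros m _. rewrite (Cmult_comm _ (w ^ m)), <- csum_scal.
      apply csum_ext. intros k Hk. replace (w ^ m) with (w ^ k * w ^ (m - k)) by (rewrite <- Cpow_add_r; f_equal; lia).
      unfold alt_eta. rewrite Cpow_opp. destruct (Nat.even (m - k)); ring.
    + apply (cauchy_product (fun n => B n * w ^ n) (fun n => en q n (eta q) * (- w) ^ n) _ _ M H (Cmod w / r)); auto.
      * apply scaled_bound; [lra|easy].
      * rewrite <- (Cmod_opp w). apply scaled_bound; [lra|]. intros n.
        assert (0 <= r ^ n <= 1)%R. { split; [apply pow_le; lra|]. rewrite <- (pow1 n). apply pow_incr. lra. }
        specialize (BH n). nra.
      * apply qE_series; [easy|]. rewrite Cmod_opp. lra.
Qed.

(** * The expansion in q-Bernoulli polynomials *)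

(** Applying [sum w^m -> sum d_m] to the identity
    [E(eta;w) (B(w) - B(-w)) - (beta(w) - beta(-w)) = w E(x;w)] of generating functions. *)
Lemma bernoulli_diagonal q (B : nat -> C) (e : nat -> C) m :
  (forall n, csum (fun k => B k * eta_odd q (n - k)) (S n) = e n) ->
  csum (fun k => if Nat.even k then en q (m - k) (eta q) * B (S k) else 0) (S m)
  - (if Nat.even m then csum (fun k => B k * alt_eta q (S m - k)) (S (S m)) else 0)
  = e m / 2.
Proof.
  (* Every sum is one over the [c k]. For [m] even the left side is the odd part minus (odd part
     minus even part), that is, the even part; for [m] odd it is the odd part. So the [k] of the
     parity of [m] survive, where [eta_odd] is twice a value of [en]. *)
  intros HB. set (c := fun k => B k * en q (S m - k) (eta q)).
  assert (D : csum (fun k => if Nat.even k then en q (m - k) (eta q) * B (S k) else 0) (S m)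
     = csum (fun k => if Nat.odd k then c k else 0) (S (S m))).
  { rewrite (csum_S_l _ (S m)). simpl Nat.odd. cbv iota. rewrite Cplus_0_l.
    apply csum_ext. intros k _. rewrite Nat.odd_succ. unfold c.
    replace (S m - S k)%nat with (m - k)%nat by lia. destruct (Nat.even k); ring. }
  rewrite D, <- HB. clear D.
  destruct (Nat.even m) eqn:Hm.
  - assert (E1 : csum (fun k => B k * eta_odd q (m - k)) (S m)
       = csum (fun k => if Nat.odd k then 0 else 2 * c k) (S (S m))).
    { change (csum (fun k => if Nat.odd k then 0 else 2 * c k) (S (S m)))
        with (csum (fun k => if Nat.odd k then 0 else 2 * c k) (S m) + (if Nat.odd (S m) then 0 else 2 * c (S m))).
      rewrite Nat.odd_succ, Hm, Cplus_0_r. apply csum_ext. intros k Hk. unfold eta_odd, c.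
      rewrite Nat.even_sub, Hm by lia. rewrite <- Nat.negb_even.
      replace (S (m - k)) with (S m - k)%nat by lia. destruct (Nat.even k); simpl; ring. }
    rewrite E1, <- csum_minus. unfold Cdiv. rewrite Cmult_comm, <- csum_scal. apply csum_ext. intros k Hk.
    unfold alt_eta, c. rewrite Nat.even_sub, Nat.even_succ by lia.
    rewrite <- !Nat.negb_even, Hm. destruct (Nat.even k); simpl; field.
  - assert (E1 : csum (fun k => B k * eta_odd q (m - k)) (S m)
       = csum (fun k => if Nat.odd k then 2 * c k else 0) (S (S m))).
    { change (csum (fun k => if Nat.odd k then 2 * c k else 0) (S (S m)))
        with (csum (fun k => if Nat.odd k then 2 * c k else 0) (S m) + (if Nat.odd (S m) then 2 * c (S m) else 0)).
      rewrite Nat.odd_succ, Hm, Cplus_0_r. apply csum_ext. intros k Hk. unfold eta_odd, c.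
      rewrite Nat.even_sub, Hm by lia. rewrite <- Nat.negb_even.
      replace (S (m - k)) with (S m - k)%nat by lia. destruct (Nat.even k); simpl; ring. }
    rewrite E1. unfold Cdiv. rewrite (Cmult_comm _ (/ 2)), <- csum_scal.
    replace (csum (fun k => if Nat.odd k then c k else 0) (S (S m)) - 0) with (csum (fun k => if Nat.odd k then c k else 0) (S (S m))) by ring.
    apply csum_ext. intros k _. destruct (Nat.odd k); field.
Qed.

(** Along the lattice through [z = q^(1/4)] the operator [D_q^k] kills the first [k] terms and
    shifts the others. *)
Lemma AW_iter_eta q f k : (0 < q < 1)%R ->
  (forall x, cv (csum (fun n => dcoef q f n * en q n x)) (f x)) ->
  cv (csum (fun j => dcoef q f (k + j) * en q j (eta q))) (/ RtoC (gamma q) ^ k * AW_iter q k f (eta q)).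
Proof.
  intros Hq Hf. destruct (cosz_eta q) as [z [Hz He]].
  assert (Ad := lattice_eta_admissible q Hq). assert (Ng := gamma_C_neq0 q Hq).
  assert (A := AW_iter_series q (lattice_eta q) (dcoef q f) (en q) f Hq Ad (fun z _ => Hf (cosz z)) k z Hz).
  rewrite He in A.
  assert (A' := cv_scal (/ RtoC (gamma q) ^ k) _ _ A).
  apply (cv_subseq (fun n => (k + n)%nat)) in A'; [|lia].
  refine (cv_ext_from 0 _ _ _ _ A'). intros n _. rewrite csum_add.
  rewrite csum_zero.
  - rewrite Cplus_0_l, <- csum_scal. apply csum_ext. intros j _. rewrite <- He.
    rewrite (AW_iter_lowered q (lattice_eta q)); auto using en_lowered.
    destruct (le_dec k (k + j)); [|lia]. replace (k + j - k)%nat with j by lia.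
    field. now apply Cpow_nz.
  - intros j Hj. rewrite <- He. rewrite (AW_iter_lowered q (lattice_eta q)); auto using en_lowered.
    destruct (le_dec k j); [lia|ring].
Qed.

Lemma dcoef_geometric q f tau : (0 < q < 1)%R -> (0 < tau < 1)%R ->
  LimSup_seq (fun n => nroot n (Cmod (AW_iter q n f 0) * Rpower q (- INR n / 4))) = Finite tau ->
  exists th K, (0 < th < 1)%R /\ forall n, (Cmod (dcoef q f n) <= K * (th * ((1 - q) / 2)) ^ n)%R.
Proof.
  (* The midpoint of [tau] and 1 leaves room for the epsilon of the limsup. The radius [r] enters
     through [gamma^(-n) = r^n q^(-n/4)]. *)
  intros Hq Ht HL. set (th := ((1 + tau) / 2)%R). set (r := ((1 - q) / 2)%R).
  assert (Hth : (0 < th < 1)%R) by (unfold th; lra).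
  assert (Hr : (0 < th * r)%R) by (apply Rmult_lt_0_compat; [lra|unfold r; lra]).
  set (a := fun n => nroot n (Cmod (AW_iter q n f 0) * Rpower q (- INR n / 4))) in HL.
  assert (HS : is_LimSup_seq a (LimSup_seq a)) by (unfold LimSup_seq; apply proj2_sig).
  rewrite HL in HS.
  assert (He : (0 < (1 - tau) / 2)%R) by lra.
  destruct (HS (mkposreal _ He)) as [_ [N HN]]. simpl in HN.
  (* [N + 1] keeps [n] positive, so that the [n]-th root can be undone. *)
  assert (E : forall n, (N + 1 <= n)%nat -> (Cmod (dcoef q f n) <= (th * r) ^ n)%R).
  { intros n Hn. specialize (HN n ltac:(lia)).
    replace (tau + (1 - tau) / 2)%R with th in HN by (unfold th; field).
    set (D := Cmod (AW_iter q n f 0)) in *. assert (PD := Cmod_ge_0 (AW_iter q n f 0)). fold D in PD.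
    assert (B : (D * Rpower q (- INR n / 4) <= th ^ n)%R).
    { unfold a, nroot in HN. fold D in HN. destruct (Rle_dec (D * Rpower q (- INR n / 4)) 0) as [L|L].
      - eapply Rle_trans; [exact L|]. apply pow_le. lra.
      - apply Rnot_le_lt in L. set (y := (D * Rpower q (- INR n / 4))%R) in *.
        assert (In : (INR n <> 0)%R) by (apply not_0_INR; lia).
        replace y with (Rpower y (/ INR n) ^ n)%R.
        + apply pow_incr. split; [apply Rlt_le, exp_pos|now apply Rlt_le].
        + rewrite <- Rpower_pow, Rpower_mult, Rinv_l, Rpower_1 by (easy || apply exp_pos). easy. }
    unfold dcoef. assert (Pg := gamma_pos q Hq).
    rewrite Cmod_mult, Cmod_inv, Cmod_pow, Cmod_RtoC_pos by (try lra; apply Cpow_nz; now apply gamma_C_neq0).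
    fold D.
    assert (P4 : (0 < Rpower q (1 / 4))%R) by apply exp_pos.
    assert (Eg : (/ gamma q ^ n = r ^ n * Rpower q (- INR n / 4))%R).
    { unfold gamma. rewrite <- pow_inv.
      replace (/ (2 * Rpower q (1 / 4) / (1 - q)))%R with (r * / Rpower q (1 / 4))%R by (unfold r; field; lra).
      rewrite Rpow_mult_distr. f_equal. rewrite pow_inv, <- Rpower_pow, Rpower_mult, <- Rpower_Ropp by easy.
      f_equal. field. }
    rewrite Eg, Rpow_mult_distr.
    replace (r ^ n * Rpower q (- INR n / 4) * D)%R with (D * Rpower q (- INR n / 4) * r ^ n)%R by ring.
    apply Rmult_le_compat_r; [apply pow_le; unfold r; lra|easy]. }
  (* The 1 serves the large indices, the sum serves the finitely many initial ones. *)
  exists th, (1 + rsum (fun k => Cmod (dcoef q f k) / (th * r) ^ k)%R (N + 1))%R.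
  split; [easy|]. intros n.
  assert (Pn : (0 < (th * r) ^ n)%R) by now apply pow_lt.
  assert (Pos : forall k, (0 <= Cmod (dcoef q f k) / (th * r) ^ k)%R).
  { intros k. apply Rmult_le_pos; [apply Cmod_ge_0|]. apply Rlt_le, Rinv_0_lt_compat. now apply pow_lt. }
  destruct (le_lt_dec (N + 1) n) as [L|L].
  - specialize (E n L). assert (T := rsum_pos (fun k => Cmod (dcoef q f k) / (th * r) ^ k)%R (N + 1) (fun k _ => Pos k)).
    nra.
  - assert (T := rsum_term (fun k => Cmod (dcoef q f k) / (th * r) ^ k)%R (N + 1) n Pos L). cbv beta in T.
    replace (Cmod (dcoef q f n)) with (Cmod (dcoef q f n) / (th * r) ^ n * (th * r) ^ n)%R at 1 by (field; lra).
    apply Rmult_le_compat_r; lra.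
Qed.

Theorem bernoulli_expansion q f th K x : (0 < q < 1)%R -> (0 < th < 1)%R ->
  (forall x, cv (csum (fun n => dcoef q f n * en q n x)) (f x)) ->
  (forall n, (Cmod (dcoef q f n) <= K * (th * ((1 - q) / 2)) ^ n)%R) ->
  exists s t,
    cv (csum (fun k => / RtoC (gamma q) ^ (2 * k) * AW_iter q (2 * k) f (eta q) * qBernoulli q (2 * k + 1) x)) s /\
    cv (csum (fun k => / RtoC (gamma q) ^ (2 * k) * AW_iter q (2 * k) f 0 * qbeta q (2 * k + 1) x)) t /\
    f x = 2 * s - 2 * t.
Proof.
  intros Hq Hth Hf Hd. set (r := ((1 - q) / 2)%R) in *. assert (Hr : (0 < r < 1)%R) by (unfold r; lra).
  destruct (qBernoulli_spec q x Hq) as [B [M [HB [HM [EB Ebeta]]]]]. fold r in HM.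
  destruct (en_bounded q (eta q) Hq) as [H [HH BH]].
  set (d := dcoef q f) in *.
  (* Row [k] sums to a term of the first series by [AW_iter_eta]; column [m] is evaluated by
     [bernoulli_diagonal]. *)
  set (u := fun k m => if Nat.even k then d m * (en q (m - k) (eta q) * B (S k)) else 0).
  assert (HM0 : (0 <= M)%R). { specialize (HM 0%nat). simpl in HM. assert (P := Cmod_ge_0 (B 0%nat)). lra. }
  assert (HK0 : (0 <= K)%R). { specialize (Hd 0%nat). simpl in Hd. assert (P := Cmod_ge_0 (d 0%nat)). lra. }
  assert (Hi : (0 < / r)%R) by (apply Rinv_0_lt_compat; lra).
  (* The factor [r^m] in the bound of [d m] compensates the [r^(-k-1)] in that of [B (S k)], since
     [k <= m]; what is left is [th^m] and a constant. *)
  assert (Hu : forall m k, (k <= m)%nat -> (Cmod (u k m) <= K * H * M * / r * th ^ m)%R).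
  { intros m k Hk. assert (Htm : (0 <= th ^ m)%R) by (apply pow_le; lra).
    unfold u. destruct (Nat.even k).
    - rewrite !Cmod_mult.
      assert (B1 := Hd m). assert (B2 := BH (m - k)%nat). assert (B3 := HM (S k)).
      assert (Hrk : (0 < r ^ S k)%R) by (apply pow_lt; lra).
      assert (B4 : (Cmod (B (S k)) <= M * / r ^ S k)%R).
      { apply Rmult_le_reg_r with (r ^ S k)%R; [easy|]. rewrite Rmult_assoc, Rinv_l; lra. }
      eapply Rle_trans.
      { apply Rmult_le_compat; [apply Cmod_ge_0| |exact B1|].
        - apply Rmult_le_pos; apply Cmod_ge_0.
        - apply Rmult_le_compat; [apply Cmod_ge_0|apply Cmod_ge_0|exact B2|exact B4]. }
      rewrite Rpow_mult_distr.
      replace (r ^ m)%R with (r ^ k * r ^ (m - k))%R by (rewrite <- pow_add; f_equal; lia).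
      assert (Hrm : (0 <= r ^ (m - k) <= 1)%R).
      { split; [apply pow_le; lra|]. rewrite <- (pow1 (m - k)). apply pow_incr. lra. }
      replace (K * (th ^ m * (r ^ k * r ^ (m - k))) * (H * (M * / r ^ S k)))%R
        with (K * H * M * / r * th ^ m * r ^ (m - k))%R.
      2: { simpl. field. split; [apply pow_nonzero; lra|lra]. }
      rewrite <- (Rmult_1_r (K * H * M * / r * th ^ m)) at 2. apply Rmult_le_compat_l; [|lra].
      repeat apply Rmult_le_pos; lra.
    - rewrite Cmod_0. repeat apply Rmult_le_pos; lra. }
  destruct (triangular_geom u _ th ltac:(lra) Hu) as [MM HMM].
  destruct (triangular_diag_summable u MM HMM) as [s Hs].
  set (R := fun k => if Nat.even k then / RtoC (gamma q) ^ k * AW_iter q k f (eta q) * B (S k) else 0).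
  assert (HR : cv (csum R) s).
  { apply (fubini_triangular u); [now exists MM| |easy]. intros k. unfold R, u.
    destruct (Nat.even k).
    - rewrite Cmult_comm. apply cv_ext_from with 0%nat (fun n => B (S k) * csum (fun j => d (k + j)%nat * en q j (eta q)) n).
      + intros n _. rewrite <- csum_scal. apply csum_ext. intros j _.
        replace (k + j - k)%nat with j by lia. ring.
      + apply cv_scal. now apply AW_iter_eta.
    - apply cv_ext_from with 0%nat (fun _ => RtoC 0); [|apply cv_const].
      intros n _. symmetry. now apply csum_zero. }
  assert (Even : forall a l, cv (csum a) l -> (forall k, a (2 * k + 1)%nat = 0) -> cv (csum (fun k => a (2 * k)%nat)) l).
  { intros a l Ha Hz. apply (cv_subseq (fun n => (2 * n)%nat)) in Ha; [|lia].
    refine (cv_ext_from 0 _ _ _ _ Ha). intros n _. rewrite csum_parity.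
    rewrite (csum_zero (fun k => a (2 * k + 1)%nat)) by auto. ring. }
  assert (Ev2 : forall k, Nat.even (2 * k) = true) by (intros; now rewrite Nat.even_mul).
  assert (Ev1 : forall k, Nat.even (2 * k + 1) = false) by (intros; now rewrite Nat.even_add, Ev2).
  set (v := fun m => if Nat.even m then d m * csum (fun k => B k * alt_eta q (S m - k)) (S (S m)) else 0).
  (* Convergence of the [qbeta] series is read off from the identity: its partial sums are those
     over columns minus half those of the expansion of [f x]. *)
  assert (Hv : cv (csum v) (s - / 2 * f x)).
  { apply cv_ext_from with 0%nat (fun n => csum (fun m => csum (fun k => u k m) (S m)) n
        - / 2 * csum (fun m => d m * en q m x) n).
    - intros n _. rewrite <- csum_scal, <- csum_minus. apply csum_ext. intros m _.
      assert (D := bernoulli_diagonal q B (fun n => en q n x) m HB).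
      transitivity (d m * (csum (fun k => if Nat.even k then en q (m - k) (eta q) * B (S k) else 0) (S m) - en q m x / 2)).
      + replace (csum (fun k => u k m) (S m))
          with (d m * csum (fun k => if Nat.even k then en q (m - k) (eta q) * B (S k) else 0) (S m)).
        * unfold Cdiv. ring.
        * rewrite <- csum_scal. apply csum_ext. intros k _. unfold u. destruct (Nat.even k); ring.
      + rewrite <- D. unfold v. destruct (Nat.even m); ring.
    - apply cv_minus; [easy|]. now apply cv_scal. }
  exists s, (s - / 2 * f x). split; [|split].
  - refine (cv_ext_from 0 _ _ _ _ (Even R s HR _)).
    + intros n _. apply csum_ext. intros k _. unfold R. rewrite Ev2, EB. now rewrite Nat.add_1_r.
    + intros k. unfold R. now rewrite Ev1.
  - refine (cv_ext_from 0 _ _ _ _ (Even v _ Hv _)).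
    + intros n _. apply csum_ext. intros k _. unfold v. rewrite Ev2, Ebeta, Nat.add_1_r. reflexivity.
    + intros k. unfold v. now rewrite Ev1.
  - field.
Qed.

(** * Reduction of the growth hypotheses and conclusion *)

Lemma q_exp_growth_bound q f : (0 < q < 1)%R ->
  ((exists k alpha : R, (k < 2 * ln (/ q))%R /\ q_exp_growth q f k alpha) \/
   (exists alpha : R, (alpha < 2 * ln 2 / ln (/ q))%R /\ q_exp_growth q f (2 * ln (/ q)) alpha)) ->
  exists K alpha, growth_bound q f K alpha.
Proof.
  intros Hq H. assert (HL := lnq_pos q Hq). set (L := ln (/ q)) in *.
  assert (El : (ln q ^ 2 = L ^ 2)%R). { unfold L. rewrite ln_Rinv by lra. ring. }
  destruct H as [[k [alpha [Hk [K [HK HG]]]]]|[alpha [Ha [K [HK HG]]]]].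
  (* [e] is the gap between the critical and the actual coefficient of [l ^ 2]. Since
     [alpha l <= e l^2 + alpha^2 / (4 e)], it absorbs the power of [|x|], and the type becomes 0. *)
  - set (e := (1 / L - k / (2 * L ^ 2))%R).
    assert (He : (0 < e)%R).
    { replace e with ((2 * L - k) * / (2 * L ^ 2))%R by (unfold e; field; lra).
      apply Rmult_lt_0_compat; [lra|]. apply Rinv_0_lt_compat. assert (0 < L ^ 2)%R by now apply pow_lt. lra. }
    exists (K * exp (alpha ^ 2 / (4 * e)))%R, 0%R. split; [|split].
    + apply Rmult_lt_0_compat; [easy|apply exp_pos].
    + rewrite Rmult_0_l. assert (0 < ln 2)%R; [|lra]. rewrite <- ln_1. apply ln_increasing; lra.
    + intros x Hx. eapply Rle_trans; [apply Rlt_le, HG, Hx|]. fold L. rewrite El. unfold Rpower.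
      set (l := ln (Cmod x)). rewrite !Rmult_assoc, <- !exp_plus. apply Rmult_le_compat_l; [lra|].
      apply exp_le_mono.
      assert (0 <= (alpha - 2 * e * l) ^ 2 / (4 * e))%R.
      { apply Rmult_le_pos; [apply pow2_ge_0|]. apply Rlt_le, Rinv_0_lt_compat. lra. }
      replace ((alpha - 2 * e * l) ^ 2 / (4 * e))%R with (alpha ^ 2 / (4 * e) - alpha * l + e * l ^ 2)%R in H by (field; lra).
      replace (e * l ^ 2)%R with (l ^ 2 / L - k * l ^ 2 / (2 * L ^ 2))%R in H by (unfold e; field; lra). lra.
  - exists K, alpha. split; [easy|split].
    + fold L. apply Rmult_lt_reg_r with (/ L)%R; [now apply Rinv_0_lt_compat|].
      rewrite Rmult_assoc, Rinv_r by lra. unfold Rdiv in Ha. lra.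
    + intros x Hx. eapply Rle_trans; [apply Rlt_le, HG, Hx|]. fold L. rewrite El. unfold Rpower.
      rewrite Rmult_assoc, <- exp_plus. right. do 2 f_equal. field. lra.
Qed.

Theorem theorem4 (q : R) (hq : (0 < q < 1)%R) (f : C -> C) (hf : entire f)
  (hgrowth :
     (exists k alpha : R,
        (k < 2 * ln (/ q))%R /\ q_exp_growth q f k alpha) \/
     (exists alpha : R,
        (alpha < 2 * ln 2 / ln (/ q))%R /\
        q_exp_growth q f (2 * ln (/ q)) alpha)) :
  (forall x : C,
     is_series (K := C_AbsRing) (V := C_NormedModule)
       (fun k => rho_coef q f k * rho q k x) (f x)) /\
  (forall w1 tau : R,
     smallest_positive_zero (qS q (eta q)) w1 ->
     LimSup_seq (fun n =>
       nroot n (Cmod (AW_iter q n f 0) * Rpower q (- INR n / 4))) = Finite tau ->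
     (0 < tau < Rmin 1 w1)%R ->
     forall x : C, exists s t : C,
       is_series (K := C_AbsRing) (V := C_NormedModule)
         (fun k => / RtoC (gamma q) ^ (2 * k) * AW_iter q (2 * k) f (eta q)
                   * qBernoulli q (2 * k + 1) x) s /\
       is_series (K := C_AbsRing) (V := C_NormedModule)
         (fun k => / RtoC (gamma q) ^ (2 * k) * AW_iter q (2 * k) f 0
                   * qbeta q (2 * k + 1) x) t /\
       f x = 2 * s - 2 * t).
Proof.
  destruct (q_exp_growth_bound q f hq hgrowth) as [K [alpha HG]].
  assert (H := en_expansion q f K alpha hq (entire_cdiff f hf) HG).
  split.
  - intros x. apply is_series_cv. refine (cv_ext_from 0 _ _ _ _ (H x)).
    intros n _. apply csum_ext. intros k _. symmetry. now apply rho_coef_en.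
  - intros w1 tau _ HL Ht x. assert (R1 := Rmin_l 1 w1).
    destruct (dcoef_geometric q f tau hq ltac:(lra) HL) as [th [K' [Hth Hd]]].
    destruct (bernoulli_expansion q f th K' x hq Hth H Hd) as [s [t [Hs [Ht' E]]]].
    exists s, t. now rewrite !is_series_cv.
Qed.
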